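(* Let $d\ge 1$, $\tau>2$, $0<\alpha<d$ and $\sigma\in(0,\tau-1)$, and let $\mu_{\sigma,\tau}$ be the limiting spectral distribution of the scaled adjacency matrices $\mathbf{A}_N$ of the kernel-based random graph with these parameters. Then the second moment of $\mu_{\sigma,\tau}$ is given by $$\int_{\mathbb{R}}x^2\,\mu_{\sigma,\tau}(\mathrm{d}x)=(\tau-1)^2\int_1^\infty\int_1^\infty\frac{1}{(x\wedge y)^{\tau-\sigma}(x\vee y)^{\tau-1}}\,\mathrm{d}x\,\mathrm{d}y\in(0,\infty).$$ Moreover, for $p\in\mathbb{N}$ with $p<\frac{\tau-1}{\sigma\vee 1}$, one has $\int_{\mathbb{R}}|x|^{2p}\,\mu_{\sigma,\tau}(\mathrm{d}x)<\infty$.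
   Context: Notation: $a\wedge b=\min(a,b)$, $a\vee b=\max(a,b)$. The vertex set $\mathbf{V}_N=\{1,\dots,N\}^d$ carries the torus distance $\|i-j\|=\sum_{\ell=1}^d |i_\ell-j_\ell|\wedge(N-|i_\ell-j_\ell|)$. The weights $(W_i)_{i\in\mathbf{V}_N}$ are i.i.d. Pareto with $\mathbf{P}(W>t)=t^{-(\tau-1)}$ for $t\ge 1$ and $\mathbf{P}(W>t)=1$ for $t<1$. The kernel is $\kappa_\sigma(w,v)=(w\vee v)(w\wedge v)^\sigma$. Conditionally on the weights, distinct vertices $i,j$ are joined by an undirected edge, independently over pairs, with probability $\frac{\kappa_\sigma(W_i,W_j)}{\|i-j\|^\alpha}\wedge 1$; no self-loops. $\mathbb{P}$ is the joint law of weights and edges. With $\mathbb{A}_{\mathbb{G}_N}$ the adjacency matrix, let $c_N=\frac{1}{N^d}\sum_{i\ne j\in\mathbf{V}_N}\|i-j\|^{-\alpha}$ and $\mathbf{A}_N=\mathbb{A}_{\mathbb{G}_N}/\sqrt{c_N}$. For $\tau>2$, $0<\alpha<d$, $\sigma\in(0,\tau-1)$, the empirical spectral distribution $\mathrm{ESD}(\mathbf{A}_N)=\frac{1}{N^d}\sum_i\delta_{\lambda_i(\mathbf{A}_N)}$ converges weakly in $\mathbb{P}$-probability (i.e. in Lévy–Prokhorov distance, in probability) to a deterministic probability measure denoted $\mu_{\sigma,\tau}$, called the limiting spectral distribution. *)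

(* Defs.v *)
From HB Require Import structures.
From mathcomp Require Import all_boot all_order all_algebra.
From mathcomp Require Import polyrcf.
From mathcomp Require Import all_classical all_reals all_analysis.

Set Implicit Arguments.
Unset Strict Implicit.
Unset Printing Implicit Defensive.

Import Order.TTheory GRing.Theory Num.Theory.
Import numFieldNormedType.Exports.

Local Open Scope classical_set_scope.
Local Open Scope ring_scope.

(* Coordinates run over {0, ..., N-1} rather than {1, ..., N}; only their
   differences matter. *)
Definition vertex (d N : nat) : finType := {ffun 'I_d -> 'I_N}.

Definition torus_dist (d N : nat) (i j : vertex d N) : nat :=
  \sum_(l < d) minn `|i l - j l|%N (N - `|i l - j l|%N)%N.

Section KernelBasedRandomGraph.
Context {R : realType}.

Definition kernel (sigma w v : R) : R :=
  Num.max w v * (Num.min w v) `^ sigma.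

Definition edge_prob (d N : nat) (alpha sigma : R) (w : vertex d N -> R)
    (i j : vertex d N) : R :=
  Num.min (kernel sigma (w i) (w j) / (torus_dist i j)%:R `^ alpha) 1.

(* The conditional probability, given the weights w, of the edge configuration
   g. Each unordered pair of distinct vertices is counted once, through its
   representative (i, j) with enum_rank i < enum_rank j. *)
Definition config_prob (d N : nat) (alpha sigma : R) (w : vertex d N -> R)
    (g : rel (vertex d N)) : R :=
  \prod_i \prod_(j | (enum_rank i < enum_rank j)%N)
    if g i j then edge_prob alpha sigma w i j
    else 1 - edge_prob alpha sigma w i j.

(* The last field is the conditional law of the edges given the weights: it
   integrates the conditional probability of every edge configuration over
   the weight events {W_i \in B_i for all i}, a pi-system generating the
   sigma-algebra of the weights. *)
Record kernel_graph (d N : nat) (tau alpha sigma : R) := KernelGraph {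
  kg_display : measure_display;
  kg_space : measurableType kg_display;
  kg_prob : probability kg_space R;
  kg_weight : vertex d N -> {RV kg_prob >-> R};
  kg_edge : kg_space -> rel (vertex d N);
  kg_weight_pareto : forall (i : vertex d N) (t : R),
    kg_prob [set omega | t < kg_weight i omega] =
    (if 1 <= t then t `^ (- (tau - 1)) else 1)%:E;
  kg_weight_indep : forall B : vertex d N -> set R,
    (forall i, measurable (B i)) ->
    kg_prob [set omega | forall i, B i (kg_weight i omega)] =
    (\prod_i kg_prob (kg_weight i @^-1` B i))%E;
  kg_edge_measurable : forall i j : vertex d N,
    measurable [set omega | kg_edge omega i j];
  kg_edge_sym : forall omega, symmetric (kg_edge omega);
  kg_edge_irrefl : forall omega, irreflexive (kg_edge omega);
  kg_edge_law : forall (B : vertex d N -> set R) (g : rel (vertex d N)),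
    (forall i, measurable (B i)) ->
    kg_prob [set omega | (forall i, B i (kg_weight i omega)) /\
      (forall i j, (enum_rank i < enum_rank j)%N ->
        kg_edge omega i j = g i j)] =
    (\int[kg_prob]_(omega in [set omega | forall i, B i (kg_weight i omega)])
      (config_prob alpha sigma (fun i => kg_weight i omega) g)%:E)%E }.

Definition adjacency (d N : nat) (g : rel (vertex d N)) :
    'M[R]_(#|vertex d N|) :=
  \matrix_(a, b) (g (enum_val a) (enum_val b))%:R.

(* The sum is over ordered pairs of distinct vertices. *)
Definition scaling (d N : nat) (alpha : R) : R :=
  ((N ^ d)%:R)^-1 *
  \sum_(i : vertex d N) \sum_(j : vertex d N | i != j)
    ((torus_dist i j)%:R `^ alpha)^-1.

Definition scaled_adjacency (d N : nat) (alpha : R) (g : rel (vertex d N)) :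
    'M[R]_(#|vertex d N|) :=
  (Num.sqrt (scaling d N alpha))^-1 *: adjacency g.

(* Real eigenvalues, repeated according to their algebraic multiplicity; for a
   symmetric matrix this is the whole spectrum. *)
Definition eigenvalues (n : nat) (A : 'M[R]_n) : seq R :=
  flatten [seq nseq (mup x (char_poly A)) x | x <- rootsR (char_poly A)].

Definition ESD (n : nat) (A : 'M[R]_n) :
    {measure set (measurableTypeR R) -> \bar R} :=
  mscale ((n%:R : R)^-1)%:nng
    (msum (fun k => dirac ((eigenvalues A)`_k : measurableTypeR R))
      (size (eigenvalues A))).

(* The defining set is nonempty and bounded below by 0 for finite measures. *)
Definition levy_prokhorov
    (mu nu : {measure set (measurableTypeR R) -> \bar R}) : R :=
  inf [set e : R | 0 < e /\
    forall A : set (measurableTypeR R), measurable A ->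
      (mu A <= nu (\bigcup_(a in A) ball (a : R) e) + e%:E)%E /\
      (nu A <= mu (\bigcup_(a in A) ball (a : R) e) + e%:E)%E].

(* Weak convergence in probability of the empirical spectral distributions to
   mu. Since mu is deterministic only the law of each graph matters, so the
   graphs need not live on a common probability space. *)
Definition limiting_spectral_distribution (d : nat) (tau alpha sigma : R)
    (G : forall N, kernel_graph d N tau alpha sigma)
    (mu : probability (measurableTypeR R) R) : Prop :=
  forall eps : R, 0 < eps ->
    (fun N => kg_prob (G N) [set omega |
       eps < levy_prokhorov (ESD (scaled_adjacency alpha (kg_edge omega))) mu])
    @ \oo --> 0%E.

End KernelBasedRandomGraph.

(* Main.v *)
(* Write A for the scaled adjacency matrix. Keep only the entries between
   vertices of weight at most m (for m large) and centre them: this gives X with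
   independent centred entries given the weights, and A = X + Y. In E tr X^{2k}
   only the closed walks crossing every edge at least twice contribute; bounding
   the kernel by a product of powers of the two weights makes the expectation
   factorise over the visited vertices, and E tr X^{2k} / N^d is bounded
   uniformly in N, even uniformly in m if k < (tau-1)/(sigma \/ 1). Since kappa
   has a moment of order 1 + eta, E |Y|_F^2 / N^d is at most a constant times
   m^{-eta} + o(1). A doubly stochastic coupling of the spectra of A and X (as in
   the Hoffman-Wielandt inequality) compares truncated moments of ESD(A) with
   traces of powers of X. For the 2p-th moment this is a bound uniform in the
   truncation level. The second moment of ESD(A) has expectation tending to
   E kappa(W_1, W_2), and for coupled eigenvalues l of A and x of X
     l^2 - min(|l|, T)^2 <= 16 x^4 / T^2 + 4 (l - x)^2,
   so the fourth moment of X controls the second-moment mass of A beyond T and no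
   mass escapes in the limit. *)
Require Import Defs.
From HB Require Import structures.
From mathcomp Require Import all_boot all_order all_algebra.
From mathcomp Require Import polyrcf complex.
From mathcomp Require Import all_classical all_reals all_analysis.
From mathcomp Require Import measurable_realfun.
From mathcomp Require Import ring lra zify.
Import Order.TTheory GRing.Theory Num.Theory.
Import numFieldNormedType.Exports.
Set Implicit Arguments.
Unset Strict Implicit.
Unset Printing Implicit Defensive.
Local Open Scope classical_set_scope.
Local Open Scope ring_scope.

(** * Spectra of symmetric matrices *)

(** Nothing is known of [mu] beyond the weak limit in probability, so information reaches it only
    through bounded Lipschitz test functions, here the truncated powers min(|x|, T)^q. Traces of
    high powers of A itself are useless: the weights have too few moments and the expected traces
    may blow up. Hence the cutoff m, with an error measured in Frobenius norm, where kernel moments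
    of order 1 + eta suffice. The condition alpha < d enters through c_N -> infinity, which makes
    most edge probabilities small: the sum over v of ||u - v||^(-alpha (1 + eta)) is o(c_N). This
    bounds both the cost of the cap at 1 in the edge probabilities and the cost of the centring. The
    moment threshold comes from the walks. A contributing walk of length 2k has at most k fresh
    steps, so a vertex has degree at most k in their tree; with kappa(x, y) <= (x y)^(sigma \/ 1), a
    weight moment of order k (sigma \/ 1) is required, and it is finite below tau - 1. *)

Section Spectral.
Local Open Scope sesquilinear_scope.
Variable R : realType.
Local Notation toC := (real_complex R).
Local Notation mxC := (map_mx (real_complex R)).

(** A real symmetric matrix is Hermitian over [R[i]], and its unitary diagonalisation has real
    eigenvalues, so the diagonal is a real row. The matrix [P] may stay complex: only squared moduli
    of inner products of eigenvectors are used later. *)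
Lemma real_spectral n (A : 'M[R]_n) : A^T = A ->
  exists (P : 'M[R[i]]_n) (l : 'rV[R]_n), P \is unitarymx /\
    mxC A = invmx P *m diag_mx (mxC l) *m P.
Proof.
move=> symA.
have hA : mxC A \is hermsymmx.
  apply: realsym_hermsym.
    apply/is_hermitianmxP; rewrite expr0 scale1r map_mx_id //.
    by apply/matrixP => i j; rewrite !mxE -{1}symA mxE.
  by apply/mxOverP => i j; rewrite mxE; apply/complex_realP; exists (A i j).
exists (spectralmx (mxC A)), (map_mx (@complex.Re R) (spectral_diag (mxC A))).
split; first exact: spectral_unitarymx.
rewrite -map_mx_comp (_ : map_mx _ _ = spectral_diag (mxC A)).
  by apply/orthomx_spectralP/hermitian_normalmx.
apply/matrixP => i j; rewrite !mxE /=; apply: RRe_real.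
by move: (hermitian_spectral_diag_real hA) => /mxOverP.
Qed.

Lemma mup_prod_XsubC (F : fieldType) (s : seq F) x :
  mup x (\prod_(y <- s) ('X - y%:P)) = count_mem x s.
Proof.
elim: s => [|a s IH]; first by rewrite big_nil mupNroot ?root1.
rewrite big_cons mupM ?polyXsubC_eq0 ?monic_neq0 ?monic_prod_XsubC//= IH.
by rewrite -['X - a%:P]expr1 mup_XsubCX eq_sym; case: eqP.
Qed.

(** Both lists contain each value as often as its multiplicity as a root; [eigenvalues] merely
    groups them by distinct root. *)
Lemma eigenvalues_perm n (A : 'M[R]_n) (l : 'rV[R]_n) :
  char_poly A = \prod_(i < n) ('X - (l 0 i)%:P) ->
  perm_eq (eigenvalues A) [seq l 0 i | i <- enum 'I_n].
Proof.
move=> cA; set s := [seq _ | _ <- _].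
have cAs : char_poly A = \prod_(y <- s) ('X - y%:P).
  by rewrite cA big_map -big_enum.
have c0 : char_poly A != 0 by rewrite monic_neq0 ?char_poly_monic.
have ur : uniq (rootsR (char_poly A)).
  by apply: (sorted_uniq (@lt_trans _ R) ltxx); exact: sorted_roots.
have mr x : (x \in rootsR (char_poly A)) = (x \in s).
  have := roots_on_rootsR c0 => /(_ x); rewrite in_itv /= => <-.
  by rewrite cAs root_prod_XsubC.
apply: perm_trans (perm_count_undup s); rewrite /eigenvalues.
under eq_map => x do rewrite cAs mup_prod_XsubC.
apply/perm_flatten/perm_map/uniq_perm => //; first exact: undup_uniq.
by move=> x; rewrite mr mem_undup.
Qed.

Lemma char_poly_unitary n (A : 'M[R]_n) (P : 'M[R[i]]_n) (l : 'rV[R]_n) :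
  P \is unitarymx -> mxC A = invmx P *m diag_mx (mxC l) *m P ->
  char_poly A = \prod_(i < n) ('X - (l 0 i)%:P).
Proof.
move=> uP eA; apply: (map_poly_inj (real_complex R)).
have uu := unitarymx_unit uP.
have cC : map_poly toC (\prod_(i < n) ('X - (l 0 i)%:P)) =
    char_poly (diag_mx (mxC l)).
  rewrite char_poly_trig ?diag_mx_is_trig // rmorph_prod.
  apply: eq_bigr => i _.
  by rewrite rmorphB /= map_polyX map_polyC !mxE eqxx mulr1n.
rewrite cC map_char_poly eA /char_poly.
set Q := map_mx polyC P; set Qi := map_mx polyC (invmx P).
have QiQ : Qi *m Q = 1%:M by rewrite -map_mxM mulVmx // map_mx1.
have -> : char_poly_mx (invmx P *m diag_mx (mxC l) *m P) =
    Qi *m char_poly_mx (diag_mx (mxC l)) *m Q.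
  rewrite /char_poly_mx mulmxBr mulmxBl !map_mxM -/Q -/Qi; congr (_ - _).
  by rewrite mul_mx_scalar -scalemxAl QiQ scalemx1.
by rewrite !det_mulmx mulrAC -det_mulmx QiQ det1 mul1r.
Qed.

Lemma mulmx_diag_conj (F : fieldType) n (P : 'M[F]_n) (d e : 'rV[F]_n) :
  P \in unitmx ->
  (invmx P *m diag_mx d *m P) *m (invmx P *m diag_mx e *m P) =
  invmx P *m diag_mx (\row_j (d 0 j * e 0 j)) *m P.
Proof.
by move=> uP; rewrite !mulmxA mulmxK // -(mulmxA (invmx P)) mulmx_diag.
Qed.

Lemma trace_expmx_unitary n (A : 'M[R]_n) (P : 'M[R[i]]_n) (l : 'rV[R]_n) k :
  P \is unitarymx -> mxC A = invmx P *m diag_mx (mxC l) *m P ->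
  \tr (iter k (mulmx A) 1%:M) = \sum_i l 0 i ^+ k.
Proof.
move=> uP eA; apply: (@complexI R).
have uu := unitarymx_unit uP.
have E : mxC (iter k (mulmx A) 1%:M) =
    invmx P *m diag_mx (map_mx (fun x => toC (x ^+ k)) l) *m P.
  elim: k => [|k IH] /=.
    rewrite map_mx1 (_ : diag_mx _ = 1%:M) ?mulmx1 ?mulVmx//.
    by apply/matrixP => i j; rewrite !mxE expr0 rmorph1.
  have -> : map_mx (fun x => toC (x ^+ k.+1)) l =
      \row_j (mxC l 0 j * map_mx (fun x => toC (x ^+ k)) l 0 j).
    by apply/rowP => j; rewrite !mxE exprS rmorphM.
  by rewrite map_mxM IH eA; exact: mulmx_diag_conj.
rewrite -[LHS]trace_map_mx E -mulmxA mxtrace_mulC -mulmxA mulmxV// mulmx1.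
rewrite mxtrace_diag rmorph_sum; apply: eq_bigr => i _; rewrite mxE.
by [].
Qed.

(** This is the cross term of the Hoffman-Wielandt identity. For unitary [P] and [Q] the last two
    factors are conjugate, so their product is a squared modulus. *)
Lemma trace_mul_diag_conj (F : fieldType) n (P Q : 'M[F]_n) (d e : 'rV[F]_n) :
  \tr ((invmx P *m diag_mx d *m P) *m (invmx Q *m diag_mx e *m Q)) =
  \sum_i \sum_k d 0 i * e 0 k * ((P *m invmx Q) i k * (Q *m invmx P) k i).
Proof.
have -> : (invmx P *m diag_mx d *m P) *m (invmx Q *m diag_mx e *m Q) =
    invmx P *m (diag_mx d *m ((P *m invmx Q) *m (diag_mx e *m Q))).
  by rewrite !mulmxA.
rewrite mxtrace_mulC.
have -> : diag_mx d *m ((P *m invmx Q) *m (diag_mx e *m Q)) *m invmx P =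
    diag_mx d *m ((P *m invmx Q) *m (diag_mx e *m (Q *m invmx P))).
  by rewrite !mulmxA.
apply: eq_bigr => i _; rewrite mul_diag_mx [LHS]mxE [in LHS]mxE mulr_sumr.
by apply: eq_bigr => k _; rewrite mul_diag_mx [in LHS]mxE; ring.
Qed.

Lemma unitarymx_mulV (C : numClosedFieldType) n (P Q : 'M[C]_n) :
  P \is unitarymx -> Q \is unitarymx ->
  P *m invmx Q \is unitarymx /\ Q *m invmx P = (P *m invmx Q)^t*.
Proof.
move=> uP uQ; rewrite !invmx_unitary // trmx_mul map_mxM trmxCK.
by rewrite mul_unitarymx // trmxC_unitary.
Qed.

Lemma sum_sqr_trace n (A : 'M[R]_n) : A^T = A ->
  \sum_i \sum_j A i j ^+ 2 = \tr (A *m A).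
Proof.
move=> symA; apply: eq_bigr => i _; rewrite mxE; apply: eq_bigr => j _.
by rewrite expr2 -{2}symA mxE.
Qed.

(** Squared moduli of the entries of a unitary matrix are doubly stochastic: row sums come from U U*
    = 1, column sums from U* U = 1. No permutation has to be extracted, since averages against [S]
    are enough. *)
Lemma unitary_coupling n (U : 'M[R[i]]_n) : U \is unitarymx ->
  exists S : 'I_n -> 'I_n -> R, [/\ forall i k, 0 <= S i k,
    forall i, \sum_k S i k = 1, forall k, \sum_i S i k = 1 &
    forall i k, toC (S i k) = U i k * (U^t*) k i].
Proof.
move=> uU; exists (fun i k => complex.Re (`|U i k| ^+ 2)).
have S_E i k : toC (complex.Re (`|U i k| ^+ 2)) = U i k * (U^t*) k i.
  by rewrite RRe_real ?rpredX ?normr_real // normCK !mxE.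
split=> // [i k|i|k].
- by rewrite -lecR S_E !mxE -normCK exprn_ge0.
- apply: (@complexI R); rewrite rmorph_sum rmorph1 (eq_bigr _ (fun k _ => S_E i k)).
  have := unitarymxP uU => /matrixP /(_ i i); rewrite !mxE eqxx mulr1n => <-.
  by apply: eq_bigr => k _; rewrite !mxE.
- apply: (@complexI R); rewrite rmorph_sum rmorph1 (eq_bigr _ (fun i _ => S_E i k)).
  have := mulVmx (unitarymx_unit uU); rewrite invmx_unitary //.
  move=> /matrixP /(_ k k); rewrite !mxE eqxx mulr1n => <-.
  by apply: eq_bigr => i _; rewrite !mxE mulrC.
Qed.

(* S i k is the squared modulus of the inner product of the i-th eigenvector of
   A with the k-th eigenvector of X. *)
Lemma spectral_coupling n (A X : 'M[R]_n) : A^T = A -> X^T = X ->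
  exists (l x : 'I_n -> R) (S : 'I_n -> 'I_n -> R),
  [/\ perm_eq (eigenvalues A) [seq l i | i <- enum 'I_n],
      [/\ forall i k, 0 <= S i k, forall i, \sum_k S i k = 1 &
          forall k, \sum_i S i k = 1],
      \sum_i \sum_k S i k * (l i - x k) ^+ 2 =
        \sum_i \sum_j (A i j - X i j) ^+ 2,
      \sum_i l i ^+ 2 = \sum_i \sum_j A i j ^+ 2 &
      forall q, \sum_k x k ^+ q = \tr (iter q (mulmx X) 1%:M)].
Proof.
move=> symA symX.
have [P [l [uP eA]]] := real_spectral symA.
have [Q [x [uQ eX]]] := real_spectral symX.
have [uU VE] := unitarymx_mulV uP uQ.
have [S [S0 Sr Sc SE]] := unitary_coupling uU.
have trX q := trace_expmx_unitary q uQ eX.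
have trA := trace_expmx_unitary 2 uP eA.
exists (l 0), (x 0), S; split=> //.
- exact/eigenvalues_perm/(char_poly_unitary uP).
- have trAX : \tr (A *m X) = \sum_i \sum_k S i k * (l 0 i * x 0 k).
    apply: (@complexI R); rewrite -[LHS]trace_map_mx map_mxM eA eX.
    rewrite trace_mul_diag_conj rmorph_sum.
    apply: eq_bigr => i _; rewrite rmorph_sum; apply: eq_bigr => k _.
    by rewrite VE !rmorphM /= SE ![mxC _ _ _]mxE [in RHS]mulrC.
  (* Both sides consist of two squares and a cross term. The squares match because [S] has row and
     column sums 1, and tr(AX) matches by the choice of [S]. *)
  have -> : \sum_i \sum_j (A i j - X i j) ^+ 2 =
      \tr (A *m A) - 2 * \tr (A *m X) + \tr (X *m X).
    have symAX : (A - X)^T = A - X by rewrite linearB /= symA symX.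
    transitivity (\tr ((A - X) *m (A - X))).
      rewrite -sum_sqr_trace //.
      by apply: eq_bigr => i _; apply: eq_bigr => j _; rewrite !mxE.
    have -> : (A - X) *m (A - X) = A *m A - A *m X - (X *m A - X *m X).
      by rewrite mulmxBl !mulmxBr.
    rewrite !raddfB /= (mxtrace_mulC X A).
    by ring.
  move: trA (trX 2%N); rewrite /= !mulmx1 => -> ->; rewrite trAX.
  have -> : \sum_i l 0 i ^+ 2 = \sum_i \sum_k S i k * l 0 i ^+ 2.
    by apply: eq_bigr => i _; rewrite -mulr_suml Sr mul1r.
  have -> : \sum_i x 0 i ^+ 2 = \sum_i \sum_k S i k * x 0 k ^+ 2.
    rewrite exchange_big /=.
    by apply: eq_bigr => i _; rewrite -mulr_suml Sc mul1r.
  rewrite mulr_sumr -sumrB -big_split; apply: eq_bigr => i _ /=.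
  rewrite mulr_sumr -sumrB -big_split; apply: eq_bigr => k _ /=.
  by ring.
- by rewrite sum_sqr_trace // -trA /= mulmx1.
Qed.

End Spectral.

(** * Walks and centred edge indicators *)

Section Walks.
Variable V : finType.

Fixpoint walks (k : nat) : seq (seq V) :=
  if k is k'.+1 then [seq v :: t | v <- enum V, t <- walks k'] else [:: [::]].

Lemma size_walks k t : t \in walks k -> size t = k.
Proof.
elim: k t => [|k IH] t /=; first by rewrite inE => /eqP ->.
by move=> /allpairsP[[v t'] /= [_ /IH <- ->]].
Qed.

Lemma big_walksS (R : nmodType) k (F : seq V -> R) :
  \sum_(t <- walks k.+1) F t = \sum_v \sum_(t <- walks k) F (v :: t).
Proof. by rewrite big_allpairs_dep big_enum. Qed.

(** [zip] stops with the shorter list, so the last vertex of [u :: t] starts no step. *)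
Definition steps (u : V) (t : seq V) : seq (V * V) := zip (u :: t) t.

(* s lists the vertices visited so far; the fresh steps, those reaching a new
   vertex, span a tree. *)
Fixpoint fresh_steps (u : V) (s t : seq V) : seq (V * V) :=
  if t is v :: t' then
    if v \in s then fresh_steps v (v :: s) t'
    else (u, v) :: fresh_steps v (v :: s) t'
  else [::].

Definition walk_prod (R : pzSemiRingType) (X : V -> V -> R) u t :=
  \prod_(e <- steps u t) X e.1 e.2.

Lemma trace_walks (R : comNzRingType) (X : V -> V -> R) L :
  \tr (iter L (mulmx (\matrix_(i, j) X (enum_val i) (enum_val j))) 1%:M :
       'M[R]_(#|V|)) =
  \sum_u \sum_(t <- walks L | last u t == u) walk_prod X u t.
Proof.
set A := \matrix_(i, j) _.
have E k i j : (iter k (mulmx A) 1%:M : 'M[R]_(#|V|)) i j =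
    \sum_(t <- walks k | last (enum_val i) t == enum_val j)
      walk_prod X (enum_val i) t.
  elim: k i => [|k IH] i.
    rewrite big_mkcond big_seq1 /= (inj_eq enum_val_inj) mxE /walk_prod big_nil.
    by case: eqP.
  rewrite iterS mxE [RHS]big_mkcond big_walksS
    [RHS](reindex _ (onW_bij _ (enum_val_bij V))) /=.
  apply: eq_bigr => m _; rewrite IH mulr_sumr [LHS]big_mkcond /=.
  apply: eq_bigr => t _; rewrite /walk_prod big_cons mxE.
  by case: ifP.
rewrite /mxtrace [RHS](reindex _ (onW_bij _ (enum_val_bij V))) /=.
by apply: eq_bigr => i _; exact: E.
Qed.

Section FreshWeight.
Variables (R : numDomainType) (rho : V -> V -> R).
Hypothesis rho0 : forall u v, 0 <= rho u v.
Hypothesis rho1 : forall u, \sum_v rho u v <= 1.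

(** The next vertex is either one of those in [s], at no cost, or a fresh one, and then [rho u] has
    total mass at most 1. Each step thus multiplies the sum by at most [size s + 1], a number that
    does not depend on the size of [V]. *)
Lemma sum_fresh_steps k u s :
  \sum_(t <- walks k) \prod_(e <- fresh_steps u s t) rho e.1 e.2
    <= ((size s + k) ^ k)%:R.
Proof.
elim: k u s => [|k IH] u s; first by rewrite big_seq1 big_nil expn0.
rewrite big_walksS.
have -> : ((size s + k.+1) ^ k.+1)%:R =
    (size s + k.+1)%:R * ((size s + k.+1) ^ k)%:R :> R.
  by rewrite -natrM expnS.
apply: (@le_trans _ _ (\sum_v ((v \in s)%:R + rho u v) *
                       ((size s + k.+1) ^ k)%:R)).
  apply: ler_sum => v _ /=; have := IH v (v :: s); rewrite /= addSnnS => IHv.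
  have [vs|vs] := boolP (v \in s).
    apply: le_trans IHv _; rewrite mulrDl mul1r lerDl.
    by rewrite mulr_ge0 // ler0n.
  rewrite add0r; under eq_bigr do rewrite big_cons /=.
  by rewrite -mulr_sumr; apply: ler_wpM2l.
rewrite -mulr_suml; apply: ler_wpM2r; first exact: ler0n.
rewrite big_split /= natrD; apply: lerD; last first.
  by apply: le_trans (rho1 u) _; rewrite ler1n.
by rewrite -natr_sum ler_nat -big_mkcond /= sum1_card card_size.
Qed.
End FreshWeight.

Lemma fresh_stepsP u s t e : u \in s -> e \in fresh_steps u s t ->
  [/\ e.2 \notin s, e.1 != e.2, e.1 \in u :: t & e.2 \in u :: t].
Proof.
elim: t u s => [//|v t IH] u s us /=.
have tl : e \in fresh_steps v (v :: s) t ->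
    [/\ e.2 \notin s, e.1 != e.2, e.1 \in u :: v :: t & e.2 \in u :: v :: t].
  move=> /(IH _ _ (mem_head _ _)) [].
  rewrite inE negb_or => /andP[_ e2] e12 h1 h2.
  by split; rewrite // inE ?h1 ?h2 orbT.
case: ifPn => [_ /tl //|vs]; rewrite inE => /predU1P[->|/tl //] /=.
split; rewrite ?inE ?eqxx ?orbT //.
by apply: contraNneq vs => <-.
Qed.

Lemma fresh_steps_sub u s t : {subset fresh_steps u s t <= steps u t}.
Proof.
elim: t u s => [//|v t IH] u s e /=; rewrite /steps /= inE.
by case: ifP => _; [move/IH->; rewrite orbT|
  rewrite inE => /predU1P[->|/IH ->]; rewrite ?eqxx ?orbT].
Qed.

(** The slot of a configuration that stores the edge [e]; a loop is its own representative. *)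
Definition canon_pair (e : V * V) : V * V :=
  if (enum_rank e.1 < enum_rank e.2)%N then e else (e.2, e.1).

Lemma canon_inj e f : canon_pair e = canon_pair f -> f = e \/ f = (e.2, e.1).
Proof.
by case: e f => [a b] [c d]; rewrite /canon_pair /=;
  case: ifP => _; case: ifP => _ [-> ->]; auto.
Qed.

Lemma canonC u v : canon_pair (u, v) = canon_pair (v, u).
Proof. by rewrite /canon_pair /=; case: ltngtP => //= /ord_inj/enum_rank_inj ->. Qed.

Lemma canon_lt e : e.1 != e.2 ->
  (enum_rank (canon_pair e).1 < enum_rank (canon_pair e).2)%N.
Proof.
case: e => a b /=; rewrite /canon_pair /= => ab.
case: (ltngtP (enum_rank a) (enum_rank b)) => //= /ord_inj/enum_rank_inj E.
by rewrite E eqxx in ab.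
Qed.

(** A later fresh step ends outside the list of visited vertices, which already contains both ends
    of the present one; so no edge repeats in either direction. *)
Lemma uniq_fresh_steps u s t : u \in s ->
  uniq [seq canon_pair e | e <- fresh_steps u s t].
Proof.
elim: t u s => [//|v t IH] u s us /=; case: ifPn => [vs|vs].
  by apply: IH; rewrite mem_head.
rewrite /= IH ?mem_head // andbT; apply/mapP => -[f fin].
have [f2 _ _ _] := fresh_stepsP (mem_head _ _) fin.
move=> /canon_inj [] fE; move: f2; rewrite fE /= !inE ?eqxx // us orbT //.
Qed.

(** The fresh steps use distinct edges, and the walk crosses each of them at least twice within its
    [size t] steps. *)
Lemma fresh_steps_twice u s t : u \in s ->
  let M := [seq canon_pair e | e <- steps u t] in
  (forall e, e \in M -> (2 <= count_mem e M)%N) ->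
  ((size (fresh_steps u s t)).*2 <= size t)%N.
Proof.
move=> us M M2.
have sM : size M = size t by rewrite size_map size_zip /= (minn_idPr _).
have /perm_size := perm_count_undup M; rewrite size_flatten sM => <-.
rewrite /shape -map_comp.
have -> : (size (fresh_steps u s t)) =
    size [seq canon_pair e | e <- fresh_steps u s t] by rewrite size_map.
apply: (@leq_trans (size (undup M)).*2).
  rewrite leq_double; apply: uniq_leq_size; first exact: uniq_fresh_steps.
  move=> e /mapP[f /fresh_steps_sub fs ->]; rewrite mem_undup.
  exact: map_f.
have : {subset undup M <= M} by move=> e; rewrite mem_undup.
elim: (undup M) => [//|e l IH] lM /=.
rewrite size_nseq doubleS -addn2 addnC; apply: leq_add.
  by apply: M2; apply: lM; rewrite mem_head.
by apply: IH => f fl; apply: lM; rewrite inE fl orbT.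
Qed.

(** The exponent of [y v] is the degree of [v] in the multigraph with edge list [l]. *)
Lemma prod_fresh_degree (R : comPzSemiRingType) (y : V -> R) (l : seq (V * V)) :
  \prod_(e <- l) (y e.1 * y e.2) =
  \prod_v y v ^+ (\sum_(e <- l) ((e.1 == v) + (e.2 == v)))%N.
Proof.
elim: l => [|e l IH].
  by rewrite big_nil big1 // => v _; rewrite big_nil expr0.
have P1 x : y x = \prod_v y v ^+ (x == v).
  by rewrite (bigD1 x) //= eqxx big1 ?mulr1 // => v; rewrite eq_sym; case: eqP.
rewrite big_cons IH (P1 e.1) (P1 e.2) -!big_split /=.
by apply: eq_bigr => v _; rewrite big_cons !exprD.
Qed.

End Walks.

(** * Conditional law of the edges given the weights *)

Section Config.
Variables (R : realType) (V : finType) (p : V -> V -> R).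

(* A configuration only uses the slots (u, v) with enum_rank u < enum_rank v; the
   other slots are false almost surely. *)
Definition slot_prob (e : V * V) (x : bool) : R :=
  if (enum_rank e.1 < enum_rank e.2)%N
  then if x then p e.1 e.2 else 1 - p e.1 e.2 else (~~ x)%:R.

Definition config_weight (g : {ffun V * V -> bool}) : R :=
  \prod_e slot_prob e (g e).

Definition graph_of (g : {ffun V * V -> bool}) (u v : V) : bool :=
  g (canon_pair (u, v)).

(** Conditional independence of the edges: [config_weight] is a product measure, so the mean of a
    product over slots is the product of the means. *)
Lemma sum_config_prod (h : V * V -> bool -> R) :
  \sum_g config_weight g * \prod_e h e (g e) =
  \prod_e \sum_x slot_prob e x * h e x.
Proof.
rewrite bigA_distr_bigA /=; apply: eq_bigr => g _.
by rewrite -big_split.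
Qed.

Lemma sum_slot e : \sum_x slot_prob e x = 1.
Proof.
rewrite big_bool /slot_prob; case: ifP => _ /=; last by rewrite add0r.
by rewrite addrC subrK.
Qed.

Lemma sum_config : \sum_g config_weight g = 1.
Proof.
transitivity (\sum_g config_weight g * \prod_(e : V * V) 1).
  by apply: eq_bigr => g _; rewrite big1 ?mulr1.
rewrite (sum_config_prod (fun _ _ => 1)); apply: big1 => e _; under eq_bigr do rewrite mulr1.
exact: sum_slot.
Qed.

Hypothesis psym : forall u v, p u v = p v u.

Lemma canon_sym (T : Type) (f : V -> V -> T) (e : V * V) :
  (forall u v, f u v = f v u) -> f (canon_pair e).1 (canon_pair e).2 = f e.1 e.2.
Proof. by move=> fC; rewrite /canon_pair; case: ifP => _ //=. Qed.

Lemma sum_config_edge u v : u != v ->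
  \sum_g config_weight g * (graph_of g u v)%:R = p u v.
Proof.
move=> uv; have uvl := @canon_lt _ (u, v) uv.
pose h (e : V * V) (x : bool) : R := if e == canon_pair (u, v) then x%:R else 1.
transitivity (\sum_g config_weight g * \prod_e h e (g e)).
  apply: eq_bigr => g _; congr (_ * _).
  by rewrite (bigD1 (canon_pair (u, v))) //= /h eqxx big1 ?mulr1 // => e /negPf ->.
rewrite sum_config_prod (bigD1 (canon_pair (u, v))) //= [X in _ * X]big1.
  rewrite mulr1 big_bool /h eqxx /= mulr1 mulr0 addr0.
  rewrite /slot_prob uvl.
  exact: (canon_sym (u, v)).
move=> e /negPf ne; rewrite -[RHS](sum_slot e); apply: eq_bigr => x _.
by rewrite /h ne mulr1.
Qed.

Hypotheses (p0 : forall u v, 0 <= p u v) (p1 : forall u v, p u v <= 1).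
Hypothesis pd : forall u, p u u = 0.
Variable b : V -> bool.

Let beta u v : R := (b u)%:R * (b v)%:R.

Definition centered (g : {ffun V * V -> bool}) (u v : V) : R :=
  (b u)%:R * (b v)%:R * ((graph_of g u v)%:R - p u v).

Lemma prod_seq_count (I : finType) (F : I -> R) (s : seq I) :
  \prod_(i <- s) F i = \prod_i F i ^+ count_mem i s.
Proof.
elim: s => [|a s IH].
  by rewrite big_nil big1 // => i _; rewrite expr0.
rewrite big_cons IH (bigD1 a) //= [in RHS](bigD1 a) //= eqxx exprS mulrA.
congr (_ * _); apply: eq_bigr => i /negPf ia.
by rewrite [a == i]eq_sym ia.
Qed.

(** For m >= 2 the absolute central moment of order m of a Bernoulli(q) variable is at most q
    (1-q)^2 + (1-q) q^2 = q (1-q) <= q. *)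
Lemma centered_slot (m : nat) e : (2 <= m)%N -> e.1 != e.2 ->
  `|\sum_x slot_prob (canon_pair e) x *
     (beta (canon_pair e).1 (canon_pair e).2 *
       (x%:R - p (canon_pair e).1 (canon_pair e).2)) ^+ m|
  <= beta e.1 e.2 * p e.1 e.2.
Proof.
move=> m2 ne; rewrite -(canon_sym e psym) -(@canon_sym _ beta e); last first.
  by move=> u v; rewrite /beta mulrC.
rewrite big_bool /slot_prob canon_lt //=.
set q := p _ _; have q0 : 0 <= q by exact: p0.
have q1 : q <= 1 by exact: p1.
rewrite /beta; case: (b _); case: (b _); rewrite ?(mul0r, mulr0, mul1r);
  rewrite ?expr0n ?gtn_eqF ?(ltn_trans _ m2) ?mulr0 ?addr0 ?normr0 //.
rewrite sub0r; case: m m2 => [//|[//|m]] _.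
apply: le_trans (ler_normD _ _) _. rewrite !(normrX, normrM) normrN.
rewrite !ger0_norm ?subr_ge0 //=.
have pw x : 0 <= x -> x <= 1 -> x ^+ m.+2 <= x ^+ 2.
  by move=> x0 x1; rewrite -addn2 exprD ler_piMl ?exprn_ge0 ?exprn_ile1.
have a0 : 0 <= 1 - q by rewrite subr_ge0.
have a1 : 1 - q <= 1 by lra.
apply: (@le_trans _ _ (q * (1 - q) ^+ 2 + (1 - q) * q ^+ 2)).
  by apply: lerD; apply: ler_wpM2l => //; apply: pw.
nra.
Qed.

(** The mean factorises over slots. A slot crossed exactly once has mean 0, so a nonzero term
    crosses every edge at least twice, which gives the boolean factor. In that case the slots of
    fresh steps supply the factors [beta * p] and every other slot is bounded by 1. *)
Lemma sum_config_centered u t :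
  `|\sum_g config_weight g * walk_prod (centered g) u t| <=
  ((size (fresh_steps u [:: u] t)).*2 <= size t)%N%:R *
  \prod_(e <- fresh_steps u [:: u] t) (beta e.1 e.2 * p e.1 e.2).
Proof.
set M := [seq canon_pair e | e <- steps u t].
pose z (e : V * V) (x : bool) : R := beta e.1 e.2 * (x%:R - p e.1 e.2).
have betaC u' v' : beta u' v' = beta v' u' by rewrite /beta mulrC.
have beta0 u' v' : 0 <= beta u' v' by rewrite /beta mulr_ge0.
have beta1 u' v' : beta u' v' <= 1.
  by rewrite /beta; case: (b u'); case: (b v'); rewrite ?mulr1 ?mulr0.
have -> : \sum_g config_weight g * walk_prod (centered g) u t =
    \prod_e \sum_x slot_prob e x * z e x ^+ count_mem e M.
  rewrite -sum_config_prod; apply: eq_bigr => g _; congr (_ * _).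
  rewrite -(prod_seq_count (fun e => z e (g e))) big_map /walk_prod.
  apply: eq_bigr => -[a c] _; rewrite /centered /z /graph_of.
  by rewrite (canon_sym (a, c) betaC) (canon_sym (a, c) psym).
have M_canon e : e \in M -> exists2 f, f \in steps u t & e = canon_pair f.
  by move=> /mapP[f fs ->]; exists f.
have [/allP M2|/allPn [e eM]] := boolP (all (fun e => 2 <= count_mem e M)%N M);
    last first.
  rewrite -ltnNge ltnS => ce.
  have {ce} ce : count_mem e M = 1%N.
    by apply/eqP; rewrite eqn_leq ce -has_count has_pred1.
  rewrite (bigD1 e) //= [X in X * _](_ : _ = 0) ?mul0r ?normr0; last first.
    have [f _ eE] := M_canon _ eM; rewrite ce big_bool /z !expr1.
    (* A loop slot is almost surely false and [pd] makes its mean 0, so its centred value vanishes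
       as well. *)
    have [f12|f12] := eqVneq f.1 f.2.
      have e12 : e.1 = e.2 by rewrite eE /canon_pair; case: ifP.
      by rewrite /slot_prob e12 ltnn pd /= mul0r subr0 !mulr0 addr0.
    have el : (enum_rank e.1 < enum_rank e.2)%N by rewrite eE canon_lt.
    by rewrite /slot_prob el /=; ring.
  apply: mulr_ge0; first exact: ler0n.
  by apply: prodr_ge0 => i _; rewrite mulr_ge0.
rewrite (fresh_steps_twice (mem_head _ _) M2) mul1r normr_prod.
set N := [seq canon_pair e | e <- fresh_steps u [:: u] t].
have -> : \prod_(e <- fresh_steps u [:: u] t) (beta e.1 e.2 * p e.1 e.2) =
    \prod_(e in N) (beta e.1 e.2 * p e.1 e.2).
  rewrite -(big_uniq _ (uniq_fresh_steps _ (mem_head _ _))) big_map.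
  by apply: eq_bigr => e _; rewrite (canon_sym e betaC) (canon_sym e psym).
rewrite [leRHS]big_mkcond; apply: ler_prod => e _; rewrite normr_ge0 /=.
have [eN|eN] := boolP (e \in N).
  have /mapP[f fin eE] := eN.
  have [_ f12 _ _] := fresh_stepsP (mem_head _ _) fin.
  have eM : e \in M by rewrite eE map_f // (fresh_steps_sub fin).
  rewrite eE (canon_sym f betaC) (canon_sym f psym) -eE {1}eE /z.
  have := centered_slot (M2 _ eM) f12; rewrite -eE; apply.
have [eM|eM] := boolP (e \in M); last first.
  have -> : count_mem e M = 0%N by apply/count_memPn.
  by under eq_bigr do rewrite expr0 mulr1; rewrite sum_slot normr1.
have [f _ eE] := M_canon _ eM.
have [f12|f12] := eqVneq f.1 f.2; last first.
  have := centered_slot (M2 _ eM) f12; rewrite -eE => /le_trans; apply.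
  by rewrite mulr_ile1.
have e12 : e.1 = e.2 by rewrite eE /canon_pair; case: ifP.
rewrite big_bool /slot_prob /z e12 ltnn pd /= mul0r add0r subr0 mulr0.
by rewrite expr0n gtn_eqF ?mulr0 ?normr0 // (ltn_trans _ (M2 _ eM)).
Qed.

End Config.

Section ConfigTrace.
Variables (R : realType) (V : finType) (p : V -> V -> R).
Hypothesis psym : forall u v, p u v = p v u.
Hypotheses (p0 : forall u v, 0 <= p u v) (p1 : forall u v, p u v <= 1).
Hypothesis pd : forall u, p u u = 0.
Variables (b : V -> bool) (y : V -> R) (r : V -> V -> R) (c : R) (k : nat).
Hypotheses (y1 : forall v, 1 <= y v) (r0 : forall u v, 0 <= r u v).
Hypotheses (pr : forall u v, p u v <= y u * y v * r u v) (c1 : 1 <= c).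

(** A fresh step is not a loop, so it adds at most 1 to the degree of [v], and it only touches
    visited vertices. *)
Lemma fresh_degree_le (u : V) (t : seq V) (v : V) :
  (\sum_(e <- fresh_steps u [:: u] t) ((e.1 == v) + (e.2 == v)) <=
   (v \in u :: t) * size (fresh_steps u [:: u] t))%N.
Proof.
rewrite -sum1_size big_distrr /= !big_seq; apply: leq_sum => e ein.
have [_ ne e1 e2] := fresh_stepsP (mem_head _ _) ein.
case: (eqVneq e.1 v) => [E1|_]; case: (eqVneq e.2 v) => [E2|_] //.
- by rewrite E1 E2 eqxx in ne.
- by rewrite -E1 e1.
- by rewrite -E2 e2.
Qed.

(** A vertex factor (b y)^deg with deg <= k is at most 1 + b y^k: use y >= 1 when deg > 0, while the
    summand 1 covers deg = 0. Dividing [r] by [c] prepares for row sums equal to 1; it costs one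
    factor [c] per fresh step, at most [c ^+ k] in all. *)
Lemma fresh_prod_le (u : V) (t : seq V) : ((size (fresh_steps u [:: u] t)) <= k)%N ->
  \prod_(e <- fresh_steps u [:: u] t)
    ((b e.1)%:R * (b e.2)%:R * p e.1 e.2) <=
  c ^+ k * (\prod_(e <- fresh_steps u [:: u] t) (r e.1 e.2 / c) *
    \prod_(v | v \in u :: t) (1 + (b v)%:R * y v ^+ k)).
Proof.
set l := fresh_steps u [:: u] t => lk.
have c0 : 0 < c by rewrite (lt_le_trans _ c1).
have y0 v : 0 <= y v by rewrite (le_trans _ (y1 v)).
have rc0 u' v' : 0 <= r u' v' / c by rewrite divr_ge0 // ltW.
apply: (@le_trans _ _ (\prod_(e <- l)
    (((b e.1)%:R * y e.1) * ((b e.2)%:R * y e.2)) *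
    (c ^+ size l * \prod_(e <- l) (r e.1 e.2 / c)))).
  have -> : c ^+ size l = \prod_(e <- l) c.
    by rewrite big_const_seq count_predT iter_mulr_1.
  rewrite -!big_split /=; apply: ler_prod => e _.
  rewrite !mulr_ge0 //= (mulrC c) divfK ?gt_eqF //.
  rewrite mulrACA -[leRHS]mulrA; apply: ler_wpM2l; first exact: mulr_ge0.
  exact: pr.
rewrite mulrCA.
have Pp0 : 0 <= \prod_(e <- l) (r e.1 e.2 / c) by apply: prodr_ge0.
have by0 v : 0 <= (b v)%:R * y v by rewrite mulr_ge0.
apply: ler_pM; rewrite ?exprn_ge0 ?mulr_ge0 ?(ltW c0) //.
- by apply: prodr_ge0 => e _; rewrite mulr_ge0.
- by rewrite ler_weXn2l.
rewrite mulrC; apply: ler_wpM2l => //.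
rewrite (prod_fresh_degree (fun v => (b v)%:R * y v)) [leRHS]big_mkcond.
apply: ler_prod => v _.
rewrite exprn_ge0 //=; have := fresh_degree_le u t v.
case: ifP => _; last by rewrite mul0n leqn0 => /eqP ->; rewrite expr0.
rewrite mul1n; set d := (\sum_(e <- _) _)%N => dl.
case: (b v); last by rewrite !mul0r addr0 expr0n lern1 leq_b1.
rewrite !mul1r; apply: le_trans (_ : y v ^+ k <= _).
  by apply: ler_weXn2l => //; exact: leq_trans dl lk.
by rewrite lerDr.
Qed.

(* Each edge of a contributing walk is crossed at least twice, so a walk of length
   2k has at most k fresh steps and the missing powers of c are at least 1. *)
Lemma sum_config_trace :
  \sum_g config_weight p g *
    (\sum_u \sum_(t <- walks V k.*2 | last u t == u)
      walk_prod (centered p b g) u t) <=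
  c ^+ k * \sum_u \sum_(t <- walks V k.*2)
    \prod_(e <- fresh_steps u [:: u] t) (r e.1 e.2 / c) *
    \prod_(v | v \in u :: t) (1 + (b v)%:R * y v ^+ k).
Proof.
have c0 : 0 < c by rewrite (lt_le_trans _ c1).
have y0 v : 0 <= y v by rewrite (le_trans _ (y1 v)).
under eq_bigr do rewrite mulr_sumr.
rewrite exchange_big mulr_sumr /=; apply: ler_sum => u _.
under eq_bigr do rewrite mulr_sumr.
rewrite exchange_big mulr_sumr /= [leLHS]big_mkcond.
rewrite !big_seq; apply: ler_sum => t /size_walks st.
have B0 : 0 <= c ^+ k * (\prod_(e <- fresh_steps u [:: u] t) (r e.1 e.2 / c) *
    \prod_(v | v \in u :: t) (1 + (b v)%:R * y v ^+ k)).
  rewrite !mulr_ge0 ?exprn_ge0 ?(ltW c0) //.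
    by apply: prodr_ge0 => e _; rewrite divr_ge0 ?(ltW c0).
  by apply: prodr_ge0 => v _; rewrite addr_ge0 ?mulr_ge0 ?exprn_ge0.
case: ifP => // _.
apply: le_trans (ler_norm _) _.
apply: le_trans (sum_config_centered psym p0 p1 pd b u t) _.
rewrite st leq_double; case: leqP => [lk|_]; last by rewrite mul0r.
by rewrite mul1r; exact: fresh_prod_le.
Qed.

End ConfigTrace.

(** * Integration *)

Section Density.
Local Open Scope ereal_scope.
Context d (T : measurableType d) (R : realType).
Variables (mu : {measure set T -> \bar R}) (f : T -> R).

(** The two properties of [f] are arguments so that the measure structure declared below can be
    inferred from the term itself. *)
Definition density of measurable_fun setT f & (forall x, (0 <= f x)%R) :=
  fun A : set T => \int[mu]_(x in A) (f x)%:E.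

Hypotheses (mf : measurable_fun setT f) (f0 : forall x, (0 <= f x)%R).
Local Notation nu := (density mf f0).

Let density0 : nu set0 = 0. Proof. exact: integral_set0. Qed.

Let density_ge0 A : 0 <= nu A.
Proof. by apply: integral_ge0 => x _; rewrite lee_fin. Qed.

Let density_sigma_additive : semi_sigma_additive nu.
Proof.
move=> /= F mF tF mUF; rewrite /density ge0_integral_bigcup //; last 2 first.
- apply/measurable_EFinP; exact: measurable_funTS.
- by move=> x _; rewrite lee_fin.
by apply: is_cvg_ereal_nneg_natsum_cond => n _ _; exact: density_ge0.
Qed.

HB.instance Definition _ := isMeasure.Build _ _ _ nu
  density0 density_ge0 density_sigma_additive.

Import HBNNSimple.

(** Clear for indicators; it extends to simple functions by linearity and to [h] by monotone
    convergence along simple approximations. *)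
Lemma ge0_integral_density (h : T -> \bar R) :
  measurable_fun setT h -> (forall x, 0 <= h x) ->
  \int[nu]_x h x = \int[mu]_x (h x * (f x)%:E).
Proof.
move=> mh h0; pose h_ := nnsfun_approx measurableT mh.
have mEf : measurable_fun setT (EFin \o f) by exact/measurable_EFinP.
have h_f x : (h_ n x)%:E * (f x)%:E @[n --> \oo] --> h x * (f x)%:E.
  by apply: cvgeZr => //; exact: cvg_nnsfun_approx.
transitivity (limn (fun n => \int[nu]_x (h_ n x)%:E)).
  rewrite -monotone_convergence //.
  - by apply: eq_integral => x _; apply/esym/cvg_lim => //; exact: cvg_nnsfun_approx.
  - by move=> n; exact/measurable_EFinP/measurable_funP.
  - by move=> n y _; rewrite lee_fin.
  - by move=> y _ m n mn; rewrite lee_fin; exact/lefP/nd_nnsfun_approx.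
rewrite [X in limn X](_ : _ = fun n => \int[mu]_x ((h_ n x)%:E * (f x)%:E)).
  rewrite -monotone_convergence //.
  - by apply: eq_integral => x _; apply/cvg_lim.
  - by move=> n; apply: emeasurable_funM => //; exact/measurable_EFinP/measurable_funP.
  - by move=> n y _; rewrite mule_ge0 ?lee_fin.
  - move=> y _ m n mn; rewrite -!EFinM lee_fin ler_wpM2r //.
    exact/lefP/nd_nnsfun_approx.
apply/funext => n; rewrite integralT_nnsfun sintegralE.
transitivity (\sum_(k \in range (h_ n))
    \int[mu]_x ((k * \1_(h_ n @^-1` [set k]) x)%:E * (f x)%:E)); last first.
  rewrite -ge0_integral_fsum //.
  - apply: eq_integral => x _; rewrite fimfunE -fsumEFin//.
    rewrite ge0_mule_fsuml // => k.
    exact: nnfun_muleindic_ge0.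
  - move=> k; apply: emeasurable_funM => //.
    exact/measurable_EFinP/measurable_funM.
  - move=> k x _; apply: mule_ge0; last by rewrite lee_fin.
    exact: nnfun_muleindic_ge0.
apply: eq_fsbigr => k kr.
have mk : measurable (h_ n @^-1` [set k]) by [].
rewrite /= /density integral_mkcond /=.
have k0 : (0 <= k)%R by move: kr; rewrite inE => -[x _ <-].
rewrite -ge0_integralZl_EFin //; last 2 first.
- by move=> x _; rewrite patchE; case: ifP => // _; rewrite lee_fin.
- by apply/(measurable_restrictT _ mk); exact: measurable_funTS.
apply: eq_integral => x _; rewrite patchE indicE EFinM -muleA.
by case: ifP => _; rewrite ?mul1e ?mul0e.
Qed.

End Density.

Section PiSystemTransfer.
Local Open Scope ereal_scope.
Context d (T : measurableType d) (R : realType).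
Variables (mu : {measure set T -> \bar R}) (G : set (set T)).
Hypotheses (GI : setI_closed G) (GT : G setT) (Gm : G `<=` measurable).

Lemma g_sigma_measurable : <<s G >> `<=` measurable.
Proof. by apply: smallest_sub => //; exact: sigma_algebra_measurable. Qed.

(* Meant for z1 the indicator of an edge configuration and z2 its conditional
   probability given the weights. *)
Lemma ge0_integral_pi_system (z1 z2 : T -> R) (h : T -> \bar R) :
  measurable_fun setT z1 -> measurable_fun setT z2 ->
  (forall x, 0 <= z1 x)%R -> (forall x, 0 <= z2 x)%R ->
  (forall S, G S -> \int[mu]_(x in S) (z1 x)%:E = \int[mu]_(x in S) (z2 x)%:E) ->
  \int[mu]_x (z1 x)%:E < +oo ->
  measurable_fun setT (h : g_sigma_algebraType G -> \bar R) ->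
  (forall x, 0 <= h x) ->
  \int[mu]_x (h x * (z1 x)%:E) = \int[mu]_x (h x * (z2 x)%:E).
Proof.
move=> mz1 mz2 z10 z20 zG z1oo mh h0.
(* [h] is measurable for the generated sigma-algebra only. Both densities are therefore pushed along
   the identity to [T'], where measures that agree on the pi-system coincide. *)
pose T' := g_sigma_algebraType G.
have mid : measurable_fun setT (id : T -> T').
  by move=> _ Y mY; rewrite setTI; exact: g_sigma_measurable.
have mh' : measurable_fun setT (h : T -> \bar R).
  move=> mT Y mY; rewrite setTI.
  by have := mh measurableT Y mY; rewrite setTI; exact: g_sigma_measurable.
pose n1 : {measure set T -> \bar R} := density mu mz1 z10.
pose n2 : {measure set T -> \bar R} := density mu mz2 z20.
have E (z : T -> R) (mz : measurable_fun setT z) (z0 : forall x, (0 <= z x)%R) :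
    \int[mu]_x (h x * (z x)%:E) =
    \int[pushforward (density mu mz z0) (id : T -> T')]_x h x.
  rewrite (ge0_integral_pushforward mid) //.
  by rewrite -(ge0_integral_density mu mz z0).
rewrite (E _ mz1 z10) (E _ mz2 z20).
pose p2 := measure_function_pushforward__canonical__measure_function_Measure
  (density mu mz2 z20) mid.
rewrite -[RHS]/(\int[p2]_x h x); apply: eq_measure_integral => A mA _.
apply: (@g_sigma_algebra_measure_unique _ _ _ G Gm (fun=> setT) (fun=> GT)
  _ n1 n2) => //.
by rewrite bigcup_const.
Qed.

End PiSystemTransfer.

Section MeasurableBigop.
Context d (T : measurableType d) (R : realType) (I : Type).

Lemma measurable_bigsum (s : seq I) (Q : pred I) (F : I -> T -> R) :
  (forall i, Q i -> measurable_fun setT (F i)) ->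
  measurable_fun setT (fun x => \sum_(i <- s | Q i) F i x).
Proof.
move=> mF; elim: s => [|i s IH].
  by under eq_fun do rewrite big_nil; exact: measurable_cst.
under eq_fun do rewrite big_cons.
case Qi: (Q i) => //; apply: measurable_funD => //; exact: mF.
Qed.

Lemma measurable_bigprod (s : seq I) (Q : pred I) (F : I -> T -> R) :
  (forall i, Q i -> measurable_fun setT (F i)) ->
  measurable_fun setT (fun x => \prod_(i <- s | Q i) F i x).
Proof.
move=> mF; elim: s => [|i s IH].
  by under eq_fun do rewrite big_nil; exact: measurable_cst.
under eq_fun do rewrite big_cons.
case Qi: (Q i) => //; apply: measurable_funM => //; exact: mF.
Qed.

End MeasurableBigop.

(** * Products of functions of independent variables *)

Section Independence.
Local Open Scope ereal_scope.
Context d (T : measurableType d) (R : realType) (P : probability T R).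
Variables (V : finType) (W : V -> T -> R).
Hypothesis mW : forall v, measurable_fun setT (W v).
Hypothesis indepW : forall B : V -> set R, (forall v, measurable (B v)) ->
  P [set x | forall v, B v (W v x)] = \prod_v P (W v @^-1` B v).

Lemma prodEFin (I : Type) (s : seq I) (Q : pred I) (F : I -> R) :
  \prod_(i <- s | Q i) (F i)%:E = (\prod_(i <- s | Q i) F i)%R%:E.
Proof. by elim/big_rec2: _ => // i x y _ ->; rewrite EFinM. Qed.

Let mWC (C : set R) v : measurable C -> measurable (W v @^-1` C).
Proof. by move=> mC; rewrite -[X in measurable X]setTI; exact: mW. Qed.

Lemma integral_prod_indic (C : V -> set R) (m : V -> R) :
  (forall v, measurable (C v)) ->
  (forall v, \int[P]_x (\1_(C v) (W v x))%:E = (m v)%:E) ->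
  \int[P]_x (\prod_v \1_(C v) (W v x))%R%:E = (\prod_v m v)%R%:E.
Proof.
move=> mC mE.
have PE v : P (W v @^-1` C v) = (m v)%:E.
  by rewrite -mE -[X in P X]setIT -integral_indic //; exact: mWC.
rewrite -prodEFin -(eq_bigr _ (fun v _ => PE v)) -indepW //.
have mS : measurable [set x | forall v, C v (W v x)].
  rewrite (_ : mkset _ = \bigcap_(v in [set: V]) (W v @^-1` C v)).
    by apply: fin_bigcap_measurable => // v _; exact: mWC.
  by apply/seteqP; split => x /= xC v; [move=> _|]; exact: xC.
rewrite -[X in _ = P X]setIT -integral_indic //.
apply: eq_integral => x _; congr (_%:E).
have [xC|nC] := pselect (forall v, C v (W v x)).
  rewrite [RHS]indicE mem_set //= big1 // => v _.
  by rewrite indicE mem_set //; exact: xC.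
rewrite [RHS]indicE memNset //=; move/existsNP: nC => [v nv].
by rewrite (bigD1 v) //= indicE memNset // mul0r.
Qed.

Lemma integral_prod_indep (phi : V -> R -> R) (m : V -> R) :
  (forall v, measurable_fun setT (phi v)) ->
  (forall v t, (0 <= phi v t)%R) ->
  (forall v, \int[P]_x (phi v (W v x))%:E = (m v)%:E) ->
  \int[P]_x (\prod_v phi v (W v x))%R%:E = (\prod_v m v)%R%:E.
Proof.
(* Induction on the list [s] of coordinates whose function may be arbitrary; outside [s] only
   indicators occur. To free the coordinate [u], the induction hypothesis is used with the indicator
   of any Borel set at [u], and the identity then extends to [f u] by the pi-system lemma. *)
suff H (s : seq V) (C : V -> set R) (f : V -> R -> R) (l : V -> R) :
    (forall v, measurable (C v)) ->
    (forall v, v \notin s -> f v = \1_(C v)) ->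
    (forall v, measurable_fun setT (f v)) ->
    (forall v t, (0 <= f v t)%R) ->
    (forall v, \int[P]_x (f v (W v x))%:E = (l v)%:E) ->
    \int[P]_x (\prod_v f v (W v x))%R%:E = (\prod_v l v)%R%:E.
  by apply: (H (enum V) (fun=> set0)) => // v; rewrite mem_enum.
elim: s C f l => [|u s IH] C f l mC fC mf f0 fl.
  have fE v : f v = \1_(C v) by exact: fC.
  under eq_integral do under eq_bigr do rewrite fE.
  by apply: integral_prod_indic => // v; rewrite -fE fl.
pose z1 x := (\prod_(v | v != u) f v (W v x))%R.
pose K := (\prod_(v | v != u) l v)%R.
have l0 v : (0 <= l v)%R.
  by rewrite -lee_fin -fl; apply: integral_ge0 => x _; rewrite lee_fin.
have mz1 : measurable_fun setT z1.
  apply: measurable_bigprod => v _.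
  exact: measurableT_comp (mf v) (mW v).
have z10 x : (0 <= z1 x)%R by apply: prodr_ge0.
have K0 (x : T) : (0 <= K)%R by apply: prodr_ge0.
have zC (D : set R) : measurable D ->
    \int[P]_(x in W u @^-1` D) (z1 x)%:E = \int[P]_(x in W u @^-1` D) K%:E.
  move=> mD; have mWD := mWC u mD.
  rewrite integral_cst // -[X in _ = _ * X]fineK ?fin_num_measure // -EFinM.
  pose f' v := if v == u then \1_D else f v.
  pose l' v := if v == u then fine (P (W u @^-1` D)) else l v.
  pose C' v := if v == u then D else C v.
  have E : (\prod_v l' v)%R = (K * fine (P (W u @^-1` D)))%R.
    rewrite (bigD1 u) //= /l' eqxx mulrC; congr (_ * _)%R.
    by apply: eq_bigr => v /negPf ->.
  rewrite -E -(IH C' f' l').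
  - rewrite integral_mkcond; apply: eq_integral => x _.
    rewrite patchE (bigD1 u) //= /f' eqxx indicE.
    have -> : (\prod_(v | v != u) (if v == u then \1_D else f v) (W v x) = z1 x)%R.
      by apply: eq_bigr => v /negPf ->.
    case: ifPn => xD; first by rewrite mem_set ?mul1r //; exact: set_mem xD.
    by rewrite memNset ?mul0r // => Dx; move/negP: xD; apply; rewrite inE.
  - by move=> v; rewrite /C'; case: ifP.
  - move=> v vs; rewrite /f' /C'; case: ifPn => // vu.
    by apply: fC; rewrite inE negb_or vu.
  - by move=> v; rewrite /f'; case: ifP => // _; exact: measurable_indic.
  - by move=> v t; rewrite /f'; case: ifP.
  - move=> v; rewrite /f' /l'; case: eqP => [->|_]; last exact: fl.
    by rewrite fineK ?fin_num_measure // -[X in _ = P X]setIT -[RHS]integral_indic.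
have G : \int[P]_x ((f u (W u x))%:E * (z1 x)%:E) =
         \int[P]_x ((f u (W u x))%:E * K%:E).
  pose G := [set S | exists D : set R, measurable D /\ S = W u @^-1` D].
  apply: (@ge0_integral_pi_system _ _ _ P G _ _ _ z1 (fun=> K)) => //.
  - move=> _ _ [A [mA ->]] [B [mB ->]]; exists (A `&` B).
    by split; [exact: measurableI|].
  - by exists setT.
  - by move=> _ [D [mD ->]]; exact: mWC.
  - by move=> _ [D [mD ->]]; exact: zC.
  - have := zC _ measurableT; rewrite preimage_setT => ->.
    by rewrite integral_cst // [X in _ * X]probability_setT mule1 ltry.
  - apply/measurable_EFinP; apply: (measurableT_comp (mf u)).
    move=> _ Y mY; rewrite setTI; apply: sub_sigma_algebra.
    by exists Y.
  - by move=> x; rewrite lee_fin.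
transitivity (\int[P]_x ((f u (W u x))%:E * (z1 x)%:E)).
  by apply: eq_integral => x _; rewrite (bigD1 u) // EFinM.
rewrite G (bigD1 u) //=.
under eq_integral do rewrite muleC.
rewrite ge0_integralZl_EFin //.
- by rewrite fl -EFinM mulrC.
- by move=> x _; rewrite lee_fin.
- apply/measurable_EFinP; exact: measurableT_comp (mf u) (mW u).
- exact: (K0 point).
Qed.

End Independence.

(** * The Pareto law and pairs of independent variables *)

Section Pareto.
Variable R : realType.

Lemma powRN_cvgy (s : R) : 0 < s -> x `^ (- s) @[x --> +oo] --> (0 : R).
Proof.
move=> s0; apply/cvgrPdist_lt => e e0; near=> x.
have x0 : 0 < x by near: x; exact: nbhs_pinfty_gt.
have ex : e `^ (- s^-1) < x by near: x; apply: nbhs_pinfty_gt; exact: num_real.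
rewrite sub0r normrN ger0_norm ?powR_ge0 // powRN.
rewrite invf_plt ?posrE ?powR_gt0 //.
have -> : e^-1 = (e `^ (- s^-1)) `^ s.
  by rewrite -powRrM mulNr mulVf ?gt_eqF // powR_inv1 // ltW.
by apply: gt0_ltr_powR => //; rewrite nnegrE ?powR_ge0 // ltW.
Unshelve. all: by end_near. Qed.

Lemma integral_powRN (s a : R) : 0 < s -> 0 < a ->
  (\int[lebesgue_measure]_(x in `[a, +oo[) (s * x `^ (- (s + 1)))%:E =
   (a `^ (- s))%:E)%E.
Proof.
move=> s0 a0.
have xpos (x : R) : a <= x -> 0 < x by exact: lt_le_trans.
have dF (x : R) : 0 < x ->
    is_derive x 1 (fun y => - y `^ (- s)) (s * x `^ (- (s + 1))).
  move=> x0; apply: (is_derive_eq (is_deriveN (is_derive1_powR (- s) x0))).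
  by rewrite mulNr opprK opprD.
rewrite (@ge0_continuous_FTC2y _ _ (fun y => - y `^ (- s)) a 0).
- by rewrite -EFinB sub0r opprK.
- by move=> x ax; rewrite mulr_ge0 ?powR_ge0 // ltW.
- apply: derivable_within_continuous => x; rewrite in_itv /= andbT => ax.
  apply: derivableM => //.
  by apply: derivable_powR; rewrite in_itv /= andbT xpos.
- rewrite -[X in _ --> X]oppr0; apply: cvgN; exact: powRN_cvgy.
- by move=> x /ltW /xpos /dF [].
- have da : {for a, continuous (fun y : R => - y `^ (- s))}.
    by apply/differentiable_continuous/derivable1_diffP; have [] := dF a a0.
  exact: cvg_at_right_filter.
- move=> x; rewrite in_itv /= andbT => /ltW /xpos x0.
  by rewrite derive1E; have [_ ->] := dF x x0.
Qed.

Lemma integral_powRN_fin (s : R) : 1 < s ->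
  (\int[lebesgue_measure]_(x in `[1%R, +oo[) (x `^ (- s))%:E =
   ((s - 1)^-1)%:E)%E.
Proof.
move=> s1; have s0 : 0 < s - 1 by rewrite subr_gt0.
have := integral_powRN s0 ltr01; rewrite subrK powR1.
under eq_integral do rewrite EFinM.
rewrite ge0_integralZl_EFin //; last 3 first.
- by move=> x _; rewrite lee_fin powR_ge0.
- apply/measurable_EFinP; apply: measurable_funTS; exact: measurable_powR.
- exact: ltW.
set J := (\int[_]_(_ in _) _)%E.
(* The equation (s - 1) J = 1 itself excludes infinite values of [J]. *)
case: J => [r| |] //=; last 2 first.
- by rewrite mulry gtr0_sg // mul1e.
- by rewrite mulrNy gtr0_sg // mul1e.
rewrite -EFinM => -[E]; congr (_%:E).
by rewrite -[LHS](mulKf (lt0r_neq0 s0)) E mulr1.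
Qed.

Definition pareto_pdf (tau x : R) : R :=
  if 1 <= x then (tau - 1) * x `^ (- tau) else 0.

Lemma pareto_pdf_ge0 tau x : 1 < tau -> 0 <= pareto_pdf tau x.
Proof.
move=> t1; rewrite /pareto_pdf; case: ifP => // _.
by rewrite mulr_ge0 ?powR_ge0 // subr_ge0 ltW.
Qed.

Lemma measurable_pareto_pdf tau : measurable_fun setT (pareto_pdf tau).
Proof.
apply: measurable_fun_ifT => //=.
- exact: measurable_fun_ler.
- by apply: measurable_funM => //; exact: measurable_powR.
Qed.

Lemma integral_pareto_pdf tau (t : R) : 1 < tau ->
  (\int[lebesgue_measure]_(x in `]t, +oo[) (pareto_pdf tau x)%:E =
   (if 1 <= t then t `^ (- (tau - 1)) else 1)%:E)%E.
Proof.
move=> t1; have s0 : 0 < tau - 1 by rewrite subr_gt0.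
have pdfE : (fun x => (pareto_pdf tau x)%:E) =
    (fun x => ((tau - 1) * x `^ (- (tau - 1 + 1)))%:E) \_ `[1, +oo[.
  apply/funext => x; rewrite patchE mem_setE in_itv /= andbT /pareto_pdf subrK.
  by case: ifP.
rewrite pdfE -integral_mkcondr; case: ifPn => [le1t|].
  have -> : `]t, +oo[%classic `&` `[1, +oo[%classic = `]t, +oo[%classic.
    apply/setIidl => x /=; rewrite !in_itv /= !andbT => /ltW; exact: le_trans.
  rewrite integral_itv_obnd_cbnd.
    by rewrite integral_powRN // (lt_le_trans _ le1t).
  apply/measurable_EFinP; apply: measurable_funTS.
  by apply: measurable_funM => //; exact: measurable_powR.
rewrite -ltNge => lt1t.
have -> : `]t, +oo[%classic `&` `[1, +oo[%classic = `[1, +oo[%classic.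
  apply/setIidr => x /=; rewrite !in_itv /= !andbT; exact: lt_le_trans.
by rewrite integral_powRN // powR1.
Qed.

Section Law.
Context d (T : measurableType d) (P : probability T R) (tau : R).
Hypothesis tau1 : 1 < tau.

(** The tails determine the law: the open upper half-lines form a pi-system generating the Borel
    sets, and on them the law of [W] and the measure of density [pareto_pdf] agree. *)
Lemma ge0_integral_pareto (W : T -> R) (g : R -> \bar R) :
  measurable_fun setT W ->
  (forall t, P [set x | t < W x] =
     (if 1 <= t then t `^ (- (tau - 1)) else 1)%:E) ->
  measurable_fun setT g -> (forall x, 0 <= g x)%E ->
  (\int[P]_x g (W x) =
   \int[lebesgue_measure]_x (g x * (pareto_pdf tau x)%:E))%E.
Proof.
move=> mW WP mg g0.
have pdf0 x := pareto_pdf_ge0 x tau1.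
have mp := measurable_pareto_pdf tau.
rewrite -(ge0_integral_density lebesgue_measure mp pdf0) //.
have mWk (k : nat) : measurable (W @^-1` `]- (k%:R : R), +oo[%classic).
  by rewrite -[X in measurable X]setTI; exact: mW.
pose TR := measurableTypeR R.
pose mW' : measurable_fun setT (W : T -> TR) := mW.
pose n1 : {measure set TR -> \bar R} :=
  measure_function_pushforward__canonical__measure_function_Measure P mW'.
pose n2 : {measure set TR -> \bar R} := density lebesgue_measure mp pdf0.
transitivity (\int[n1]_x g x)%E.
  by rewrite (ge0_integral_pushforward mW').
transitivity (\int[n2]_x g x)%E; last by [].
apply: eq_measure_integral => A mA _.
have E (t : R) : n1 `]t, +oo[%classic = n2 `]t, +oo[%classic.
  rewrite [RHS]integral_pareto_pdf //= -WP /= /pushforward.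
  by congr (P _); apply/seteqP; split => x /=; rewrite in_itv /= andbT.
pose G := @RGenOInfty.G R.
apply: (@measure_unique _ R TR G (fun n => `]- (n%:R : R), +oo[%classic)
  _ _ _ _ n1 n2 _ _ A mA) => //.
- exact: RGenOInfty.measurableE.
- move=> _ _ [s ->] [t ->]; exists (Num.max s t).
  by apply/seteqP; split => x /=; rewrite !in_itv /= !andbT gt_max => /andP.
- by move=> n; exists (- n%:R).
- apply/seteqP; split => // x _; exists (Num.truncn `|x|).+1 => //=.
  rewrite in_itv /= andbT ltrNl; apply: le_lt_trans (ler_norm _) _.
  by rewrite normrN truncnS_gt.
- by move=> _ [t ->]; exact: E.
- move=> k; apply: (@le_lt_trans _ _ 1%E); last exact: ltry.
  exact: probability_le1 (mWk k).
Qed.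

(** The joint law is the product of the two laws, then Tonelli. Both integrals are pulled back to
    the same space, so the Pareto formula can be applied to each variable in turn. *)
Lemma ge0_integral_indep_pair (W1 W2 : T -> R) (g : R * R -> \bar R) :
  measurable_fun setT W1 -> measurable_fun setT W2 ->
  (forall A B, measurable A -> measurable B ->
     P ((W1 @^-1` A) `&` (W2 @^-1` B)) = (P (W1 @^-1` A) * P (W2 @^-1` B))%E) ->
  measurable_fun setT g -> (forall x, 0 <= g x)%E ->
  (\int[P]_x g (W1 x, W2 x) = \int[P]_x \int[P]_y g (W1 x, W2 y))%E.
Proof.
move=> m1 m2 ind mg g0.
pose X1 : {mfun T >-> R} := HB.pack W1 (isMeasurableFun.Build _ _ _ _ _ m1).
pose X2 : {mfun T >-> R} := HB.pack W2 (isMeasurableFun.Build _ _ _ _ _ m2).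
have mW : measurable_fun setT (fun x => (W1 x, W2 x)).
  exact: measurable_fun_pair.
transitivity (\int[pushforward P (fun x => (W1 x, W2 x))]_z g z)%E.
  by rewrite (ge0_integral_pushforward mW).
pose n := measure_function_pushforward__canonical__measure_function_Measure P mW.
rewrite -[LHS]/(\int[n]_x g x)%E.
transitivity (\int[(distribution P X1 \x distribution P X2)%E]_z g z)%E.
  apply: eq_measure_integral => A mA _; apply/esym.
  apply: (@product_measure_unique _ _ _ _ R (distribution P X1)
    (distribution P X2) n) => // B C mB mC; exact: ind.
rewrite fubini_tonelli1 //.
rewrite ge0_integral_distribution //; last 2 first.
- exact: measurable_fun_fubini_tonelli_F.
- by move=> x; apply: integral_ge0.
apply: eq_integral => x _; rewrite /fubini_F /=.
rewrite ge0_integral_distribution //.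
exact: measurableT_comp mg (measurable_pair1 _).
Qed.

End Law.

End Pareto.

(** * From the Levy-Prokhorov distance to integrals of Lipschitz functions *)

Section Staircase.
Variable R : realType.

(** For y >= 0 the staircase is h times the number of k < M with k h < y: it rounds y up to a
    multiple of h and is capped at M h. *)
Lemma staircase_ge (h y : R) (M : nat) : 0 < h ->
  Num.min y (M%:R * h) <= \sum_(k < M) h * (k%:R * h < y)%R%:R.
Proof.
move=> h0; elim: M => [|M IH]; first by rewrite big_ord0 mul0r ge_min lexx orbT.
rewrite big_ord_recr /=; case: ltP => yM; last first.
  rewrite mulr0 addr0; apply: le_trans IH.
  by rewrite le_min ge_min lexx /= ge_min yM.
rewrite mulr1; move: IH; rewrite (min_idPr (ltW yM)) => IH.
rewrite ge_min; apply/orP; right.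
by rewrite -addn1 natrD mulrDl mul1r lerD2r.
Qed.

Lemma staircase_le (h y : R) (M : nat) : 0 < h -> 0 <= y ->
  \sum_(k < M) h * (k%:R * h < y)%R%:R <= y + h.
Proof.
move=> h0 y0; elim: M => [|M IH]; first by rewrite big_ord0 addr_ge0 // ltW.
rewrite big_ord_recr /=; case: ltP => yM; last by rewrite mulr0 addr0.
rewrite mulr1 lerD2r; apply: le_trans (ltW yM).
have -> : M%:R * h = \sum_(k < M) h by rewrite sumr_const card_ord mulr_natl.
by apply: ler_sum => k _; case: (_ < y); rewrite ?mulr1 ?mulr0 // ltW.
Qed.

End Staircase.

Section LevyProkhorov.
Variable R : realType.
Local Notation TR := (measurableTypeR R).
Variables (f : R -> R) (K L : R).
Hypotheses (mf : measurable_fun setT (f : TR -> R)).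
Hypotheses (f0 : forall x, 0 <= f x) (fK : forall x, f x <= K) (K0 : 0 < K).
Hypotheses (L0 : 0 <= L) (fL : forall x y, `|f x - f y| <= L * `|x - y|).

Lemma measurable_superlevel (t : R) : measurable ([set x | t < f x] : set TR).
Proof.
have -> : [set x : TR | t < f x] = f @^-1` `]t, +oo[%classic.
  by apply/seteqP; split => x /=; rewrite in_itv /= andbT.
by rewrite -[X in measurable X]setTI; apply: mf.
Qed.

Lemma integral_staircase (m : {measure set TR -> \bar R}) (h s : R) (M : nat) :
  0 <= h ->
  (\int[m]_x (\sum_(k < M) h * (k%:R * h < f x + s)%R%:R)%:E =
   \sum_(k < M) h%:E * m [set x | (k%:R * h - s < f x)%R])%E.
Proof.
move=> h0; under eq_integral do rewrite -sumEFin.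
have E (k : nat) : (fun x => (h * (k%:R * h < f x + s)%R%:R)%:E) =
    (fun x => h%:E * (\1_[set x | (k%:R * h - s < f x)%R] x)%:E)%E.
  apply/funext => x; rewrite EFinM indicE; congr (_ * ((nat_of_bool _)%:R)%:E)%E.
  by apply/idP/idP; rewrite -ltrBlDr inE.
rewrite ge0_integral_sum //.
- apply: eq_bigr => k _; rewrite E ge0_integralZl_EFin //.
  + rewrite integral_indic ?setIT //; exact: measurable_superlevel.
  + by apply/measurable_EFinP/measurable_indic; exact: measurable_superlevel.
- move=> k; rewrite E; apply: measurable_funeM.
  by apply/measurable_EFinP/measurable_indic; exact: measurable_superlevel.
- by move=> k x _; rewrite lee_fin mulr_ge0.
Qed.

(* Layer cake: f is squeezed between staircases of step K / M whose integrals are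
   sums of measures of superlevel sets; an e-enlargement of {t < f} lies in
   {t - L e < f}. *)
Lemma lp_integral_le (nu mu : {measure set TR -> \bar R}) (e : R) (M : nat) :
  0 < e -> (mu setT <= 1)%E -> (0 < M)%N ->
  (forall A : set TR, measurable A ->
     (nu A <= mu (\bigcup_(a in A) ball (a : R) e) + e%:E)%E) ->
  (\int[nu]_x (f x)%:E <=
   \int[mu]_x (f x)%:E + (L * e + K * e + K / M%:R)%:E)%E.
Proof.
(* Origin of the three errors: [L * e] from the enlargement of superlevel sets, [K * e] from the
   additive [e] at each of [M] levels of height [h], and [h] from rounding up. *)
move=> e0 mu1 M0 lp; set h := K / M%:R.
have M0' : 0 < M%:R :> R by rewrite ltr0n.
have h0 : 0 < h by rewrite divr_gt0.
have Mh : M%:R * h = K by rewrite /h mulrC divfK ?gt_eqF.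
have mEf : measurable_fun setT (fun x : TR => (f x)%:E).
  exact/measurable_EFinP.
have mst (s : R) : measurable_fun setT
    (fun x : TR => (\sum_(k < M) h * (k%:R * h < f x + s)%R%:R)%:E).
  apply/measurable_EFinP; apply: measurable_bigsum => k _.
  apply: measurable_funM => //.
  have -> : (fun x : TR => (k%:R * h < f x + s)%R%:R : R) =
      \1_[set x | k%:R * h - s < f x].
    apply/funext => x; rewrite indicE; congr ((nat_of_bool _)%:R).
    by apply/idP/idP; rewrite -ltrBlDr inE.
  by apply: measurable_indic; apply: measurable_superlevel.
have st0 (s x : R) : 0 <= \sum_(k < M) h * (k%:R * h < f x + s)%R%:R.
  by apply: sumr_ge0 => k _; rewrite mulr_ge0 // ltW.
apply: (@le_trans _ _
    (\int[nu]_x (\sum_(k < M) h * (k%:R * h < f x + 0)%R%:R)%:E)%E).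
  apply: ge0_le_integral => //.
  - by move=> x _; rewrite lee_fin.
  - move=> x _; rewrite lee_fin addr0; apply: le_trans (staircase_ge _ _ h0).
    by rewrite Mh (min_idPl (fK x)).
rewrite (integral_staircase _ _ _ (ltW h0)).
apply: (@le_trans _ _
   (\sum_(k < M) h%:E * (mu [set x | (k%:R * h - L * e < f x)%R] + e%:E))%E).
  apply: lee_sum => k _; apply: lee_wpmul2l; first by rewrite lee_fin ltW.
  rewrite subr0; apply: le_trans (lp _ (measurable_superlevel _)) _.
  rewrite leeD2r //; apply: le_measure.
  - rewrite inE; apply: open_measurable; apply: bigcup_open => a _.
    exact: ball_open.
  - by apply/mem_set; apply: measurable_superlevel.
  - move=> x [a /= ka]; rewrite /ball /= => ax.
    have := fL a x => /ler_normlW fax.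
    have : L * `|a - x| <= L * e by apply: ler_wpM2l => //; exact: ltW.
    by move: ka fax; lra.
have -> : (\sum_(k < M) h%:E * (mu [set x | (k%:R * h - L * e < f x)%R] + e%:E) =
    \sum_(k < M) h%:E * mu [set x | (k%:R * h - L * e < f x)%R] + (K * e)%:E)%E.
  rewrite (eq_bigr (fun k : 'I_M =>
    (h%:E * mu [set x | (k%:R * h - L * e < f x)%R] + (h * e)%:E)%E)); last first.
    by move=> k _; rewrite ge0_muleDr // lee_fin ltW.
  rewrite big_split /=; congr (_ + _)%E.
  by rewrite sumEFin sumr_const card_ord -[in RHS]Mh -mulrA mulr_natl.
rewrite -(integral_staircase _ _ _ (ltW h0)).
have -> : (L * e + K * e + h)%:E = ((L * e + h)%:E + (K * e)%:E)%E.
  by rewrite -EFinD addrAC.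
rewrite addeA; apply: leeD2r.
have Le0 : 0 <= L * e by rewrite mulr_ge0 // ltW.
apply: (@le_trans _ _ (\int[mu]_x ((f x)%:E + (L * e + h)%:E))%E).
  apply: ge0_le_integral => //.
  - by move=> x _; rewrite lee_fin.
  - exact: emeasurable_funD.
  - move=> x _; rewrite -EFinD lee_fin addrA; apply: staircase_le => //.
    exact: addr_ge0.
rewrite ge0_integralD //; last 2 first.
- by move=> x _; rewrite lee_fin.
- by move=> x _; rewrite lee_fin addr_ge0 // ltW.
apply: leeD2l; rewrite integral_cst //.
by rewrite -[leRHS]mule1; apply: lee_wpmul2l => //; rewrite lee_fin addr_ge0 // ltW.
Qed.

End LevyProkhorov.

Section ESDTheory.
Variable R : realType.
Local Notation TR := (measurableTypeR R).

Lemma integral_ESD n (A : 'M[R]_n) (f : R -> R) :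
  measurable_fun setT (f : TR -> R) -> (forall x, 0 <= f x) ->
  (\int[ESD A]_x (f x)%:E =
   (n%:R^-1 * \sum_(x <- eigenvalues A) f x)%:E)%E.
Proof.
move=> mf f0.
have mEf : measurable_fun setT (fun x : TR => (f x)%:E) by exact/measurable_EFinP.
rewrite ge0_integral_mscale //; last by move=> x _; rewrite lee_fin.
rewrite ge0_integral_measure_sum //; last by move=> x _; rewrite lee_fin.
rewrite EFinM; congr (_ * _)%E.
rewrite (big_nth 0) big_mkord -sumEFin; apply: eq_bigr => k _.
by rewrite integral_dirac // diracT mul1e.
Qed.

Lemma ESD_setT_le1 n (A : 'M[R]_n) : A^T = A -> (ESD A setT <= 1)%E.
Proof.
move=> symA; have [l [x [S [pe _ _ _ _]]]] := spectral_coupling symA symA.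
have E : (ESD A setT = (n%:R^-1 * \sum_(x <- eigenvalues A) 1)%:E)%E.
  rewrite -(@integral_ESD _ _ (fun=> 1)) //.
  by rewrite integral_cst // mul1e.
rewrite E big_const_seq count_predT iter_addr_0; have -> : size (eigenvalues A) = n.
  by rewrite (perm_size pe) size_map size_enum_ord.
(* The empty matrix has the zero measure as its [ESD]; this is why mass at most 1 is claimed rather
   than mass 1. *)
rewrite lee_fin; case: n A symA {l x S pe E} => [|n] A _.
  by rewrite mulr0 ler01.
by rewrite mulVf // pnatr_eq0.
Qed.

(** For masses at most 1 the radius 1 is always admissible, so the infimum is a genuine one; an
    admissible [e] lies within [eps] of it. *)
Lemma levy_prokhorov_le (nu mu : {measure set TR -> \bar R}) (eps : R) :
  0 < eps -> (nu setT <= 1)%E -> (mu setT <= 1)%E ->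
  levy_prokhorov nu mu <= eps ->
  exists e : R, [/\ 0 < e, e < 2 * eps,
    forall A : set TR, measurable A ->
      (nu A <= mu (\bigcup_(a in A) ball (a : R) e) + e%:E)%E &
    forall A : set TR, measurable A ->
      (mu A <= nu (\bigcup_(a in A) ball (a : R) e) + e%:E)%E].
Proof.
move=> eps0 nu1 mu1; rewrite /levy_prokhorov; set D := (X in inf X) => infD.
have le1 (m : {measure set TR -> \bar R}) (A : set TR) : measurable A ->
    (m setT <= 1)%E -> (m A <= 1)%E.
  by move=> mA; apply: le_trans; apply: le_measure; rewrite ?inE.
have D1 : D 1.
  split=> // A mA; split.
    by apply: le_trans (le1 _ _ mA nu1) _; rewrite leeDr.
  by apply: le_trans (le1 _ _ mA mu1) _; rewrite leeDr.
have hD : has_inf D.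
  by split; [exists 1|exists 0 => x [/ltW]].
have [e De elt] := inf_adherent eps0 hD.
exists e; case: De => e0 De; split => //.
- by apply: lt_le_trans elt _; rewrite mulr2n mulrDl mul1r lerD2r.
- by move=> A /De [].
- by move=> A /De [].
Qed.

Section Close.
Variables (f : R -> R) (K L : R).
Hypotheses (mf : measurable_fun setT (f : TR -> R)).
Hypotheses (f0 : forall x, 0 <= f x) (fK : forall x, f x <= K) (K0 : 0 < K).
Hypotheses (L0 : 0 <= L) (fL : forall x y, `|f x - f y| <= L * `|x - y|).

Lemma levy_prokhorov_integral_le (nu mu : {measure set TR -> \bar R}) (eps : R) :
  0 < eps -> (nu setT <= 1)%E -> (mu setT <= 1)%E ->
  levy_prokhorov nu mu <= eps ->
  (\int[nu]_x (f x)%:E <= \int[mu]_x (f x)%:E + ((2 * L + 2 * K + 1) * eps)%:E)%E /\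
  (\int[mu]_x (f x)%:E <= \int[nu]_x (f x)%:E + ((2 * L + 2 * K + 1) * eps)%:E)%E.
Proof.
move=> eps0 nu1 mu1 lp.
have [e [e0 elt nuD muD]] := levy_prokhorov_le eps0 nu1 mu1 lp.
(* With e < 2 eps the first two errors give 2L + 2K; this [M] makes the rounding error at most
   [eps], whence the summand 1. *)
pose M := (Num.truncn (K / eps)).+1.
have KM : K / M%:R <= eps.
  rewrite ler_pdivrMr ?ltr0n // mulrC -ler_pdivrMr //.
  exact/ltW/truncnS_gt.
have bnd : ((L * e + K * e + K / M%:R)%:E <= ((2 * L + 2 * K + 1) * eps)%:E)%E.
  rewrite lee_fin.
  have : L * e <= L * (2 * eps) by apply: ler_wpM2l => //; exact: ltW.
  have : K * e <= K * (2 * eps) by apply: ler_wpM2l; exact: ltW.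
  by move: KM; lra.
split.
  apply: le_trans (lp_integral_le mf f0 fK K0 L0 fL e0 mu1 (isT : (0 < M)%N) nuD) _.
  exact: leeD2l.
apply: le_trans (lp_integral_le mf f0 fK K0 L0 fL e0 nu1 (isT : (0 < M)%N) muD) _.
exact: leeD2l.
Qed.

End Close.
End ESDTheory.

Section ExpectationClose.
Context d (T : measurableType d) (R : realType) (P : probability T R).
Variables (X : T -> R) (B : set T) (m K delta : R).
Hypotheses (mX : measurable_fun setT X) (mB : measurable B).
Hypotheses (X0 : forall x, 0 <= X x) (XK : forall x, X x <= K).
Hypotheses (m0 : 0 <= m) (mK : m <= K) (delta0 : 0 <= delta).
Hypothesis Xm : forall x, ~ B x -> X x <= m + delta /\ m <= X x + delta.

(** Turns convergence in probability into convergence of expectations: off [B] the variable is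
    within [delta] of [m], and on [B] the bound [K] is paid. *)
Lemma expectation_close :
  (\int[P]_x (X x)%:E <= (m + delta)%:E + K%:E * P B)%E /\
  (m%:E <= \int[P]_x (X x)%:E + delta%:E + K%:E * P B)%E.
Proof.
have K0 : 0 <= K by exact: le_trans mK.
have mEX : measurable_fun setT (fun x => (X x)%:E) by exact/measurable_EFinP.
have mI : measurable_fun setT (fun x => (\1_B x : R)%:E).
  exact/measurable_EFinP/measurable_indic.
have IB : (\int[P]_x (K%:E * (\1_B x)%:E) = K%:E * P B)%E.
  by rewrite ge0_integralZl_EFin // integral_indic // setIT.
have P1 (c : R) : (\int[P]_x c%:E = c%:E)%E.
  by rewrite integral_cst // [X in (_ * X)%E]probability_setT mule1.
have KI0 x : (0 <= K%:E * (\1_B x)%:E)%E by rewrite -EFinM lee_fin mulr_ge0.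
have mKI : measurable_fun setT (fun x => K%:E * (\1_B x : R)%:E)%E.
  exact: measurable_funeM.
split.
  rewrite -IB -[X in (X + _)%E]P1 -ge0_integralD //; last first.
    by move=> x _; rewrite lee_fin addr_ge0.
  apply: ge0_le_integral => //.
  - by move=> x _; rewrite lee_fin.
  - exact: emeasurable_funD.
  - move=> x _; rewrite -EFinM -EFinD lee_fin indicE.
    have [xB|xB] := pselect (B x).
      by rewrite mem_set // mulr1; apply: le_trans (XK x) _; rewrite lerDr addr_ge0.
    by rewrite memNset // mulr0 addr0; have [] := Xm xB.
rewrite -IB -[leLHS]P1 -[X in (_ + X + _)%E]P1.
rewrite -ge0_integralD //; last by move=> x _; rewrite lee_fin.
rewrite -ge0_integralD //; last 2 first.
- by move=> x _; rewrite -EFinD lee_fin addr_ge0.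
- exact: emeasurable_funD.
apply: ge0_le_integral => //.
- apply: emeasurable_funD => //; exact: emeasurable_funD.
- move=> x _; rewrite -EFinM -!EFinD lee_fin indicE.
  have [xB|xB] := pselect (B x).
    by rewrite mem_set // mulr1; apply: le_trans mK _; rewrite lerDr addr_ge0.
  by rewrite memNset // mulr0 addr0; have [] := Xm xB.
Qed.

End ExpectationClose.

(** * The random graph *)

(** Borel measurability of a function of the weight vector, tested on all measurable families. It
    thus applies to the sample space and equally to the coarser sigma-algebra generated by the
    weights. *)
Definition borel_fun (R : realType) (V : finType) (h : (V -> R) -> R) :=
  forall d (T : measurableType d) (U : V -> T -> R),
    (forall v, measurable_fun setT (U v)) ->
    measurable_fun setT (fun x => h (U^~ x)).

Section EdgeProb.
Variables (R : realType) (d N : nat) (alpha sigma : R).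
Local Notation V := (vertex d N).

Lemma torus_distC (u v : V) : torus_dist u v = torus_dist v u.
Proof. by apply: eq_bigr => l _; rewrite distnC. Qed.

Lemma torus_dist_refl (u : V) : torus_dist u u = 0%N.
Proof. by rewrite /torus_dist big1 // => l _; rewrite distnn min0n. Qed.

Lemma kernelC (x y : R) : Defs.kernel sigma x y = Defs.kernel sigma y x.
Proof. by rewrite /Defs.kernel maxC minC. Qed.

Lemma kernel_ge0 (x y : R) : 1 <= x -> 1 <= y -> 0 <= Defs.kernel sigma x y.
Proof.
move=> x1 y1; rewrite /Defs.kernel mulr_ge0 ?powR_ge0 // le_max.
by rewrite (le_trans ler01 x1).
Qed.

Lemma edge_probC w (u v : V) : edge_prob alpha sigma w u v = edge_prob alpha sigma w v u.
Proof. by rewrite /edge_prob kernelC torus_distC. Qed.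

Lemma edge_prob_le1 w (u v : V) : edge_prob alpha sigma w u v <= 1.
Proof. by rewrite /edge_prob ge_min lexx orbT. Qed.

Lemma edge_prob_ge0 w (u v : V) : (forall v, 1 <= w v) ->
  0 <= edge_prob alpha sigma w u v.
Proof.
by move=> w1; rewrite /edge_prob le_min ler01 andbT divr_ge0 ?powR_ge0 ?kernel_ge0.
Qed.

Lemma edge_prob_diag w (u : V) : 0 < alpha -> edge_prob alpha sigma w u u = 0.
Proof.
move=> a0; rewrite /edge_prob torus_dist_refl powR0 ?gt_eqF // invr0 mulr0.
by rewrite (min_idPl ler01).
Qed.

Lemma borel_kernel (I : finType) (u v : I) :
  borel_fun (fun w : I -> R => Defs.kernel sigma (w u) (w v)).
Proof.
move=> d' T U mU; rewrite /Defs.kernel; apply: measurable_funM.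
  exact: measurable_maxr.
apply: (measurableT_comp (measurable_powR sigma)).
exact: measurable_minr.
Qed.

Lemma borel_edge_prob (u v : V) :
  borel_fun (fun w => edge_prob alpha sigma w u v).
Proof.
move=> d' T U mU; rewrite /edge_prob; apply: measurable_minr => //.
by apply: measurable_funM => //; exact: borel_kernel.
Qed.

Lemma borel_config_weight g :
  borel_fun (fun w : V -> R => config_weight (edge_prob alpha sigma w) g).
Proof.
move=> d' T U mU; rewrite /config_weight; apply: measurable_bigprod => e _.
rewrite /slot_prob; case: (_ < _)%N => //; case: (g e).
  exact: borel_edge_prob.
by apply: measurable_funB => //; exact: borel_edge_prob.
Qed.

(** [config_weight] ranges over all slots, [config_prob] over the increasing ones: they agree when
    the other slots are false, and otherwise the weight is 0. *)
Lemma config_probE w (g : {ffun V * V -> bool}) :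
  config_weight (edge_prob alpha sigma w) g =
  if [forall e, g e ==> (enum_rank e.1 < enum_rank e.2)%N]
  then config_prob alpha sigma w (fun i j => g (i, j)) else 0.
Proof.
case: ifPn => [/forallP gE|].
  rewrite /config_prob pair_big_dep /= /config_weight [RHS]big_mkcond /=.
  apply: eq_bigr => -[i j] _; rewrite /slot_prob /=; case: ifPn => // ij.
  by have := gE (i, j); rewrite /= (negPf ij) implybF => ->.
rewrite negb_forall => /existsP [e]; rewrite negb_imply => /andP[ge /negPf ne].
by rewrite /config_weight (bigD1 e) //= /slot_prob ne ge mul0r.
Qed.

End EdgeProb.

Section Model.
Variables (R : realType) (d N : nat) (tau alpha sigma : R).
Variable G : kernel_graph d N tau alpha sigma.
Local Notation V := (vertex d N).
Local Notation Omega := (kg_space G).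
Local Notation P := (kg_prob G).

(* The weights of the model are only almost surely at least 1. *)
Definition weight (v : V) (x : Omega) : R := Num.max 1 (kg_weight G v x).

Definition config (x : Omega) : {ffun V * V -> bool} :=
  [ffun e => (enum_rank e.1 < enum_rank e.2)%N && kg_edge x e.1 e.2].

Lemma weight_ge1 v x : 1 <= weight v x.
Proof. by rewrite /weight le_max lexx. Qed.

Lemma measurable_weight v : measurable_fun setT (weight v).
Proof. exact: measurable_maxr. Qed.

Let measurable_max1 (B : set R) : measurable B ->
  measurable (Num.max (1 : R) @^-1` B).
Proof.
move=> mB; rewrite -[X in measurable X]setTI.
by apply: measurable_maxr => //; exact: measurable_id.
Qed.

Lemma weight_pareto v t : P [set x | t < weight v x] =
  (if 1 <= t then t `^ (- (tau - 1)) else 1)%:E.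
Proof.
have [t1|t1] := leP 1 t.
  have := kg_weight_pareto G v t; rewrite t1 => <-; congr (P _); apply/seteqP; split=> x /=.
    by rewrite /weight lt_max ltNge t1.
  by rewrite /weight lt_max => ->; rewrite orbT.
rewrite -(@probability_setT _ _ _ P); congr (P _).
by apply/seteqP; split=> x //= _; rewrite /weight lt_max t1.
Qed.

Lemma weight_indep (B : V -> set R) : (forall v, measurable (B v)) ->
  (P [set x | forall v, B v (weight v x)] = \prod_v P (weight v @^-1` B v))%E.
Proof.
move=> mB; apply: (@kg_weight_indep R d N tau alpha sigma G
  (fun v => Num.max 1 @^-1` B v)) => v; exact: measurable_max1.
Qed.

Lemma graph_config x : graph_of (config x) = kg_edge x.
Proof.
apply/funext => u; apply/funext => v; rewrite /graph_of ffunE.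
have [->|uv] := eqVneq u v.
  by rewrite /canon_pair ltnn /= ltnn kg_edge_irrefl.
rewrite canon_lt //=; apply: (canon_sym (u, v)); exact: kg_edge_sym.
Qed.

Lemma measurable_config g : measurable [set x | config x = g].
Proof.
pose S (e : V * V) : set Omega :=
  [set x | ((enum_rank e.1 < enum_rank e.2)%N && kg_edge x e.1 e.2) = g e].
rewrite (_ : mkset _ = \bigcap_(e in [set: V * V]) S e).
  apply: fin_bigcap_measurable => // e _; rewrite /S.
  have mE := kg_edge_measurable G e.1 e.2.
  case: (g e); case: (_ < _)%N => /=.
  - exact: mE.
  - by rewrite (_ : mkset _ = set0) //; apply/seteqP; split.
  - rewrite (_ : mkset _ = ~` [set x | kg_edge x e.1 e.2]); first exact: measurableC.
    by apply/seteqP; split=> x /=; [move=> ->|move/negP/negPf].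
  - by rewrite (_ : mkset _ = setT) //; apply/seteqP; split.
apply/seteqP; split=> [x /= cx e _|x H /=].
  by rewrite /S /= -cx ffunE.
by apply/ffunP => e; rewrite ffunE; exact: (H e I).
Qed.

Lemma measurable_fun_config (F : {ffun V * V -> bool} -> R) :
  measurable_fun setT (F \o config).
Proof.
move=> _ Y mY; rewrite setTI.
rewrite (_ : _ @^-1` _ = \bigcup_(g in [set g | Y (F g)]) [set x | config x = g]).
  by apply: fin_bigcup_measurable => // g _; exact: measurable_config.
by apply/seteqP; split=> [x /= Yx|x [g /= Yg cx]] /=; [exists (config x)|rewrite cx].
Qed.

(** The event that a weight is below 1 is the union over n of the events that it is at most 1 -
    1/(n+1); these are null because the tail equals 1 below 1. *)
Lemma weight_ae : {ae P, forall x v, weight v x = kg_weight G v x}.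
Proof.
apply: filter_forall => v.
pose F n := [set x : Omega | kg_weight G v x <= 1 - n.+1%:R^-1].
have FC n : F n = ~` [set x | 1 - n.+1%:R^-1 < kg_weight G v x].
  by apply/seteqP; split=> x; rewrite /F /= leNgt => /negP.
have mFC n : measurable [set x | 1 - n.+1%:R^-1 < kg_weight G v x].
  rewrite (_ : mkset _ = kg_weight G v @^-1` `]1 - n.+1%:R^-1, +oo[%classic).
    by rewrite -[X in measurable X]setTI; apply: measurable_funP.
  by apply/seteqP; split => x /=; rewrite in_itv /= andbT.
have mF n : measurable (F n) by rewrite FC; exact: measurableC.
have F0 n : P (F n) = 0%E.
  rewrite FC probability_setC // kg_weight_pareto.
  by rewrite ifF ?subee // leNgt ltrBlDr ltrDl invr_gt0 ltr0n.
have : P.-negligible (\bigcup_n F n).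
  by apply: negligible_bigcup => n; apply/(negligibleP _ (mF n)); exact: F0.
apply: negligibleS => x /= /eqP; rewrite /weight; case: leP => [_|lt1 _].
  by rewrite eqxx.
have e0 : 0 < 1 - kg_weight G v x by rewrite subr_gt0.
exists (Num.truncn (1 - kg_weight G v x)^-1) => //; rewrite /F /=.
rewrite lerBrDr addrC -lerBrDr -[leRHS]invrK lef_pV2 ?posrE ?invr_gt0 ?ltr0n //.
exact/ltW/truncnS_gt.
Qed.

Local Notation p := (edge_prob alpha sigma).

(** [kg_edge_law] for the truncated weights: the event has the required form for the preimages of
    [B v] under [Num.max 1], and the integrands agree almost everywhere. If [g] has a true slot off
    the increasing ones, both sides are 0. *)
Lemma config_law (B : V -> set R) g : (forall v, measurable (B v)) ->
  (P ([set x | forall v, B v (weight v x)] `&` [set x | config x = g]) =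
   \int[P]_(x in [set x | forall v, B v (weight v x)])
     (config_weight (p (weight^~ x)) g)%:E)%E.
Proof.
move=> mB; pose B' v := Num.max (1 : R) @^-1` B v.
have mB' v : measurable (B' v) by exact: measurable_max1.
have mS : measurable [set x | forall v, B v (weight v x)].
  rewrite (_ : mkset _ = \bigcap_(v in [set: V]) (weight v @^-1` B v)).
    apply: fin_bigcap_measurable => // v _.
    by rewrite -[X in measurable X]setTI; exact: measurable_weight.
  by apply/seteqP; split => x /= xC v; [move=> _|]; exact: xC.
have mcw (w : V -> Omega -> R) : (forall v, measurable_fun setT (w v)) ->
    measurable_fun [set x | forall v, B v (weight v x)]
      (fun x => (config_weight (p (w^~ x)) g)%:E).
  move=> mw; apply: measurable_funTS; apply/measurable_EFinP.
  exact: borel_config_weight.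
rewrite (@ae_eq_integral _ _ _ P _
  (fun x => (config_weight (p (fun v => kg_weight G v x)) g)%:E) _ mS); last 3 first.
- exact: mcw measurable_weight.
- exact: (mcw (fun v x => kg_weight G v x)).
- apply: filterS weight_ae => x xE _; congr ((config_weight (p _) g)%:E).
  by apply/funext => v; rewrite xE.
have [gE|gE] := boolP [forall e, g e ==> (enum_rank e.1 < enum_rank e.2)%N].
  under eq_integral do rewrite config_probE gE.
  move/forallP: gE => gE.
  rewrite -(kg_edge_law G _ mB'); congr (P _).
  apply/seteqP; split=> x /= [xB xg]; split => //.
    by move=> i j ij; rewrite -xg ffunE ij.
  apply/ffunP => -[i j]; rewrite ffunE /=.
  have [ij|ij] := boolP (enum_rank i < enum_rank j)%N; first exact: xg.
  by have := gE (i, j); rewrite /= (negPf ij) implybF => /negPf ->.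
under eq_integral do rewrite config_probE (negPf gE).
move: gE; rewrite negb_forall => /existsP [e].
rewrite negb_imply => /andP[ge /negPf ne].
rewrite integral0 (_ : _ `&` _ = set0) ?measure0 //.
apply/seteqP; split => // x [_ /= xg].
by move: ge; rewrite -xg ffunE ne.
Qed.

Hypothesis alpha0 : 0 < alpha.

Lemma config_weight_ge0 (w : V -> R) g : (forall v, 1 <= w v) ->
  0 <= config_weight (p w) g.
Proof.
move=> w1; apply: prodr_ge0 => e _; rewrite /slot_prob.
case: ifP => _; last by [].
by case: (g e); rewrite ?subr_ge0 ?edge_prob_le1 ?edge_prob_ge0.
Qed.

(** Conditioning on the weights: the edges are averaged out first. After splitting over the finitely
    many configurations [g], the factor in [H] depends on the weights alone, and the indicator of
    [g] is exchanged for its conditional probability by the pi-system lemma. *)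
Lemma config_transfer (H : (V -> R) -> {ffun V * V -> bool} -> R) :
  (forall g, borel_fun (H ^~ g)) ->
  (forall w g, (forall v, 1 <= w v) -> 0 <= H w g) ->
  (\int[P]_x (H (weight^~ x) (config x))%:E =
   \int[P]_x (\sum_g config_weight (p (weight^~ x)) g * H (weight^~ x) g)%:E)%E.
Proof.
move=> mH H0.
have w1 x v : 1 <= weight v x by exact: weight_ge1.
have mw := measurable_weight.
have mHw g : measurable_fun setT (fun x => H (weight^~ x) g) by exact: mH.
have mcw g : measurable_fun setT (fun x => config_weight (p (weight^~ x)) g).
  exact: borel_config_weight.
pose z1 g x : R := \1_[set x | config x = g] x.
have mz1 g : measurable_fun setT (z1 g).
  by apply: measurable_indic; exact: measurable_config.
transitivity (\int[P]_x (\sum_g (H (weight^~ x) g)%:E * (z1 g x)%:E)%E)%E.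
  apply: eq_integral => x _; rewrite (bigD1 (config x)) //= big1 ?adde0.
    by rewrite /z1 indicE mem_set // mule1.
  by move=> g gx; rewrite /z1 indicE memNset ?mule0 //= => /esym/eqP; apply/negP.
transitivity (\int[P]_x (\sum_g (H (weight^~ x) g)%:E *
    (config_weight (p (weight^~ x)) g)%:E)%E)%E; last first.
  apply: eq_integral => x _; rewrite -sumEFin; apply: eq_bigr => g _.
  by rewrite muleC EFinM.
rewrite ge0_integral_sum //; last 2 first.
- by move=> g; apply: emeasurable_funM; exact/measurable_EFinP.
- by move=> g x _; rewrite -EFinM lee_fin mulr_ge0 // H0.
rewrite ge0_integral_sum //; last 2 first.
- by move=> g; apply: emeasurable_funM; exact/measurable_EFinP.
- by move=> g x _; rewrite -EFinM lee_fin mulr_ge0 ?H0 // config_weight_ge0.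
apply: eq_bigr => g _.
pose GG := [set S | exists B : V -> set R, (forall v, measurable (B v)) /\
  S = [set x | forall v, B v (weight v x)]].
have mGG : GG `<=` measurable.
  move=> _ [B [mB ->]].
  rewrite (_ : mkset _ = \bigcap_(v in [set: V]) (weight v @^-1` B v)).
    apply: fin_bigcap_measurable => // v _.
    by rewrite -[X in measurable X]setTI; exact: measurable_weight.
  by apply/seteqP; split => x /= xC v; [move=> _|]; exact: xC.
apply: (@ge0_integral_pi_system _ _ _ P GG _ _ _ (z1 g)) => //.
- move=> _ _ [A [mA ->]] [B [mB ->]]; exists (fun v => A v `&` B v).
  split; first by move=> v; exact: measurableI.
  apply/seteqP; split => x /= => [[xA xB] v|xAB]; first by split.
  by split=> v; have [] := xAB v.
- by exists (fun=> setT); split => //; apply/seteqP; split.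
- by move=> x; exact: config_weight_ge0.
- move=> S GS; have mS := mGG _ GS; case: GS => B [mB SE].
  rewrite integral_indic //; last exact: measurable_config.
  by rewrite setIC SE; exact: config_law.
- rewrite integral_indic ?setIT //; last exact: measurable_config.
  apply: le_lt_trans (ltry 1); apply: probability_le1.
  exact: measurable_config.
- apply/measurable_EFinP; apply: mH => v _ Y mY; rewrite setTI.
  apply: sub_sigma_algebra; exists (fun u => if u == v then Y else setT).
  split; first by move=> u; case: ifP.
  apply/seteqP; split => x /= => [xY u|/(_ v)]; last by rewrite eqxx.
  by case: eqP => // ->.
- by move=> x; rewrite lee_fin H0.
Qed.

End Model.

(** * Distances on the torus and the growth of the scaling *)

Section Torus.
Variables (R : realType) (d N' : nat) (alpha : R).
Local Notation N := N'.+1.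
Local Notation V := (vertex d N).

Definition torus_norm (j : V) : nat := \sum_(l < d) minn (j l) (N - j l).

(** Addition in an ordinal type of successor size is modulo [N], so this is the translation of the
    torus; it reduces sums of distances from any vertex to sums of norms. *)
Definition torus_shift (i j : V) : V := [ffun l => i l + j l].

Lemma torus_shift_bij i : bijective (torus_shift i).
Proof.
exists (fun j : V => [ffun l => j l - i l] : V) => j; apply/ffunP => l;
  rewrite !ffunE; first by rewrite addrC addKr.
by rewrite addrC subrK.
Qed.

Lemma torus_dist_shift (i j : V) : torus_dist i (torus_shift i j) = torus_norm j.
Proof.
apply: eq_bigr => l _; rewrite ffunE /=.
have := ltn_ord (i l); have := ltn_ord (j l).
move: (nat_of_ord (i l)) (nat_of_ord (j l)) => a b bN aN.
have [abN|abN] := ltnP (a + b) N.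
  by rewrite modn_small //; lia.
have -> : ((a + b) %% N = a + b - N)%N.
  by rewrite -[in LHS](subnK abN) modnDr modn_small //; lia.
by lia.
Qed.

Lemma sum_torus_dist (F : nat -> R) (i : V) :
  \sum_j F (torus_dist i j) = \sum_(j : V) F (torus_norm j).
Proof.
rewrite (reindex (torus_shift i)) /=; last exact/onW_bij/torus_shift_bij.
by apply: eq_bigr => j _; rewrite torus_dist_shift.
Qed.

Hypothesis alpha0 : 0 < alpha.

(* Equal to 0 on the diagonal, because 0 `^ alpha = 0 and 0^-1 = 0. *)
Definition edge_decay (u v : V) : R := ((torus_dist u v)%:R `^ alpha)^-1.

Lemma edge_decay_ge0 u v : 0 <= edge_decay u v.
Proof. by rewrite invr_ge0 powR_ge0. Qed.

(** By homogeneity all row sums are equal, hence each equals c_N, which is their average. So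
    [edge_decay / c] is a stochastic kernel. *)
Lemma sum_edge_decay u : \sum_v edge_decay u v = scaling d N alpha.
Proof.
have diag i : edge_decay i i = 0.
  by rewrite /edge_decay torus_dist_refl powR0 ?gt_eqF // invr0.
have E i : \sum_(j : V | i != j) ((torus_dist i j)%:R `^ alpha)^-1 =
    \sum_v edge_decay u v.
  transitivity (\sum_v edge_decay i v).
    rewrite [RHS](bigD1 i) //= diag add0r.
    by apply: eq_bigl => j; rewrite eq_sym.
  by rewrite !(sum_torus_dist (fun k => (k%:R `^ alpha)^-1)).
rewrite /scaling [X in _ = _ * X](eq_bigr _ (fun i _ => E i)).
rewrite [X in _ = _ * X]sumr_const card_ffun !card_ord -[X in _ * X]mulr_natl.
by rewrite mulKf // pnatr_eq0 expn_eq0.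
Qed.

Lemma card_torus_ball K : (#|[pred j : V | torus_norm j < K]| <= (2 * K).+1 ^ d)%N.
Proof.
(* In a ball each coordinate is within [K] of 0 modulo [N], from the left or from the right; the two
   cases are coded by disjoint ranges below 2K. The successor keeps the target type inhabited for
   [inord]. *)
pose f (j : V) : {ffun 'I_d -> 'I_(2 * K).+1} :=
  [ffun l => inord (if j l < K then nat_of_ord (j l) else K + (N - j l))%N].
have <- : #|{ffun 'I_d -> 'I_(2 * K).+1}| = ((2 * K).+1 ^ d)%N.
  by rewrite card_ffun !card_ord.
have minK (j : V) l : j \in [pred j : V | (torus_norm j < K)%N] ->
    (minn (j l) (N - j l) < K)%N.
  rewrite inE; apply: leq_ltn_trans; rewrite /torus_norm (bigD1 l) //=.
  exact: leq_addr.
apply: (@leq_card_in _ _ f) => i j iK jK /ffunP fij.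
apply/ffunP => l; have := fij l; rewrite !ffunE => /(congr1 (@nat_of_ord _)).
have := minK _ l iK; have := minK _ l jK.
have := ltn_ord (i l); have := ltn_ord (j l) => jN iN mj mi.
rewrite !inordK; try by case: ifP; lia.
by move=> E; apply: ord_inj; move: E; case: ifP; case: ifP; lia.
Qed.

(** Split at distance [K]: nearer terms are at most 1 and are counted by the ball; for the others
    the extra factor of exponent [eta] is at most K^(-alpha eta). *)
Lemma sum_edge_decay_pow (eta : R) (K : nat) u : 0 < eta -> (0 < K)%N ->
  \sum_v edge_decay u v `^ (1 + eta) <=
  ((2 * K).+1 ^ d)%:R + K%:R `^ (- (alpha * eta)) * scaling d N alpha.
Proof.
move=> eta0 K0; rewrite -(sum_edge_decay u).
have eta1 : 0 < 1 + eta by rewrite addr_gt0.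
rewrite (sum_torus_dist (fun k => ((k%:R `^ alpha)^-1) `^ (1 + eta))).
rewrite (sum_torus_dist (fun k => (k%:R `^ alpha)^-1)).
apply: (@le_trans _ _ (\sum_(j : V) ((torus_norm j < K)%N%:R +
    K%:R `^ (- (alpha * eta)) * ((torus_norm j)%:R `^ alpha)^-1))); last first.
  rewrite big_split /= -mulr_sumr lerD2r -natr_sum ler_nat.
  apply: leq_trans (card_torus_ball K).
  by rewrite -sum1_card [leqRHS]big_mkcond.
apply: ler_sum => j _; move: (torus_norm j) => k.
have r0 : 0 <= (k%:R `^ alpha)^-1 :> R by rewrite invr_ge0 powR_ge0.
case: k r0 => [|k] r0.
  rewrite powR0 ?gt_eqF // invr0 powR0 ?gt_eqF // mulr0 addr0.
have k1 : 1 <= k.+1%:R :> R by rewrite ler1n.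
have kE : ((k.+1%:R `^ alpha)^-1) `^ (1 + eta) =
    k.+1%:R `^ (- (alpha * eta)) * (k.+1%:R `^ alpha)^-1 :> R.
  rewrite -powRN -powRrM -powRD; last by rewrite pnatr_eq0 implybT.
  by congr (_ `^ _); ring.
rewrite kE; have [kK|kK] := ltnP k.+1 K.
  apply: (@le_trans _ _ 1); last by rewrite lerDl mulr_ge0 ?powR_ge0.
  rewrite mulr_ile1 ?powR_ge0 //.
    rewrite -[leRHS](powRr0 k.+1%:R); apply: ler_powR => //.
    by rewrite oppr_le0 mulr_ge0 // ltW.
  rewrite -powRN -[leRHS](powRr0 k.+1%:R); apply: ler_powR => //.
  by rewrite oppr_le0 ltW.
rewrite add0r; apply: ler_wpM2r => //.
rewrite !powRN lef_pV2 ?posrE ?powR_gt0 ?ltr0n //.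
by apply: ge0_ler_powR; rewrite ?nnegrE ?ler_nat // mulr_ge0 // ltW.
Qed.

Lemma torus_norm_le (j : V) : (torus_norm j <= d * N)%N.
Proof.
rewrite -[d in (d * _)%N]card_ord -sum_nat_const; apply: leq_sum => l _.
by apply: leq_trans (geq_minl _ _) _; exact: ltnW.
Qed.

(** All distances between distinct vertices are replaced by the crude maximum [d * N]. *)
Lemma scaling_ge : (0 < d)%N ->
  (N ^ d).-1%:R * ((d * N)%:R `^ alpha)^-1 <= scaling d N alpha.
Proof.
move=> d0; rewrite -(sum_edge_decay 0).
rewrite (sum_torus_dist (fun k => (k%:R `^ alpha)^-1)).
rewrite (bigD1 (0 : V)) //= -[leLHS]add0r; apply: lerD.
  by rewrite invr_ge0 powR_ge0.
apply: (@le_trans _ _ (\sum_(j : V | j != 0) ((d * N)%:R `^ alpha)^-1)).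
  rewrite sumr_const -[leRHS]mulr_natl; apply: ler_wpM2r.
    by rewrite invr_ge0 powR_ge0.
  have -> : (N ^ d).-1 = #|predC1 (0 : V)| by rewrite cardC1 card_ffun !card_ord.
  by rewrite ler_nat; apply: eq_leq; apply: eq_card.
apply: ler_sum => j j0.
have nj : (0 < torus_norm j)%N.
  rewrite lt0n; apply: contraNneq j0 => /eqP.
  rewrite sum_nat_eq0 => /forallP j0; apply/eqP/ffunP => l; rewrite ffunE.
  have := j0 l; have := ltn_ord (j l) => jN /= /eqP jl.
  by apply: ord_inj => /=; move: (nat_of_ord _) jN jl => k; lia.
rewrite lef_pV2 ?posrE ?powR_gt0 ?ltr0n ?muln_gt0 ?d0 //.
by apply: ge0_ler_powR; rewrite ?nnegrE ?ler_nat ?torus_norm_le // ltW.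
Qed.

End Torus.

Section TorusLimit.
Variables (R : realType) (d : nat) (alpha : R).
Hypotheses (d0 : (0 < d)%N) (alpha0 : 0 < alpha) (alphad : alpha < d%:R).

Lemma scaling_large (A : R) :
  exists N0, forall N', (N0 <= N')%N -> A <= scaling d N'.+1 alpha.
Proof.
have s0 : 0 < d%:R - alpha by rewrite subr_gt0.
have dR0 : 0 < d%:R :> R by rewrite ltr0n.
(* The lower bound for c_N is of order N^(d - alpha). The factor 2 pays for N^d - 1 >= N^d / 2, and
   d^alpha for the bound [d * N] on distances. *)
pose B := 2 * d%:R `^ alpha * Num.max A 0.
have B0 : 0 <= B by rewrite !mulr_ge0 ?powR_ge0 // le_max lexx orbT.
exists (Num.truncn (B `^ (d%:R - alpha)^-1)).+1 => N' NN'.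
have NB : B <= N'.+1%:R `^ (d%:R - alpha).
  have -> : B = (B `^ (d%:R - alpha)^-1) `^ (d%:R - alpha).
    by rewrite -powRrM mulVf ?gt_eqF // powRr1.
  apply: ge0_ler_powR; rewrite ?nnegrE ?powR_ge0 ?(ltW s0) //.
  apply: (le_trans (ltW (truncnS_gt _))).
  by rewrite ler_nat (leq_trans NN').
apply: le_trans (scaling_ge N' alpha0 d0).
apply: (@le_trans _ _ (Num.max A 0)); first by rewrite le_max lexx.
have N0 : 0 < N'.+1%:R :> R by rewrite ltr0n.
have da0 : 0 < d%:R `^ alpha by rewrite powR_gt0.
rewrite natrM powRM ?ler0n // ler_pdivlMr ?mulr_gt0 ?powR_gt0 //.
have half : N'.+1%:R `^ d%:R <= 2 * (N'.+1 ^ d).-1%:R :> R.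
  rewrite powR_mulrn // -natrX -natrM ler_nat.
  have N2 : (2 <= N'.+1)%N by rewrite ltnS; apply: leq_trans NN'.
  have : (2 <= N'.+1 ^ d)%N.
    by apply: (leq_trans N2); rewrite -{1}(expn1 N'.+1) leq_exp2l.
  by move: (N'.+1 ^ d)%N => k; lia.
have NE : N'.+1%:R `^ d%:R = N'.+1%:R `^ (d%:R - alpha) * N'.+1%:R `^ alpha.
  by rewrite -powRD ?subrK // gt_eqF ?implybT.
have : B * N'.+1%:R `^ alpha <= 2 * (N'.+1 ^ d).-1%:R.
  by apply: le_trans half; rewrite NE ler_wpM2r ?powR_ge0.
by rewrite /B -!mulrA ler_pM2l // mulrCA.
Qed.

(** [K] makes the far part at most [eps / 2] times the scaling; once [K] is fixed, the number of
    near vertices is constant and is absorbed because the scaling diverges. *)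
Lemma sum_edge_decay_small (eta eps : R) : 0 < eta -> 0 < eps ->
  exists N0, forall N', (N0 <= N')%N -> 1 <= scaling d N'.+1 alpha /\
    forall u : vertex d N'.+1,
    \sum_v edge_decay alpha u v `^ (1 + eta) <= eps * scaling d N'.+1 alpha.
Proof.
move=> eta0 eps0.
have ae0 : 0 < alpha * eta by rewrite mulr_gt0.
pose K := (Num.truncn ((2 / eps) `^ (alpha * eta)^-1)).+1.
have KE : K%:R `^ (- (alpha * eta)) <= eps / 2.
  rewrite powRN -[leRHS]invrK invf_div lef_pV2 ?posrE ?powR_gt0 ?divr_gt0 ?ltr0n //.
  have -> : 2 / eps = ((2 / eps) `^ (alpha * eta)^-1) `^ (alpha * eta).
    by rewrite -powRrM mulVf ?gt_eqF // powRr1 // divr_ge0 // ltW.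
  by apply: ge0_ler_powR; rewrite ?nnegrE ?powR_ge0 ?(ltW ae0) // ltW // truncnS_gt.
pose D := ((2 * K).+1 ^ d)%:R : R.
have [N1 H1] := scaling_large 1.
have [N2 H2] := scaling_large (2 * D / eps).
exists (maxn N1 N2) => N'; rewrite geq_max => /andP[/H1 c1 /H2 c2].
split=> // u; apply: le_trans (sum_edge_decay_pow alpha0 u eta0 (isT : (0 < K)%N)) _.
have c0 : 0 <= scaling d N'.+1 alpha by rewrite (le_trans ler01).
have : K%:R `^ (- (alpha * eta)) * scaling d N'.+1 alpha <=
    eps / 2 * scaling d N'.+1 alpha by rewrite ler_wpM2r.
have : D <= eps / 2 * scaling d N'.+1 alpha.
  by move: c2; rewrite ler_pdivrMr //; lra.
by rewrite -/D; lra.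
Qed.

End TorusLimit.

(** * Comparison of spectral sums through the coupling *)

Section SpectralComparison.
Variable R : realType.

(* If |l| > T then either |x| >= |l|/2 >= T/2 or |l - x| >= |l|/2. *)
Lemma sqr_tail_le (l x T : R) : 0 < T ->
  l ^+ 2 - Num.min `|l| T ^+ 2 <= 16 / T ^+ 2 * x ^+ 4 + 4 * (l - x) ^+ 2.
Proof.
move=> T0; have T2 : 0 < T ^+ 2 by rewrite exprn_gt0.
have rhs0 : 0 <= 16 / T ^+ 2 * x ^+ 4.
  by rewrite mulr_ge0 ?divr_ge0 ?exprn_even_ge0 // ltW.
have y0 : 0 <= 4 * (l - x) ^+ 2 by rewrite mulr_ge0 ?sqr_ge0.
case: (leP `|l| T) => lT; first by rewrite real_normK ?num_real // subrr addr_ge0.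
have T2' : 0 <= T ^+ 2 by exact: ltW.
have lx : `|l| <= `|x| + `|l - x|.
  by have := ler_normD x (l - x); rewrite addrC subrK.
have [xy|xy] := leP `|l - x| `|x|.
  have l2 : l ^+ 2 <= 4 * x ^+ 2.
    rewrite -[l ^+ 2]real_normK ?num_real // -[x ^+ 2]real_normK ?num_real //.
    have : `|l| <= 2 * `|x| by lra.
    have := normr_ge0 l; nra.
  have Tx : T ^+ 2 <= 4 * x ^+ 2.
    apply: le_trans l2; rewrite -[leRHS]real_normK ?num_real //.
    by apply: lerXn2r; rewrite ?nnegrE //; exact: ltW.
  suff : 4 * x ^+ 2 <= 16 / T ^+ 2 * x ^+ 4 by lra.
  have -> : 16 / T ^+ 2 * x ^+ 4 = (4 * x ^+ 2) * (4 * x ^+ 2) / T ^+ 2 by field; lra.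
  rewrite ler_pdivlMr // ler_wpM2l // mulr_ge0 ?sqr_ge0 //.
have : l ^+ 2 <= 4 * (l - x) ^+ 2.
  rewrite -[l ^+ 2]real_normK ?num_real // -[(l - x) ^+ 2]real_normK ?num_real //.
  have : `|l| <= 2 * `|l - x| by lra.
  have := normr_ge0 l; nra.
lra.
Qed.

Section Coupled.
Variables (n : nat) (A X : 'M[R]_n).
Hypotheses (symA : A^T = A) (symX : X^T = X).

(** Pointwise, f(l) <= f(x) + L |l - x| <= x^q + L (delta + (l - x)^2 / delta), and this is averaged
    against the coupling. The linear term is turned into a square because the coupling controls
    squares only. *)
Lemma sum_eigenvalues_le (f : R -> R) (q : nat) (L delta : R) :
  0 <= L -> 0 < delta ->
  (forall x y, `|f x - f y| <= L * `|x - y|) -> (forall x, f x <= x ^+ q) ->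
  \sum_(x <- eigenvalues A) f x <=
  \tr (iter q (mulmx X) 1%:M) + n%:R * (L * delta) +
  L / delta * \sum_i \sum_j (A i j - X i j) ^+ 2.
Proof.
move=> L0 de0 fL fq.
have [l [x [S [pe [S0 Sr Sc] SE _ trX]]]] := spectral_coupling symA symX.
rewrite (perm_big _ pe) big_map big_enum /= -(trX q) -SE.
have -> : \sum_i f (l i) = \sum_i \sum_k S i k * f (l i).
  by apply: eq_bigr => i _; rewrite -mulr_suml Sr mul1r.
have -> : \sum_k x k ^+ q = \sum_i \sum_k S i k * x k ^+ q.
  rewrite exchange_big /=; apply: eq_bigr => k _.
  by rewrite -mulr_suml Sc mul1r.
have -> : n%:R * (L * delta) = \sum_i \sum_k S i k * (L * delta).
  rewrite (eq_bigr (fun=> L * delta)); last first.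
    by move=> i _; rewrite -mulr_suml Sr mul1r.
  by rewrite sumr_const card_ord mulr_natl.
rewrite mulr_sumr -!big_split /=; apply: ler_sum => i _.
rewrite mulr_sumr -!big_split /=; apply: ler_sum => k _.
have -> : S i k * x k ^+ q + S i k * (L * delta) +
    L / delta * (S i k * (l i - x k) ^+ 2) =
    S i k * (x k ^+ q + L * (delta + (l i - x k) ^+ 2 / delta)) by field; lra.
apply: ler_wpM2l => //.
have := fL (l i) (x k) => /ler_normlW fl.
have := fq (x k).
have : L * `|l i - x k| <= L * (delta + (l i - x k) ^+ 2 / delta).
  apply: ler_wpM2l => //; rewrite -[(l i - x k) ^+ 2]real_normK ?num_real //.
  set y := `|l i - x k|; have y0 : 0 <= y by exact: normr_ge0.
  rewrite -(ler_pM2r de0); have -> : (delta + y ^+ 2 / delta) * delta = delta ^+ 2 + y ^+ 2.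
    by field; lra.
  nra.
lra.
Qed.

Lemma sum_sqr_eigenvalues_tail (T : R) : 0 < T ->
  \sum_i \sum_j A i j ^+ 2 - \sum_(x <- eigenvalues A) Num.min `|x| T ^+ 2 <=
  16 / T ^+ 2 * \tr (iter 4 (mulmx X) 1%:M) +
  4 * \sum_i \sum_j (A i j - X i j) ^+ 2.
Proof.
move=> T0.
have [l [x [S [pe [S0 Sr Sc] SE lE trX]]]] := spectral_coupling symA symX.
rewrite (perm_big _ pe) big_map big_enum /= -(trX 4%N) -SE -lE -sumrB.
have -> : \sum_i (l i ^+ 2 - Num.min `|l i| T ^+ 2) =
    \sum_i \sum_k S i k * (l i ^+ 2 - Num.min `|l i| T ^+ 2).
  by apply: eq_bigr => i _; rewrite -mulr_suml Sr mul1r.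
have -> : \sum_k x k ^+ 4 = \sum_i \sum_k S i k * x k ^+ 4.
  rewrite exchange_big /=; apply: eq_bigr => k _.
  by rewrite -mulr_suml Sc mul1r.
rewrite !mulr_sumr -big_split /=; apply: ler_sum => i _.
rewrite !mulr_sumr -big_split /=; apply: ler_sum => k _.
have := ler_wpM2l (S0 i k) (sqr_tail_le (l i) (x k) T0).
by rewrite [X in _ <= X]mulrDr (mulrCA (S i k) (16 / _)) (mulrCA (S i k) 4).
Qed.

Lemma trace_even_ge0 (k : nat) : 0 <= \tr (iter k.*2 (mulmx X) 1%:M).
Proof.
have [l [x [S [_ _ _ _ trX]]]] := spectral_coupling symX symX.
rewrite -trX; apply: sumr_ge0 => i _.
by rewrite -muln2 mulnC exprM exprn_ge0 ?sqr_ge0.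
Qed.

End Coupled.

Lemma sum_sqr_min_eigenvalues_le n (A : 'M[R]_n) (T : R) : A^T = A -> 0 <= T ->
  \sum_(x <- eigenvalues A) Num.min `|x| T ^+ 2 <= \sum_i \sum_j A i j ^+ 2.
Proof.
move=> symA T0.
have [l [x [S [pe _ _ lE _]]]] := spectral_coupling symA symA.
rewrite (perm_big _ pe) big_map big_enum /= -lE; apply: ler_sum => i _.
rewrite -[leRHS]real_normK ?num_real // ler_sqr ?nnegrE ?le_min ?normr_ge0 //.
by rewrite ge_min lexx.
Qed.

(** Truncation is 1-Lipschitz, and in the factorisation of a^q - b^q each of the q summands of the
    cofactor is at most T^(q-1). *)
Lemma trunc_pow_lipschitz (T : R) (q : nat) (x y : R) : 0 <= T ->
  `|Num.min `|x| T ^+ q - Num.min `|y| T ^+ q| <=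
  (q%:R * T ^+ q.-1) * `|x - y|.
Proof.
move=> T0; case: q => [|q].
  by rewrite !expr0 subrr normr0 !mul0r.
rewrite subrXX normrM mulrC; apply: ler_pM => //.
  apply: le_trans (ler_norm_sum _ _ _) _.
  have -> : q.+1%:R * T ^+ q.+1.-1 = \sum_(i < q.+1) T ^+ q :> R.
    by rewrite sumr_const card_ord mulr_natl.
  apply: ler_sum => i _; rewrite normrM !normrX.
  have m0 z : `|Num.min `|z| T| <= T.
    by rewrite ger0_norm ?le_min ?normr_ge0 // ge_min lexx orbT.
  have -> : T ^+ q = T ^+ (q.+1 - i.+1) * T ^+ i.
    by rewrite -exprD subSS subnK // -ltnS.
  by rewrite subSS; apply: ler_pM; rewrite ?exprn_ge0 // lerXn2r ?nnegrE.
have := ler_dist_dist x y; move: `|x| `|y| => a c.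
case: (leP a T) => aT; case: (leP c T) => cT H; apply: le_trans H => //.
- by rewrite distrC (distrC a) !ger0_norm; lra.
- by rewrite !ger0_norm; lra.
- by rewrite subrr normr0.
Qed.

End SpectralComparison.

(** * Kernel bounds and moments of the weights *)

Section KernelBounds.
Variables (R : realType) (tau sigma : R).
Hypotheses (tau2 : 2 < tau) (sigma0 : 0 < sigma) (sigma1 : sigma < tau - 1).
Local Notation kernel := (Defs.kernel sigma).

(** The second bound uses tau > 2, the third sigma < tau - 1; halving keeps the inequalities strict.
    The bound [eta <= 1] serves to compare squares with powers of order 1 + eta. *)
Lemma exists_moment_gain : exists eta : R,
  [/\ 0 < eta, eta <= 1, 1 + eta < tau - 1 & sigma * (1 + eta) < tau - 1].
Proof.
exists (Num.min 1 (Num.min ((tau - 2) / 2) ((tau - 1 - sigma) / (2 * sigma)))).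
set e := Num.min _ _.
have e1 : e <= 1 by rewrite /e ge_min lexx.
have e2 : e <= (tau - 2) / 2 by rewrite /e !ge_min lexx orbT.
have e3 : e <= (tau - 1 - sigma) / (2 * sigma) by rewrite /e !ge_min lexx !orbT.
have e0 : 0 < e.
  by rewrite /e !lt_min ltr01 !divr_gt0 ?subr_gt0 ?mulr_gt0.
clearbody e; split=> //; first by clear e3; lra.
have : sigma * e <= (tau - 1 - sigma) / 2.
  have := ler_wpM2l (ltW sigma0) e3.
  have -> : sigma * ((tau - 1 - sigma) / (2 * sigma)) = (tau - 1 - sigma) / 2.
    by field; rewrite gt_eqF.
  by [].
move=> se; clear e3; rewrite mulrDr mulr1; move: (se) (sigma1) => + +; lra.
Qed.

Lemma kernel_ge1 (x y : R) : 1 <= x -> 1 <= y -> 1 <= kernel x y.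
Proof.
move=> x1 y1; rewrite /Defs.kernel -[leLHS]mulr1; apply: ler_pM => //.
  by rewrite le_max x1.
by rewrite -[leLHS](powRr0 (Num.min x y)); apply: ler_powR; rewrite ?le_min ?x1 ?y1 // ltW.
Qed.

Lemma kernel_ge_max (x y : R) : 1 <= x -> 1 <= y -> Num.max x y <= kernel x y.
Proof.
move=> x1 y1; rewrite /Defs.kernel -[leLHS]mulr1; apply: ler_wpM2l.
  by rewrite le_max (le_trans ler01).
by rewrite -[leLHS](powRr0 (Num.min x y)); apply: ler_powR; rewrite ?le_min ?x1 ?y1 // ltW.
Qed.

(** Both exponents of max(x, y) min(x, y)^sigma are raised to their maximum, which makes the bound a
    product. This is the origin of sigma \/ 1 in the moment condition. *)
Lemma kernel_le_pow (x y : R) : 1 <= x -> 1 <= y ->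
  kernel x y <= x `^ (Num.max sigma 1) * y `^ (Num.max sigma 1).
Proof.
move=> x1 y1; set s := Num.max sigma 1.
have -> : x `^ s * y `^ s = (Num.max x y) `^ s * (Num.min x y) `^ s.
  by case: (leP x y) => _ //; rewrite mulrC.
have M1 : 1 <= Num.max x y by rewrite le_max x1.
have m1 : 1 <= Num.min x y by rewrite le_min x1.
apply: ler_pM; rewrite ?powR_ge0 ?(le_trans ler01) //.
  by apply: le1r_powR => //; rewrite le_max lexx orbT.
by apply: ler_powR => //; rewrite le_max lexx.
Qed.

Lemma kernel_pow_le (eta x y : R) : 0 < eta -> 1 <= x -> 1 <= y ->
  kernel x y `^ (1 + eta) <=
  x `^ (1 + eta) * y `^ (sigma * (1 + eta)) +
  x `^ (sigma * (1 + eta)) * y `^ (1 + eta).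
Proof.
move=> eta0 x1 y1.
have x0 : 0 <= x by rewrite (le_trans ler01).
have y0 : 0 <= y by rewrite (le_trans ler01).
rewrite /Defs.kernel powRM ?powR_ge0 ?le_max ?x0 // -powRrM.
case: (leP x y) => _.
  by rewrite mulrC lerDr mulr_ge0 ?powR_ge0.
by rewrite lerDl mulr_ge0 ?powR_ge0.
Qed.

(** The cost of removing the cap at 1: it acts only where k r > 1, and there k r <= (k r)^(1 +
    eta). *)
Lemma le_min_mul1 (eta k r : R) : 0 < eta -> 0 <= k -> 0 <= r ->
  k * r <= Num.min (k * r) 1 + k `^ (1 + eta) * r `^ (1 + eta).
Proof.
move=> eta0 k0 r0; rewrite -powRM //; case: (leP (k * r) 1) => kr.
  by rewrite lerDl powR_ge0.
apply: (@le_trans _ _ ((k * r) `^ (1 + eta))); last by rewrite lerDr.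
by apply: le1r_powR; [exact: ltW|rewrite lerDl ltW].
Qed.

Lemma sqr_min_mul1_le (eta k r : R) : 0 < eta -> eta <= 1 -> 0 <= k -> 0 <= r ->
  Num.min (k * r) 1 ^+ 2 <= k `^ (1 + eta) * r `^ (1 + eta).
Proof.
move=> eta0 eta1 k0 r0; rewrite -powRM //.
have kr0 : 0 <= k * r by exact: mulr_ge0.
case: (leP (k * r) 1) => kr; last first.
  rewrite expr1n; apply: le_trans (ltW kr) _.
  by apply: le1r_powR; [exact: ltW|rewrite lerDl ltW].
have [->|kr_neq0] := eqVneq (k * r) 0; first by rewrite expr0n /= powR_ge0.
rewrite -powR_mulrn //; apply: ger_powR; first by rewrite lt_def kr_neq0 kr0.
by move: eta1; lra.
Qed.

(** Markov's argument: a weight above [m] forces the kernel above [m], so its power -eta is at most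
    m^(-eta). *)
Lemma kernel_tail_le (eta m x y : R) : 0 < eta -> 1 <= m -> 1 <= x -> 1 <= y ->
  ~~ ((x <= m) && (y <= m)) ->
  kernel x y <= kernel x y `^ (1 + eta) * m `^ (- eta).
Proof.
move=> eta0 m1 x1 y1 nm.
have mk : m <= kernel x y.
  apply: le_trans (kernel_ge_max x1 y1).
  by move: nm; rewrite negb_and -!ltNge le_max => /orP[] /ltW -> //; rewrite orbT.
have k0 : 0 < kernel x y by rewrite (lt_le_trans ltr01) // kernel_ge1.
have m0 : 0 < m by rewrite (lt_le_trans ltr01).
rewrite powRN ler_pdivlMr ?powR_gt0 // powRD; last by rewrite (gt_eqF k0) implybT.
rewrite powRr1 ?(ltW k0) // ler_pM2l //.
by apply: ge0_ler_powR => //; rewrite ?nnegrE; exact: ltW.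
Qed.

End KernelBounds.

Section ParetoMoments.
Variables (R : realType) (tau : R).
Hypothesis tau1 : 1 < tau.

Lemma pareto_moment (a : R) : a < tau - 1 ->
  (\int[lebesgue_measure]_x ((x `^ a)%:E * (pareto_pdf tau x)%:E) =
   ((tau - 1) / (tau - 1 - a))%:E)%E.
Proof.
move=> a1.
have E : (fun x => ((x `^ a)%:E * (pareto_pdf tau x)%:E)%E) =
    (fun x => ((tau - 1) * x `^ (- (tau - a)))%:E) \_ `[1, +oo[.
  apply/funext => x; rewrite patchE mem_setE in_itv /= andbT /pareto_pdf.
  case: ifPn => x1; last by rewrite mule0.
  have x0 : 0 < x by exact: lt_le_trans ltr01 x1.
  rewrite -EFinM mulrCA -powRD; last by rewrite (gt_eqF x0) implybT.
  by congr ((_ * _ `^ _)%:E); ring.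
rewrite E -integral_mkcond; under eq_integral do rewrite EFinM.
rewrite ge0_integralZl_EFin //.
- by rewrite integral_powRN_fin ?EFinM; [congr (_ * (_^-1)%:E)%E; ring|lra].
- by move=> x _; rewrite lee_fin powR_ge0.
- apply/measurable_EFinP; apply: measurable_funTS; exact: measurable_powR.
- by rewrite subr_ge0 ltW.
Qed.

End ParetoMoments.

Section WeightMoments.
Variables (R : realType) (d N : nat) (tau alpha sigma : R).
Variable G : kernel_graph d N tau alpha sigma.
Hypotheses (tau2 : 2 < tau) (sigma0 : 0 < sigma) (sigma1 : sigma < tau - 1).
Local Notation V := (vertex d N).
Local Notation P := (kg_prob G).
Local Notation W := (weight (G := G)).
Local Notation kernel := (Defs.kernel sigma).

Let tau1 : 1 < tau. Proof. by move: (tau2); lra. Qed.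

Lemma ge0_integral_weight v (g : R -> \bar R) :
  measurable_fun setT g -> (forall x, 0 <= g x)%E ->
  (\int[P]_x g (W v x) =
   \int[lebesgue_measure]_x (g x * (pareto_pdf tau x)%:E))%E.
Proof.
apply: ge0_integral_pareto => //; first exact: measurable_weight.
exact: weight_pareto.
Qed.

Lemma weight_moment v a : a < tau - 1 ->
  (\int[P]_x (W v x `^ a)%:E = ((tau - 1) / (tau - 1 - a))%:E)%E.
Proof.
move=> a1; rewrite -(pareto_moment tau1 a1).
rewrite (@ge0_integral_weight v (fun x => (x `^ a)%:E)) //.
- by apply/measurable_EFinP; exact: measurable_powR.
- by move=> x; rewrite lee_fin powR_ge0.
Qed.

Lemma weight_pair_indep u v (A B : set R) : u != v ->
  measurable A -> measurable B ->
  P ((W u @^-1` A) `&` (W v @^-1` B)) = (P (W u @^-1` A) * P (W v @^-1` B))%E.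
Proof.
move=> uv mA mB.
pose C z := if z == u then A else if z == v then B else setT.
have mC z : measurable (C z) by rewrite /C; case: ifP => //; case: ifP.
have CE : [set x | forall z, C z (W z x)] = (W u @^-1` A) `&` (W v @^-1` B).
  apply/seteqP; split => x /=.
    move=> H; split; first by have := H u; rewrite /C eqxx.
    by have := H v; rewrite /C eqxx eq_sym (negPf uv).
  by move=> [xA xB] z; rewrite /C; case: eqP => [->|_] //; case: eqP => [->|].
rewrite -CE weight_indep // (bigD1 u) //= (bigD1 v) /=; last by rewrite eq_sym.
rewrite /C eqxx eqxx eq_sym (negPf uv) muleA big1 ?mule1 //.
move=> z /andP[/negPf zu /negPf zv]; rewrite zu zv preimage_setT.
exact: probability_setT.
Qed.

Lemma ge0_integral_weight_pair u v (g : R * R -> \bar R) : u != v ->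
  measurable_fun setT g -> (forall x, 0 <= g x)%E ->
  (\int[P]_x g (W u x, W v x) = \int[P]_x \int[P]_y g (W u x, W v y))%E.
Proof.
move=> uv; apply: ge0_integral_indep_pair; try exact: measurable_weight.
by move=> A B; exact: weight_pair_indep.
Qed.

Lemma weight_pair_moment u v a b : u != v -> a < tau - 1 -> b < tau - 1 ->
  (\int[P]_x (W u x `^ a * W v x `^ b)%:E =
   ((tau - 1) / (tau - 1 - a) * ((tau - 1) / (tau - 1 - b)))%:E)%E.
Proof.
move=> uv a1 b1.
rewrite (@ge0_integral_weight_pair u v (fun z => (z.1 `^ a * z.2 `^ b)%:E)) //=.
- under eq_integral => x _.
    under eq_integral do rewrite EFinM.
    rewrite ge0_integralZl_EFin ?powR_ge0 //; last 2 first.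
    + by move=> y _; rewrite lee_fin powR_ge0.
    + apply/measurable_EFinP.
      exact: measurableT_comp (measurable_powR b) (measurable_weight v).
    rewrite weight_moment // muleC.
    over.
  rewrite ge0_integralZl_EFin //.
  + by rewrite weight_moment // -EFinM mulrC.
  + by move=> x _; rewrite lee_fin powR_ge0.
  + apply/measurable_EFinP.
    exact: measurableT_comp (measurable_powR a) (measurable_weight u).
  + by rewrite divr_ge0 // subr_ge0 ltW.
- apply/measurable_EFinP; apply: measurable_funM.
    exact: measurableT_comp (measurable_powR a) measurable_fst.
  exact: measurableT_comp (measurable_powR b) measurable_snd.
- by move=> z; rewrite lee_fin mulr_ge0 ?powR_ge0.
Qed.

(** Twice the product of the Pareto moments of orders 1 + eta and sigma (1 + eta), one copy for each
    term of [kernel_pow_le]. *)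
Definition kernel_moment_bound (eta : R) : R :=
  2 * ((tau - 1) / (tau - 1 - (1 + eta)) *
       ((tau - 1) / (tau - 1 - sigma * (1 + eta)))).

Lemma measurable_kernel_pow u v (a : R) :
  measurable_fun setT (fun x => kernel (W u x) (W v x) `^ a).
Proof.
apply: (measurableT_comp (measurable_powR a)).
exact: (borel_kernel sigma u v (measurable_weight (G := G))).
Qed.

Lemma kernel_moment_le (eta : R) u v : 0 < eta -> 1 + eta < tau - 1 ->
  sigma * (1 + eta) < tau - 1 -> u != v ->
  (\int[P]_x (kernel (W u x) (W v x) `^ (1 + eta))%:E <=
   (kernel_moment_bound eta)%:E)%E.
Proof.
move=> eta0 e1 e2 uv.
have mp z a : measurable_fun setT (fun x => W z x `^ a).
  exact: measurableT_comp (measurable_powR a) (measurable_weight z).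
have mpp a b : measurable_fun setT (fun x => (W u x `^ a * W v x `^ b)%:E).
  by apply/measurable_EFinP; apply: measurable_funM.
apply: (@le_trans _ _ (\int[P]_x ((W u x `^ (1 + eta) *
    W v x `^ (sigma * (1 + eta)))%:E + (W u x `^ (sigma * (1 + eta)) *
    W v x `^ (1 + eta))%:E))%E).
  apply: ge0_le_integral => //.
  - by move=> x _; rewrite lee_fin powR_ge0.
  - by apply/measurable_EFinP; exact: measurable_kernel_pow.
  - exact: emeasurable_funD.
  - by move=> x _; rewrite -EFinD lee_fin kernel_pow_le // weight_ge1.
rewrite ge0_integralD //; last 2 first.
- by move=> x _; rewrite lee_fin mulr_ge0 ?powR_ge0.
- by move=> x _; rewrite lee_fin mulr_ge0 ?powR_ge0.
rewrite !weight_pair_moment // -EFinD lee_fin /kernel_moment_bound.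
by rewrite [X in _ + X]mulrC mulr_natl mulr2n.
Qed.

Definition kernel_mean : \bar R :=
  (((tau - 1) ^+ 2)%:E *
    \int[lebesgue_measure]_(x in `[1%R, +oo[)
      \int[lebesgue_measure]_(y in `[1%R, +oo[)
        (((Num.min x y) `^ (tau - sigma) *
          (Num.max x y) `^ (tau - 1))^-1)%:E)%E.

Lemma kernel_pdfE (x y : R) : 1 <= x -> 1 <= y ->
  kernel x y * pareto_pdf tau y * pareto_pdf tau x =
  (tau - 1) ^+ 2 *
  ((Num.min x y) `^ (tau - sigma) * (Num.max x y) `^ (tau - 1))^-1.
Proof.
move=> x1 y1; rewrite /pareto_pdf x1 y1 /Defs.kernel.
set M := Num.max x y; set m := Num.min x y.
have M0 : 0 < M by rewrite /M lt_max (lt_le_trans ltr01).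
have m0 : 0 < m by rewrite /m lt_min !(lt_le_trans ltr01).
have E : y `^ (- tau) * x `^ (- tau) = M `^ (- tau) * m `^ (- tau).
  by rewrite /M /m; case: (leP x y) => _ //; rewrite mulrC.
have -> : M * m `^ sigma * ((tau - 1) * y `^ (- tau)) * ((tau - 1) * x `^ (- tau))
   = (tau - 1) ^+ 2 * (M * m `^ sigma * (y `^ (- tau) * x `^ (- tau))) by ring.
rewrite E; congr (_ * _).
have -> : M * m `^ sigma * (M `^ (- tau) * m `^ (- tau)) =
  (m `^ sigma * m `^ (- tau)) * (M * M `^ (- tau)) by ring.
rewrite -powRD; last by rewrite (gt_eqF m0) implybT.
rewrite -{1}(powRr1 (ltW M0)) -powRD; last by rewrite (gt_eqF M0) implybT.
rewrite invfM -!powRN; congr (_ `^ _ * _ `^ _); ring.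
Qed.

Lemma integral_kernel u v : u != v ->
  (\int[P]_x (kernel (W u x) (W v x))%:E = kernel_mean)%E.
Proof.
(* The absolute value gives an integrand that is nonnegative on the whole plane, as Tonelli
   requires; on the weights it changes nothing. *)
move=> uv; pose g (z : R * R) := (`|kernel z.1 z.2|)%:E.
have mg : measurable_fun setT g.
  apply/measurable_EFinP; apply: measurableT_comp => //.
  rewrite /Defs.kernel; apply: measurable_funM.
    by apply: measurable_maxr; [exact: measurable_fst|exact: measurable_snd].
  apply: (measurableT_comp (measurable_powR sigma)).
  by apply: measurable_minr; [exact: measurable_fst|exact: measurable_snd].
have g0 z : (0 <= g z)%E by rewrite /g lee_fin.
transitivity (\int[P]_x g (W u x, W v x))%E.
  apply: eq_integral => x _; rewrite /g /= ger0_norm //.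
  by rewrite kernel_ge0 ?weight_ge1.
rewrite ge0_integral_weight_pair //.
pose h x := (\int[lebesgue_measure]_y (g (x, y) * (pareto_pdf tau y)%:E))%E.
have mpdf : measurable_fun setT (fun y => (pareto_pdf tau y)%:E).
  by apply/measurable_EFinP; exact: measurable_pareto_pdf.
have pdf0 x : (0 <= (pareto_pdf tau x)%:E)%E by rewrite lee_fin pareto_pdf_ge0.
have h0 x : (0 <= h x)%E by apply: integral_ge0 => y _; rewrite mule_ge0.
have mh : measurable_fun setT h.
  apply: (measurable_fun_fubini_tonelli_F (m2 := lebesgue_measure)
    (fun z : R * R => g z * (pareto_pdf tau z.2)%:E)%E).
    apply: emeasurable_funM => //.
    exact: measurableT_comp mpdf measurable_snd.
  by move=> z; rewrite mule_ge0.
transitivity (\int[P]_x h (W u x))%E.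
  apply: eq_integral => x _; rewrite (@ge0_integral_weight v (fun y => g (W u x, y))) //.
  exact: measurableT_comp mg (measurable_pair1 _).
rewrite ge0_integral_weight // /kernel_mean.
set c2 := (tau - 1) ^+ 2.
have c20 : 0 < c2 by rewrite exprn_gt0 // subr_gt0.
have i20 : 0 <= c2^-1 by rewrite invr_ge0 ltW.
have kE x : 1 <= x -> (\int[lebesgue_measure]_(y in `[1%R, +oo[)
    (((Num.min x y) `^ (tau - sigma) * (Num.max x y) `^ (tau - 1))^-1)%:E =
    c2^-1%:E * (h x * (pareto_pdf tau x)%:E))%E.
  move=> x1.
  transitivity (\int[lebesgue_measure]_(y in `[1%R, +oo[)
      (c2^-1%:E * (g (x, y) * (pareto_pdf tau y)%:E * (pareto_pdf tau x)%:E)))%E.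
    apply: eq_integral => y; rewrite mem_setE in_itv /= andbT => y1.
    rewrite /g /= ger0_norm ?kernel_ge0 // -!EFinM kernel_pdfE // -/c2.
    by rewrite mulKf // gt_eqF.
  have mgp : measurable_fun setT (fun y => g (x, y) * (pareto_pdf tau y)%:E)%E.
    by apply: emeasurable_funM => //; exact: measurableT_comp mg (measurable_pair1 _).
  rewrite ge0_integralZl_EFin //; last 2 first.
  - by move=> y _; rewrite !mule_ge0.
  - by apply: measurable_funTS; apply: emeasurable_funM.
  congr (_ * _)%E; rewrite /h -ge0_integralZr //; last first.
    by move=> y _; rewrite mule_ge0.
  rewrite integral_mkcond; apply: eq_integral => y _.
  rewrite patchE mem_setE in_itv /= andbT; case: ifPn => // /negPf y1.
  have -> : pareto_pdf tau y = 0 by rewrite /pareto_pdf y1.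
  by rewrite mule0 mul0e.
have mhp : measurable_fun setT (fun x => h x * (pareto_pdf tau x)%:E)%E.
  exact: emeasurable_funM.
transitivity (c2%:E * \int[lebesgue_measure]_(x in `[1%R, +oo[)
    (c2^-1%:E * (h x * (pareto_pdf tau x)%:E)))%E; last first.
  congr (_ * _)%E; apply: eq_integral => x.
  by rewrite mem_setE in_itv /= andbT => x1; rewrite kE.
rewrite ge0_integralZl_EFin //; last 2 first.
- by move=> x _; rewrite mule_ge0.
- exact: measurable_funTS.
rewrite muleA -EFinM divff ?gt_eqF // mul1e.
rewrite [RHS]integral_mkcond; apply: eq_integral => x _.
rewrite patchE mem_setE in_itv /= andbT; case: ifPn => // /negPf x1.
by rewrite /pareto_pdf x1 mule0.
Qed.

End WeightMoments.

Section IntegralBounds.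
Context d (T : measurableType d) (R : realType) (mu : {measure set T -> \bar R}).

Lemma integral_scale_le (a B : R) (F : T -> R) : 0 <= a ->
  measurable_fun setT F -> (forall x, 0 <= F x) ->
  (\int[mu]_x (F x)%:E <= B%:E)%E -> (\int[mu]_x (a * F x)%:E <= (a * B)%:E)%E.
Proof.
move=> a0 mF F0 FB; under eq_integral do rewrite EFinM.
rewrite ge0_integralZl_EFin //; last 2 first.
- by move=> x _; rewrite lee_fin.
- exact/measurable_EFinP.
by rewrite EFinM; apply: lee_wpmul2l.
Qed.

Lemma integral_sum_le (I : eqType) (s : seq I) (F : I -> T -> R) (B : I -> R) :
  (forall i, measurable_fun setT (F i)) -> (forall i x, 0 <= F i x) ->
  (forall i, i \in s -> (\int[mu]_x (F i x)%:E <= (B i)%:E)%E) ->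
  (\int[mu]_x (\sum_(i <- s) F i x)%:E <= (\sum_(i <- s) B i)%:E)%E.
Proof.
move=> mF F0 FB; under eq_integral do rewrite -sumEFin.
rewrite ge0_integral_sum //; last 2 first.
- by move=> i; exact/measurable_EFinP.
- by move=> i x _; rewrite lee_fin.
by rewrite -sumEFin big_seq [leRHS]big_seq; apply: lee_sum => i /FB.
Qed.

End IntegralBounds.

Lemma iter_mulmx_scale (R : comNzRingType) n (a : R) (A : 'M[R]_n) q :
  iter q (mulmx (a *: A)) 1%:M = a ^+ q *: iter q (mulmx A) 1%:M.
Proof.
elim: q => [|q IH]; first by rewrite expr0 scale1r.
by rewrite !iterS IH -scalemxAl -scalemxAr scalerA -exprS.
Qed.

(** * Expected traces of the truncated centred matrix *)

Section GraphTrace.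
Variables (R : realType) (d N' : nat) (tau alpha sigma : R).
Local Notation N := N'.+1.
Variable G : kernel_graph d N tau alpha sigma.
Hypotheses (tau2 : 2 < tau) (sigma0 : 0 < sigma) (sigma1 : sigma < tau - 1).
Hypothesis alpha0 : 0 < alpha.
Local Notation V := (vertex d N).
Local Notation P := (kg_prob G).
Local Notation W := (weight (G := G)).
Local Notation kernel := (Defs.kernel sigma).
Local Notation c := (scaling d N alpha).
Local Notation n := #|V|.
Local Notation p := (edge_prob alpha sigma).
Hypothesis c1 : 1 <= c.

Let c0 : 0 < c. Proof. exact: lt_le_trans ltr01 c1. Qed.
Let tau1 : 1 < tau. Proof. by move: (tau2); lra. Qed.

Let n0 : 0 < n%:R :> R.
Proof. by rewrite ltr0n card_ffun !card_ord expn_gt0. Qed.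

(* The matrix X of the comparison A = X + Y. *)
Definition centered_mx (m : R) (w : V -> R) (g : {ffun V * V -> bool}) :
    'M[R]_n :=
  (Num.sqrt c)^-1 *: \matrix_(i, j)
    centered (p w) (fun v => w v <= m) g (enum_val i) (enum_val j).

Lemma graph_ofC (g : {ffun V * V -> bool}) u v : graph_of g u v = graph_of g v u.
Proof. by rewrite /graph_of canonC. Qed.

Lemma centeredC (m : R) (w : V -> R) g (u v : V) :
  centered (p w) (fun v => w v <= m) g u v =
  centered (p w) (fun v => w v <= m) g v u.
Proof. by rewrite /centered graph_ofC edge_probC [_%:R * _%:R]mulrC. Qed.

Lemma tr_centered_mx m w g : (centered_mx m w g)^T = centered_mx m w g.
Proof. by apply/matrixP => i j; rewrite !mxE centeredC. Qed.

Lemma tr_adjacency (e : rel V) : symmetric e ->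
  (scaled_adjacency alpha e : 'M[R]_n)^T = scaled_adjacency alpha e.
Proof. by move=> eC; apply/matrixP => i j; rewrite !mxE eC. Qed.

Lemma sqr_sqrt_scaling : (Num.sqrt c)^-1 ^+ 2 = c^-1.
Proof. by rewrite exprVn sqr_sqrtr // ltW. Qed.

Lemma trace_centered_mx m w g k :
  \tr (iter k.*2 (mulmx (centered_mx m w g)) 1%:M) =
  c^-1 ^+ k * \sum_u \sum_(t <- walks V k.*2 | last u t == u)
    walk_prod (centered (p w) (fun v => w v <= m) g) u t.
Proof.
rewrite iter_mulmx_scale mxtraceZ trace_walks -mul2n exprM.
by rewrite sqr_sqrt_scaling.
Qed.

Lemma borel_indic_le (m : R) (u : V) :
  borel_fun (fun w : V -> R => (w u <= m)%R%:R : R).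
Proof.
move=> d' T U mU.
have -> : (fun x => (U u x <= m)%R%:R : R) = \1_(`]-oo, m]%classic) \o U u.
  apply/funext => x /=; rewrite indicE; congr ((nat_of_bool _)%:R).
  by apply/idP/idP; rewrite inE /= in_itv.
by apply: measurableT_comp => //; exact: measurable_indic.
Qed.

Lemma borel_centered (m : R) g (u v : V) :
  borel_fun (fun w : V -> R => centered (p w) (fun v => w v <= m) g u v).
Proof.
move=> d' T U mU; rewrite /centered; apply: measurable_funM.
  by apply: measurable_funM; exact: borel_indic_le.
by apply: measurable_funB => //; exact: borel_edge_prob.
Qed.

Lemma edge_prob_le_decay (w : V -> R) (u v : V) : (forall v, 1 <= w v) ->
  p w u v <= kernel (w u) (w v) * edge_decay alpha u v.
Proof. by move=> w1; rewrite /edge_prob ge_min lexx. Qed.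

Lemma borel_trace (m : R) (k : nat) (g : {ffun V * V -> bool}) :
  borel_fun (fun w : V -> R =>
    n%:R^-1 * \tr (iter k.*2 (mulmx (centered_mx m w g)) 1%:M)).
Proof.
move=> d' T U mU; apply: measurable_funM => //.
under eq_fun do rewrite trace_centered_mx; apply: measurable_funM => //.
apply: measurable_bigsum => u _; apply: measurable_bigsum => t _.
by apply: measurable_bigprod => e _; exact: borel_centered.
Qed.

(** The factor contributed by one visited vertex of weight [x] in the walk bound. *)
Definition cut_pow (m : R) (k : nat) (x : R) : R :=
  1 + (x <= m)%R%:R * (x `^ Num.max sigma 1) ^+ k.

Lemma cut_pow_ge1 m k x : 1 <= cut_pow m k x.
Proof. by rewrite lerDl mulr_ge0 // exprn_ge0 // powR_ge0. Qed.

Lemma measurable_cut_pow m k : measurable_fun setT (cut_pow m k).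
Proof.
rewrite /cut_pow; apply: measurable_funD => //; apply: measurable_funM.
  have -> : (fun x : R => (x <= m)%R%:R : R) = \1_(`]-oo, m]%classic).
    apply/funext => x /=; rewrite indicE; congr ((nat_of_bool _)%:R).
    by apply/idP/idP; rewrite inE /= in_itv.
  exact: measurable_indic.
by apply: measurable_funX; exact: measurable_powR.
Qed.

Variables (m : R) (k : nat) (M : R).
Hypothesis cutM : (\int[lebesgue_measure]_x
  ((cut_pow m k x)%:E * (pareto_pdf tau x)%:E) <= M%:E)%E.

(** By independence the expectation is a product over the distinct vertices of [s]. There may be
    fewer than [size s] of them, and M >= 1 makes up for the difference. *)
Lemma integral_prod_cut (s : seq V) :
  (\int[P]_x (\prod_(v | v \in s) cut_pow m k (W v x))%:E <=
   (M ^+ size s)%:E)%E.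
Proof.
have cut0 x : 0 <= cut_pow m k x by rewrite (le_trans ler01) ?cut_pow_ge1.
have mcut v : measurable_fun setT (fun x => cut_pow m k (W v x)).
  exact: measurableT_comp (measurable_cut_pow m k) (measurable_weight v).
have cutW v : (\int[P]_x (cut_pow m k (W v x))%:E <= M%:E)%E.
  rewrite (@ge0_integral_weight _ _ _ _ _ _ G tau2 v (fun x => (cut_pow m k x)%:E)) //.
  by apply/measurable_EFinP; exact: measurable_cut_pow.
have cut1 v : (1 <= \int[P]_x (cut_pow m k (W v x))%:E)%E.
  rewrite -[leLHS](@probability_setT _ _ _ P) -[leLHS]mul1e -integral_cst //.
  apply: ge0_le_integral => //; first exact/measurable_EFinP.
  by move=> x _; rewrite lee_fin cut_pow_ge1.
have cutfin v : (\int[P]_x (cut_pow m k (W v x))%:E)%E \is a fin_num.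
  rewrite ge0_fin_numE; last by apply: le_trans (cut1 v).
  exact: le_lt_trans (cutW v) (ltry _).
pose l v := if v \in s then fine (\int[P]_x (cut_pow m k (W v x))%:E)%E else 1.
pose f v := if v \in s then cut_pow m k else fun=> 1.
have M1 : 1 <= M.
  by rewrite -lee_fin; have v0 : V := [ffun=> ord0]; apply: le_trans (cut1 v0) (cutW v0).
under eq_integral do rewrite big_mkcond.
have -> : (\int[P]_x (\prod_v (if v \in s then cut_pow m k (W v x) else 1))%:E =
    \int[P]_x (\prod_v f v (W v x))%R%:E)%E.
  apply: eq_integral => x _; congr (_%:E); apply: eq_bigr => v _.
  by rewrite /f; case: ifP.
rewrite (integral_prod_indep (measurable_weight (G := G)) _ (phi := f) (m := l)).
- rewrite lee_fin /l -big_mkcond /=.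
  apply: (@le_trans _ _ (\prod_(v in s) M)).
    apply: ler_prod => v _; rewrite -!lee_fin fineK // cutW andbT.
    exact: le_trans (cut1 v).
  by rewrite prodr_const ler_weXn2l // card_size.
- exact: weight_indep.
- by move=> v; rewrite /f; case: ifP => // _; exact: measurable_cut_pow.
- by move=> v t; rewrite /f; case: ifP.
- move=> v; rewrite /f /l; case: ifP => _; first by rewrite fineK.
  by rewrite integral_cst // [X in (_ * X)%E]probability_setT mule1.
Qed.

(** The factor c^k of the walk bound cancels the scaling, and the sum over the starting vertex
    cancels 1/n. What remains is a sum over walks with the stochastic kernel [edge_decay / c],
    started from a one-element list, each walk listing 2k + 1 vertices. *)
Lemma expectation_trace_le :
  (\int[P]_x (n%:R^-1 *
     \tr (iter k.*2 (mulmx (centered_mx m (W^~ x) (config x))) 1%:M))%:E <=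
   (((1 + k.*2) ^ k.*2)%:R * M ^+ (k.*2).+1)%:E)%E.
Proof.
pose H (w : V -> R) g := n%:R^-1 * \tr (iter k.*2 (mulmx (centered_mx m w g)) 1%:M).
rewrite (@config_transfer _ _ _ _ _ _ G H); last 2 first.
- by move=> g; exact: borel_trace.
- move=> w g _; rewrite /H mulr_ge0 ?invr_ge0 ?ler0n //.
  exact: trace_even_ge0 (tr_centered_mx _ _ _) _.
pose s := Num.max sigma 1.
pose a (u : V) t := \prod_(e <- fresh_steps u [:: u] t) (edge_decay alpha e.1 e.2 / c : R).
have a0 u t : 0 <= a u t.
  by apply: prodr_ge0 => e _; rewrite divr_ge0 ?edge_decay_ge0 ?(ltW c0).
pose F u t x := \prod_(v | v \in u :: t) cut_pow m k (W v x).
have F0 u t x : 0 <= F u t x.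
  by apply: prodr_ge0 => v _; rewrite (le_trans ler01) ?cut_pow_ge1.
have mF u t : measurable_fun setT (F u t).
  apply: measurable_bigprod => v _.
  exact: measurableT_comp (measurable_cut_pow m k) (measurable_weight v).
have maF u t : measurable_fun setT (fun x => a u t * F u t x).
  exact: measurable_funM.
have aF0 u t x : 0 <= a u t * F u t x by rewrite mulr_ge0.
have mS u : measurable_fun setT (fun x => \sum_(t <- walks V k.*2) a u t * F u t x).
  by apply: measurable_bigsum => t _.
have S0 u x : 0 <= \sum_(t <- walks V k.*2) a u t * F u t x.
  by apply: sumr_ge0 => t _.
apply: (@le_trans _ _ (\int[P]_x (n%:R^-1 *
    \sum_u \sum_(t <- walks V k.*2) a u t * F u t x)%:E)%E).
  apply: ge0_le_integral => //.
  - move=> x _; rewrite lee_fin; apply: sumr_ge0 => g _; rewrite mulr_ge0 //.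
      by apply: config_weight_ge0 => // v; exact: weight_ge1.
    rewrite /H mulr_ge0 ?invr_ge0 ?ler0n //.
    exact: trace_even_ge0 (tr_centered_mx _ _ _) _.
  - apply/measurable_EFinP; apply: measurable_bigsum => g _; apply: measurable_funM.
      by apply: borel_config_weight; exact: measurable_weight.
    rewrite /H; apply: measurable_funM => //.
    under eq_fun do rewrite trace_centered_mx; apply: measurable_funM => //.
    apply: measurable_bigsum => u _; apply: measurable_bigsum => t _.
    apply: measurable_bigprod => e _; apply: borel_centered.
    exact: measurable_weight.
  - apply/measurable_EFinP; apply: measurable_funM => //.
    by apply: measurable_bigsum => u _.
  move=> x _; rewrite lee_fin /H.
  have w1 v : 1 <= W v x by exact: weight_ge1.
  under eq_bigr do rewrite trace_centered_mx.
  rewrite (eq_bigr (fun g => n%:R^-1 * (c^-1 ^+ k * (config_weight (p (W^~ x)) g *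
     (\sum_u \sum_(t <- walks V k.*2 | last u t == u)
       walk_prod (centered (p (W^~ x)) (fun v => W v x <= m) g) u t))))); last first.
    by move=> g _; ring.
  rewrite -!mulr_sumr; apply: ler_wpM2l; first by rewrite invr_ge0 ler0n.
  rewrite exprVn ler_pdivrMl ?exprn_gt0 //.
  apply: sum_config_trace => //.
  - by move=> u v; exact: edge_probC.
  - by move=> u v; exact: edge_prob_ge0.
  - by move=> u v; exact: edge_prob_le1.
  - by move=> u; exact: edge_prob_diag.
  - move=> v; rewrite -[leLHS](powRr0 (W v x)); apply: ler_powR => //.
    by rewrite le_max ler01 orbT.
  - by move=> u v; exact: edge_decay_ge0.
  - move=> u v; apply: le_trans (edge_prob_le_decay u v w1) _.
    apply: ler_wpM2r; first exact: edge_decay_ge0.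
    exact: kernel_le_pow.
set C := (((1 + k.*2) ^ k.*2)%:R * M ^+ (k.*2).+1).
have -> : C = n%:R^-1 * \sum_(u : V) C.
  by rewrite sumr_const -[X in _ = _ * X]mulr_natl mulKf // gt_eqF.
apply: integral_scale_le; rewrite ?invr_ge0 ?ler0n //.
- by apply: measurable_bigsum => u _.
- by move=> x; apply: sumr_ge0 => u _.
apply: integral_sum_le => // u _.
have M0 : 0 <= M.
  rewrite -lee_fin; apply: le_trans cutM; apply: integral_ge0 => x _.
  by rewrite -EFinM lee_fin mulr_ge0 ?pareto_pdf_ge0 // (le_trans ler01) ?cut_pow_ge1.
apply: (@le_trans _ _ (\sum_(t <- walks V k.*2) a u t * M ^+ (k.*2).+1)%:E).
  apply: integral_sum_le => // t /size_walks st.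
  apply: integral_scale_le => //.
  by have := integral_prod_cut (u :: t); rewrite /= st.
rewrite lee_fin -mulr_suml; apply: ler_wpM2r; first exact: exprn_ge0.
apply: (@sum_fresh_steps V R (fun u v => edge_decay alpha u v / c)).
- by move=> u' v'; rewrite divr_ge0 ?edge_decay_ge0 ?(ltW c0).
- by move=> u'; rewrite -mulr_suml sum_edge_decay // divff // gt_eqF.
Qed.

End GraphTrace.

Lemma sum_config_edge_diag (R : realType) (V : finType) (p : V -> V -> R) u v :
  (forall u v, p u v = p v u) -> (forall u, p u u = 0) ->
  \sum_g config_weight p g * (graph_of g u v)%:R = p u v.
Proof.
move=> pC pd; have [->|uv] := eqVneq u v; last exact: sum_config_edge.
rewrite pd big1 // => g _; rewrite /graph_of /canon_pair ltnn /=.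
case gv: (g (v, v)); last by rewrite mulr0.
by rewrite /config_weight (bigD1 (v, v)) //= /slot_prob ltnn gv !mul0r.
Qed.

Section IntegralEq.
Context d (T : measurableType d) (R : realType) (mu : {measure set T -> \bar R}).

Lemma integral_scale_eq (a B : R) (F : T -> R) : 0 <= a ->
  measurable_fun setT F -> (forall x, 0 <= F x) ->
  (\int[mu]_x (F x)%:E = B%:E)%E -> (\int[mu]_x (a * F x)%:E = (a * B)%:E)%E.
Proof.
move=> a0 mF F0 FB; under eq_integral do rewrite EFinM.
rewrite ge0_integralZl_EFin //; last 2 first.
- by move=> x _; rewrite lee_fin.
- by apply/measurable_EFinP.
by rewrite FB.
Qed.

Lemma integral_sum_eq (I : eqType) (s : seq I) (F : I -> T -> R) (B : I -> R) :
  (forall i, measurable_fun setT (F i)) -> (forall i x, 0 <= F i x) ->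
  (forall i, i \in s -> (\int[mu]_x (F i x)%:E = (B i)%:E)%E) ->
  (\int[mu]_x (\sum_(i <- s) F i x)%:E = (\sum_(i <- s) B i)%:E)%E.
Proof.
move=> mF F0 FB; under eq_integral do rewrite -sumEFin.
rewrite ge0_integral_sum //; last 2 first.
- by move=> i; apply/measurable_EFinP.
- by move=> i x _; rewrite lee_fin.
by rewrite -sumEFin big_seq [RHS]big_seq; apply: eq_bigr.
Qed.

End IntegralEq.

(** * Expected Frobenius norms *)

Section GraphSquares.
Variables (R : realType) (d N' : nat) (tau alpha sigma : R).
Local Notation N := N'.+1.
Variable G : kernel_graph d N tau alpha sigma.
Hypotheses (tau2 : 2 < tau) (sigma0 : 0 < sigma) (sigma1 : sigma < tau - 1).
Hypothesis alpha0 : 0 < alpha.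
Local Notation V := (vertex d N).
Local Notation P := (kg_prob G).
Local Notation W := (weight (G := G)).
Local Notation kernel := (Defs.kernel sigma).
Local Notation c := (scaling d N alpha).
Local Notation n := #|V|.
Local Notation p := (edge_prob alpha sigma).
Local Notation r := (edge_decay alpha).
Hypothesis c1 : 1 <= c.

Let c0 : 0 < c. Proof. exact: lt_le_trans ltr01 c1. Qed.

Let n0 : 0 < n%:R :> R.
Proof. by rewrite ltr0n card_ffun !card_ord expn_gt0. Qed.

Lemma sum_enum_val (F : V -> V -> R) :
  \sum_(i < n) \sum_(j < n) F (enum_val i) (enum_val j) = \sum_u \sum_v F u v.
Proof.
rewrite [RHS](reindex _ (onW_bij _ (enum_val_bij V))) /=; apply: eq_bigr => i _.
by rewrite [RHS](reindex _ (onW_bij _ (enum_val_bij V))).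
Qed.

Lemma sum_sqr_scaled_adjacency (e : rel V) :
  \sum_i \sum_j (scaled_adjacency alpha e : 'M[R]_n) i j ^+ 2 =
  c^-1 * \sum_u \sum_v (e u v)%:R.
Proof.
rewrite -(sum_enum_val (fun u v => (e u v)%:R)) mulr_sumr.
apply: eq_bigr => i _; rewrite mulr_sumr; apply: eq_bigr => j _.
rewrite !mxE exprMn (sqr_sqrt_scaling c1); congr (_ * _).
by case: (e _ _); rewrite ?expr1n ?expr0n.
Qed.

Definition cut (m : R) (w : V -> R) (u v : V) : R :=
  ((w u <= m) && (w v <= m))%:R.

(** On a kept pair the centring leaves the mean p; on any other pair the whole entry remains, and a
    0-1 entry is its own square. *)
Lemma sum_sqr_diff (m : R) (w : V -> R) (g : {ffun V * V -> bool}) :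
  \sum_i \sum_j ((scaled_adjacency alpha (graph_of g) : 'M[R]_n) i j -
    centered_mx alpha sigma m w g i j) ^+ 2 =
  c^-1 * \sum_u \sum_v ((1 - cut m w u v) * (graph_of g u v)%:R +
    cut m w u v * p w u v ^+ 2).
Proof.
rewrite -(sum_enum_val (fun u v => (1 - cut m w u v) * (graph_of g u v)%:R +
    cut m w u v * p w u v ^+ 2)) mulr_sumr.
apply: eq_bigr => i _; rewrite mulr_sumr; apply: eq_bigr => j _.
rewrite !mxE -mulrBr exprMn (sqr_sqrt_scaling c1); congr (_ * _).
rewrite /centered /cut; case: (w _ <= m); case: (w _ <= m) => /=;
  case: (graph_of _ _ _); rewrite /=; ring.
Qed.

Lemma expect_sqr_diff (m : R) (w : V -> R) :
  \sum_g config_weight (p w) g * (n%:R^-1 * \sum_i \sum_j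
    ((scaled_adjacency alpha (graph_of g) : 'M[R]_n) i j -
     centered_mx alpha sigma m w g i j) ^+ 2) =
  n%:R^-1 * (c^-1 * \sum_u \sum_v ((1 - cut m w u v) * p w u v +
    cut m w u v * p w u v ^+ 2)).
Proof.
have pC u v : p w u v = p w v u by exact: edge_probC.
have pd u : p w u u = 0 by exact: edge_prob_diag.
transitivity (\sum_g n%:R^-1 * (c^-1 * \sum_u \sum_v (config_weight (p w) g *
    ((1 - cut m w u v) * (graph_of g u v)%:R + cut m w u v * p w u v ^+ 2)))).
  apply: eq_bigr => g _; rewrite sum_sqr_diff mulrCA (mulrCA (config_weight _ _)).
  congr (_ * (_ * _)); rewrite mulr_sumr; apply: eq_bigr => u _.
  by rewrite mulr_sumr.
rewrite -mulr_sumr -mulr_sumr; congr (_ * (_ * _)).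
rewrite exchange_big /=; apply: eq_bigr => u _.
rewrite exchange_big /=; apply: eq_bigr => v _.
rewrite (eq_bigr (fun g => (1 - cut m w u v) * (config_weight (p w) g * (graph_of g u v)%:R) +
  cut m w u v * p w u v ^+ 2 * config_weight (p w) g)); last first.
  by move=> g _; ring.
by rewrite big_split /= -!mulr_sumr sum_config mulr1 sum_config_edge_diag.
Qed.

Lemma expect_sqr (w : V -> R) :
  \sum_g config_weight (p w) g * (n%:R^-1 * \sum_i \sum_j
    (scaled_adjacency alpha (graph_of g) : 'M[R]_n) i j ^+ 2) =
  n%:R^-1 * (c^-1 * \sum_u \sum_v p w u v).
Proof.
have pC u v : p w u v = p w v u by exact: edge_probC.
have pd u : p w u u = 0 by exact: edge_prob_diag.
transitivity (\sum_g n%:R^-1 * (c^-1 * \sum_u \sum_v (config_weight (p w) g *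
    (graph_of g u v)%:R))).
  apply: eq_bigr => g _; rewrite sum_sqr_scaled_adjacency mulrCA.
  rewrite (mulrCA (config_weight _ _)); congr (_ * (_ * _)).
  by rewrite mulr_sumr; apply: eq_bigr => u _; rewrite mulr_sumr.
rewrite -mulr_sumr -mulr_sumr; congr (_ * (_ * _)).
rewrite exchange_big /=; apply: eq_bigr => u _.
rewrite exchange_big /=; apply: eq_bigr => v _.
exact: sum_config_edge_diag.
Qed.

Lemma edge_decay_diag (u : V) : r u u = 0 :> R.
Proof. by rewrite /edge_decay torus_dist_refl powR0 ?gt_eqF // invr0. Qed.

Lemma borel_sqr_diff (m : R) (g : {ffun V * V -> bool}) :
  borel_fun (fun w : V -> R => n%:R^-1 * \sum_i \sum_j
    ((scaled_adjacency alpha (graph_of g) : 'M[R]_n) i j -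
     centered_mx alpha sigma m w g i j) ^+ 2).
Proof.
move=> d' T U mU; apply: measurable_funM => //.
apply: measurable_bigsum => i _; apply: measurable_bigsum => j _.
apply: measurable_funX; apply: measurable_funB => //.
under eq_fun do rewrite !mxE.
by apply: measurable_funM => //; exact: borel_centered.
Qed.

Variable eta : R.
Hypotheses (eta0 : 0 < eta) (eta1 : eta <= 1).
Hypotheses (eta_tau : 1 + eta < tau - 1) (eta_sigma : sigma * (1 + eta) < tau - 1).
Local Notation K := (kernel_moment_bound tau sigma eta).

Let mkp u v : measurable_fun setT
  (fun x => kernel (W u x) (W v x) `^ (1 + eta)).
Proof. exact: measurable_kernel_pow. Qed.

Let weight1 x v : 1 <= W v x. Proof. exact: weight_ge1. Qed.

Let k0 u v x : 0 <= kernel (W u x) (W v x).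
Proof. exact: kernel_ge0. Qed.

Lemma integral_weighted_kernel_le u v (a : R) : 0 <= a -> (u = v -> a = 0) ->
  (\int[P]_x (a * kernel (W u x) (W v x) `^ (1 + eta))%:E <= (a * K)%:E)%E.
Proof.
move=> a0 auv; have [uv|uv] := eqVneq u v.
  rewrite auv // mul0r; under eq_integral do rewrite mul0r.
  by rewrite integral0.
apply: integral_scale_le => // [x|]; first exact: powR_ge0.
exact: kernel_moment_le.
Qed.

(** The common form of all error terms: each off-diagonal pair costs at most [K] and each row of [a]
    sums to at most [B * c]. The diagonal must vanish because the moment bound concerns two
    independent weights. *)
Lemma integral_weighted_sum_le (a : V -> V -> R) (B : R) :
  (forall u v, 0 <= a u v) -> (forall u, a u u = 0) ->
  (forall u, \sum_v a u v <= B * c) ->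
  (\int[P]_x (n%:R^-1 * (c^-1 * \sum_u \sum_v
      a u v * kernel (W u x) (W v x) `^ (1 + eta)))%:E <= (K * B)%:E)%E.
Proof.
move=> a0 ad aB.
have K0 : 0 <= K.
  have h1 : 0 <= tau - 1 by move: (tau2); lra.
  have h2 : 0 <= tau - 1 - (1 + eta) by rewrite subr_ge0 ltW.
  have h3 : 0 <= tau - 1 - sigma * (1 + eta) by rewrite subr_ge0 ltW.
  by rewrite /kernel_moment_bound mulr_ge0 // mulr_ge0 // divr_ge0.
have mak u v : measurable_fun setT
    (fun x => a u v * kernel (W u x) (W v x) `^ (1 + eta)).
  exact: measurable_funM.
have ak0 u v x : 0 <= a u v * kernel (W u x) (W v x) `^ (1 + eta).
  by rewrite mulr_ge0 ?powR_ge0.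
apply: (@le_trans _ _
    (n%:R^-1 * (c^-1 * \sum_u \sum_v a u v * K))%:E).
  apply: integral_scale_le; rewrite ?invr_ge0 ?ler0n //.
  - apply: measurable_funM => //.
    by apply: measurable_bigsum => u _; apply: measurable_bigsum => v _.
  - move=> x; rewrite mulr_ge0 ?invr_ge0 ?(ltW c0) //.
    by apply: sumr_ge0 => u _; apply: sumr_ge0 => v _.
  apply: integral_scale_le; rewrite ?invr_ge0 ?(ltW c0) //.
  - by apply: measurable_bigsum => u _; apply: measurable_bigsum => v _.
  - by move=> x; apply: sumr_ge0 => u _; apply: sumr_ge0 => v _.
  apply: integral_sum_le => [u|u x|u _].
  - by apply: measurable_bigsum => v _.
  - by apply: sumr_ge0 => v _.
  apply: integral_sum_le => // v _.
  by apply: integral_weighted_kernel_le => // ->; exact: ad.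
rewrite lee_fin ler_pdivrMl // ler_pdivrMl //.
have -> : c * (n%:R * (K * B)) = \sum_(u : V) B * c * K.
  by rewrite sumr_const -[RHS]mulr_natl; ring.
apply: ler_sum => u _; rewrite -mulr_suml.
by apply: ler_wpM2r => //; exact: aB.
Qed.

Variable eps : R.
Hypothesis decay_eps : forall u : V, \sum_v r u v `^ (1 + eta) <= eps * c.

Let r0 (u v : V) : 0 <= r u v :> R. Proof. exact: edge_decay_ge0. Qed.

Lemma expectation_diff_le (m : R) : 1 <= m ->
  (\int[P]_x (n%:R^-1 * \sum_i \sum_j
    ((scaled_adjacency alpha (graph_of (config x)) : 'M[R]_n) i j -
     centered_mx alpha sigma m (W^~ x) (config x) i j) ^+ 2)%:E <=
   (K * (m `^ (- eta) + eps))%:E)%E.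
Proof.
move=> m1.
pose H (w : V -> R) g := n%:R^-1 * \sum_i \sum_j
    ((scaled_adjacency alpha (graph_of g) : 'M[R]_n) i j -
     centered_mx alpha sigma m w g i j) ^+ 2.
rewrite (@config_transfer _ _ _ _ _ _ G H); last 2 first.
- by move=> g; exact: borel_sqr_diff.
- move=> w g _; rewrite /H mulr_ge0 ?invr_ge0 ?ler0n //.
  by apply: sumr_ge0 => i _; apply: sumr_ge0 => j _; exact: sqr_ge0.
under eq_integral do rewrite /H expect_sqr_diff.
have mbp u v : measurable_fun setT (fun x => p (W^~ x) u v).
  by apply: borel_edge_prob; exact: measurable_weight.
have mcut u v : measurable_fun setT (fun x => cut m (W^~ x) u v).
  have -> : (fun x => cut m (W^~ x) u v) =
      (fun x => (W u x <= m)%R%:R * (W v x <= m)%R%:R).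
    apply/funext => x; rewrite /cut.
    by case: (_ <= _); case: (_ <= _); rewrite ?mulr1 ?mulr0.
  apply: measurable_funM; apply: borel_indic_le; exact: measurable_weight.
have mf u v : measurable_fun setT (fun x =>
    (1 - cut m (W^~ x) u v) * p (W^~ x) u v + cut m (W^~ x) u v * p (W^~ x) u v ^+ 2).
  apply: measurable_funD; apply: measurable_funM => //.
    exact: measurable_funB.
  exact: measurable_funX.
have cut01 x u v : 0 <= cut m (W^~ x) u v <= 1.
  by rewrite /cut ler0n lern1 leq_b1.
have f0 u v x : 0 <= (1 - cut m (W^~ x) u v) * p (W^~ x) u v +
    cut m (W^~ x) u v * p (W^~ x) u v ^+ 2.
  have /andP[h0 h1] := cut01 x u v.
  have pp := @edge_prob_ge0 R d N alpha sigma (W^~ x) u v (weight1 x).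
  by rewrite addr_ge0 ?mulr_ge0 ?subr_ge0 ?sqr_ge0.
(* The first summand pays for pairs with a weight above [m], through [kernel_tail_le]; the second
   pays for the squared means on kept pairs, through [sqr_min_mul1_le]. *)
pose a (u v : V) := m `^ (- eta) * r u v + r u v `^ (1 + eta).
have a0 u v : 0 <= a u v by rewrite addr_ge0 ?mulr_ge0 ?powR_ge0.
apply: (le_trans _ (integral_weighted_sum_le (a := a) _ _ _)) => //; last first.
- move=> u; rewrite big_split /= -mulr_sumr sum_edge_decay // mulrDl lerD2l.
  exact: decay_eps.
- by move=> u; rewrite /a edge_decay_diag mulr0 add0r powR0 // gt_eqF // addr_gt0.
apply: ge0_le_integral => //.
- move=> x _; rewrite lee_fin mulr_ge0 ?invr_ge0 ?ler0n // mulr_ge0 ?invr_ge0 ?(ltW c0) //.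
  by apply: sumr_ge0 => u _; apply: sumr_ge0 => v _.
- apply/measurable_EFinP; apply: measurable_funM => //; apply: measurable_funM => //.
  by apply: measurable_bigsum => u _; apply: measurable_bigsum => v _.
- apply/measurable_EFinP; apply: measurable_funM => //; apply: measurable_funM => //.
  apply: measurable_bigsum => u _; apply: measurable_bigsum => v _.
  exact: measurable_funM.
move=> x _; rewrite lee_fin; apply: ler_wpM2l; first by rewrite invr_ge0 ler0n.
apply: ler_wpM2l; first by rewrite invr_ge0 ltW.
apply: ler_sum => u _; apply: ler_sum => v _.
set k := kernel (W u x) (W v x).
have kk0 : 0 <= k by exact: k0.
rewrite /a [leRHS]mulrDl; case: (boolP ((W u x <= m) && (W v x <= m))) => [wm|nm].
  have -> : cut m (W^~ x) u v = 1 by rewrite /cut wm.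
  rewrite subrr mul0r add0r mul1r.
  apply: le_trans (_ : k `^ (1 + eta) * r u v `^ (1 + eta) <= _).
    exact: sqr_min_mul1_le.
  by rewrite [leLHS]mulrC lerDr !mulr_ge0 ?powR_ge0.
have -> : cut m (W^~ x) u v = 0 by rewrite /cut (negbTE nm).
rewrite subr0 mul1r mul0r addr0.
have pk : p (W^~ x) u v <= k * r u v by apply: edge_prob_le_decay.
apply: (le_trans pk).
apply: (@le_trans _ _ (k `^ (1 + eta) * m `^ (- eta) * r u v)).
  by apply: ler_wpM2r => //; apply: (kernel_tail_le sigma0 eta0 m1).
have -> : k `^ (1 + eta) * m `^ (- eta) * r u v =
    m `^ (- eta) * r u v * k `^ (1 + eta) by ring.
by rewrite lerDl mulr_ge0 ?powR_ge0.
Qed.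

Lemma expectation_sqrE :
  (\int[P]_x (n%:R^-1 * \sum_i \sum_j
    (scaled_adjacency alpha (graph_of (config x)) : 'M[R]_n) i j ^+ 2)%:E =
   \int[P]_x (n%:R^-1 * (c^-1 * \sum_u \sum_v p (W^~ x) u v))%:E)%E.
Proof.
pose H (w : V -> R) g := n%:R^-1 * \sum_i \sum_j
    (scaled_adjacency alpha (graph_of g) : 'M[R]_n) i j ^+ 2.
rewrite (@config_transfer _ _ _ _ _ _ G H).
- by under eq_integral do rewrite /H expect_sqr.
- by move=> g d' T U mU.
- move=> w g _; rewrite /H mulr_ge0 ?invr_ge0 ?ler0n //.
  by apply: sumr_ge0 => i _; apply: sumr_ge0 => j _; exact: sqr_ge0.
Qed.

Variable mean : R.
Hypothesis meanE : kernel_mean tau sigma = mean%:E.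

Let mrk u v : measurable_fun setT (fun x => r u v * kernel (W u x) (W v x)).
Proof.
apply: measurable_funM => //.
exact: (borel_kernel sigma u v (measurable_weight (G := G))).
Qed.

Let rk0 u v x : 0 <= r u v * kernel (W u x) (W v x).
Proof. by rewrite mulr_ge0. Qed.

(** Without the cap at 1 the average is exactly [mean] for every N, because the rows of [r] sum to
    [c]. *)
Lemma integral_kernel_sum :
  (\int[P]_x (n%:R^-1 * (c^-1 * \sum_u \sum_v r u v * kernel (W u x) (W v x)))%:E =
   mean%:E)%E.
Proof.
have -> : mean = n%:R^-1 * (c^-1 * \sum_(u : V) \sum_v r u v * mean).
  under eq_bigr do rewrite -mulr_suml sum_edge_decay //.
  rewrite sumr_const -[(_ * _) *+ _]mulr_natl.
  by field; rewrite !gt_eqF.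
have mS u : measurable_fun setT (fun x => \sum_v r u v * kernel (W u x) (W v x)).
  by apply: measurable_bigsum => v _.
have S0 u x : 0 <= \sum_v r u v * kernel (W u x) (W v x).
  by apply: sumr_ge0.
have mSS : measurable_fun setT (fun x => \sum_u \sum_v r u v * kernel (W u x) (W v x)).
  by apply: measurable_bigsum => v _.
have SS0 x : 0 <= \sum_u \sum_v r u v * kernel (W u x) (W v x).
  by apply: sumr_ge0.
apply: integral_scale_eq; rewrite ?invr_ge0 ?ler0n //.
- exact: measurable_funM.
- by move=> x; rewrite mulr_ge0 // invr_ge0 ltW.
apply: integral_scale_eq; rewrite ?invr_ge0 ?(ltW c0) //.
apply: integral_sum_eq => // u _; apply: integral_sum_eq => // v _.
have [->|uv] := eqVneq u v.
  rewrite edge_decay_diag mul0r; under eq_integral do rewrite mul0r.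
  by rewrite integral0.
apply: integral_scale_eq => //.
  exact: (borel_kernel sigma u v (measurable_weight (G := G))).
by rewrite integral_kernel.
Qed.

Let mbp u v : measurable_fun setT (fun x => p (W^~ x) u v).
Proof. by apply: borel_edge_prob; exact: measurable_weight. Qed.

Let bp0 u v x : 0 <= p (W^~ x) u v.
Proof. exact: edge_prob_ge0. Qed.

Let avg (F : V -> V -> kg_space G -> R) x := n%:R^-1 * (c^-1 * \sum_u \sum_v F u v x).

Let avg_ge0 F x : (forall u v x, 0 <= F u v x) -> 0 <= avg F x.
Proof.
move=> F0; rewrite mulr_ge0 ?invr_ge0 ?ler0n // mulr_ge0 ?invr_ge0 ?(ltW c0) //.
by apply: sumr_ge0 => u _; apply: sumr_ge0.
Qed.

Let measurable_avg F : (forall u v, measurable_fun setT (F u v)) ->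
  measurable_fun setT (avg F).
Proof.
move=> mF; apply: measurable_funM => //; apply: measurable_funM => //.
by apply: measurable_bigsum => u _; apply: measurable_bigsum => v _.
Qed.

Let avg_le F F' x : (forall u v, F u v x <= F' u v x) -> avg F x <= avg F' x.
Proof.
move=> FF'; apply: ler_wpM2l; first by rewrite invr_ge0 ler0n.
apply: ler_wpM2l; first by rewrite invr_ge0 ltW.
by apply: ler_sum => u _; apply: ler_sum.
Qed.

Lemma expectation_sqr_le :
  (\int[P]_x (n%:R^-1 * \sum_i \sum_j
    (scaled_adjacency alpha (graph_of (config x)) : 'M[R]_n) i j ^+ 2)%:E <=
   mean%:E)%E.
Proof.
rewrite expectation_sqrE -integral_kernel_sum.
apply: ge0_le_integral => //.
- by move=> x _; rewrite lee_fin (avg_ge0 (F := fun u v x => p (W^~ x) u v)).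
- by apply/measurable_EFinP; exact: (measurable_avg (F := fun u v x => p (W^~ x) u v)).
- by apply/measurable_EFinP; exact: (measurable_avg (F := fun u v x => _)).
move=> x _; rewrite lee_fin.
apply: (avg_le (F := fun u v x => p (W^~ x) u v)
               (F' := fun u v x => r u v * kernel (W u x) (W v x))) => u v.
by rewrite [leRHS]mulrC; apply: edge_prob_le_decay.
Qed.

(** By [le_min_mul1], the cap at 1 loses at most r^(1 + eta) kappa^(1 + eta) per pair, which
    averages to at most [K * eps]. *)
Lemma expectation_sqr_ge :
  (mean%:E <= \int[P]_x (n%:R^-1 * \sum_i \sum_j
    (scaled_adjacency alpha (graph_of (config x)) : 'M[R]_n) i j ^+ 2)%:E +
   (K * eps)%:E)%E.
Proof.
rewrite expectation_sqrE -integral_kernel_sum.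
pose F1 (u v : V) x := p (W^~ x) u v.
pose F2 (u v : V) x := r u v `^ (1 + eta) * kernel (W u x) (W v x) `^ (1 + eta).
have mF2 u v : measurable_fun setT (F2 u v) by exact: measurable_funM.
have F20 u v x : 0 <= F2 u v x by rewrite mulr_ge0 ?powR_ge0.
apply: (@le_trans _ _ (\int[P]_x (avg F1 x)%:E + \int[P]_x (avg F2 x)%:E)%E); last first.
  apply: leeD => //; apply: integral_weighted_sum_le => // [u v|u].
    exact: powR_ge0.
  by rewrite edge_decay_diag powR0 // gt_eqF // addr_gt0.
rewrite -ge0_integralD //; last 4 first.
- by move=> x _; rewrite lee_fin avg_ge0.
- by apply/measurable_EFinP; exact: measurable_avg.
- by move=> x _; rewrite lee_fin avg_ge0.
- by apply/measurable_EFinP; exact: measurable_avg.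
apply: ge0_le_integral => //.
- move=> x _; rewrite lee_fin.
  by apply: (avg_ge0 (F := fun u v x => r u v * kernel (W u x) (W v x))).
- by apply/measurable_EFinP; exact: (measurable_avg (F := fun u v x => _)).
- by apply: emeasurable_funD; apply/measurable_EFinP; exact: measurable_avg.
move=> x _; rewrite -EFinD lee_fin /avg -mulrDr -mulrDr -big_split /=.
apply: ler_wpM2l; first by rewrite invr_ge0 ler0n.
apply: ler_wpM2l; first by rewrite invr_ge0 ltW.
apply: ler_sum => u _; rewrite -big_split /=; apply: ler_sum => v _.
rewrite mulrC [F2 _ _ _]mulrC; exact: le_min_mul1.
Qed.

End GraphSquares.

Section WeightConfig.
Variables (R : realType) (d N : nat) (tau alpha sigma : R).
Variable G : kernel_graph d N tau alpha sigma.
Local Notation V := (vertex d N).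

Lemma measurable_weight_config (H : (V -> R) -> {ffun V * V -> bool} -> R) :
  (forall g, borel_fun (H ^~ g)) ->
  measurable_fun setT (fun x => H (weight (G := G) ^~ x) (config x)).
Proof.
move=> mH; pose z1 g : kg_space G -> R := \1_[set x | config x = g].
have -> : (fun x => H (weight (G := G) ^~ x) (config x)) =
    (fun x => \sum_g H (weight (G := G) ^~ x) g * z1 g x).
  apply/funext => x; rewrite (bigD1 (config x)) //= big1 ?addr0.
    by rewrite /z1 indicE mem_set // mulr1.
  by move=> g gx; rewrite /z1 indicE memNset ?mulr0 //= => /esym/eqP; apply/negP.
apply: measurable_bigsum => g _; apply: measurable_funM.
  by apply: mH; exact: measurable_weight.
by apply: measurable_indic; exact: measurable_config.
Qed.

End WeightConfig.

Lemma integral_le3 d (T : measurableType d) (R : realType)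
    (mu : {measure set T -> \bar R}) (F F0 F1 F2 : T -> R) (a1 a2 B0 B1 B2 : R) :
  0 <= a1 -> 0 <= a2 -> measurable_fun setT F ->
  measurable_fun setT F0 -> measurable_fun setT F1 -> measurable_fun setT F2 ->
  (forall x, 0 <= F x) -> (forall x, 0 <= F0 x) ->
  (forall x, 0 <= F1 x) -> (forall x, 0 <= F2 x) ->
  (forall x, F x <= F0 x + a1 * F1 x + a2 * F2 x) ->
  (\int[mu]_x (F0 x)%:E <= B0%:E)%E -> (\int[mu]_x (F1 x)%:E <= B1%:E)%E ->
  (\int[mu]_x (F2 x)%:E <= B2%:E)%E ->
  (\int[mu]_x (F x)%:E <= (B0 + a1 * B1 + a2 * B2)%:E)%E.
Proof.
move=> a10 a20 mF mF0 mF1 mF2 F_0 F00 F10 F20 FF h0 h1 h2.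
have m1 : measurable_fun setT (fun x => a1 * F1 x) by exact: measurable_funM.
have m2 : measurable_fun setT (fun x => a2 * F2 x) by exact: measurable_funM.
apply: (@le_trans _ _ (\int[mu]_x ((F0 x)%:E + (a1 * F1 x)%:E + (a2 * F2 x)%:E))%E).
  apply: ge0_le_integral => //.
  - by move=> x _; rewrite lee_fin.
  - by apply/measurable_EFinP.
  - by apply: emeasurable_funD; [apply: emeasurable_funD|]; apply/measurable_EFinP.
  - by move=> x _; rewrite -!EFinD lee_fin.
rewrite ge0_integralD //; last 4 first.
- by move=> x _; rewrite -EFinD lee_fin addr_ge0 // mulr_ge0.
- by apply: emeasurable_funD; apply/measurable_EFinP.
- by move=> x _; rewrite lee_fin mulr_ge0.
- by apply/measurable_EFinP.
rewrite ge0_integralD //; last 4 first.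
- by move=> x _; rewrite lee_fin.
- by apply/measurable_EFinP.
- by move=> x _; rewrite lee_fin mulr_ge0.
- by apply/measurable_EFinP.
rewrite !EFinD; apply: leeD; last exact: integral_scale_le.
by apply: leeD => //; exact: integral_scale_le.
Qed.

(** * Truncated spectral moments of a finite graph *)

Section FiniteGraph.
Variables (R : realType) (d N' : nat) (tau alpha sigma : R).
Local Notation N := N'.+1.
Variable G : kernel_graph d N tau alpha sigma.
Hypotheses (tau2 : 2 < tau) (sigma0 : 0 < sigma) (sigma1 : sigma < tau - 1).
Hypothesis alpha0 : 0 < alpha.
Local Notation V := (vertex d N).
Local Notation P := (kg_prob G).
Local Notation W := (weight (G := G)).
Local Notation c := (scaling d N alpha).
Local Notation n := #|V|.
Hypothesis c1 : 1 <= c.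

Let n0 : 0 < n%:R :> R.
Proof. by rewrite ltr0n card_ffun !card_ord expn_gt0. Qed.

Let invn0 : 0 <= n%:R^-1 :> R.
Proof. by rewrite invr_ge0 ltW. Qed.

(** The integral of [f] against the [ESD], kept as a finite sum to exhibit it as a function of the
    configuration. *)
Definition ESD_mean (f : R -> R) (x : kg_space G) : R :=
  n%:R^-1 * \sum_(z <- eigenvalues (scaled_adjacency alpha (kg_edge x) : 'M[R]_n)) f z.

Lemma ESD_mean_ge0 f x : (forall z, 0 <= f z) -> 0 <= ESD_mean f x.
Proof. by move=> f0; rewrite mulr_ge0 // sumr_ge0. Qed.

(** The eigenvalues depend on the sample point only through the configuration, which takes finitely
    many values. *)
Lemma measurable_ESD_mean f : measurable_fun setT (ESD_mean f).
Proof.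
rewrite (_ : ESD_mean f = (fun g => n%:R^-1 *
    \sum_(z <- eigenvalues (scaled_adjacency alpha (graph_of g) : 'M[R]_n)) f z) \o
    config (G := G)); first exact: measurable_fun_config.
by apply/funext => x; rewrite /ESD_mean /= graph_config.
Qed.

Lemma tr_scaled_adjacency x :
  (scaled_adjacency alpha (kg_edge (k := G) x) : 'M[R]_n)^T =
  scaled_adjacency alpha (kg_edge x).
Proof. by apply: tr_adjacency; exact: kg_edge_sym. Qed.

Definition trunc_pow (T : R) (q : nat) (x : R) : R := Num.min `|x| T ^+ q.

Lemma trunc_pow_ge0 T q x : 0 <= T -> 0 <= trunc_pow T q x.
Proof. by move=> T0; rewrite exprn_ge0 // le_min normr_ge0. Qed.

Variable eta : R.
Hypotheses (eta0 : 0 < eta) (eta1 : eta <= 1).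
Hypotheses (eta_tau : 1 + eta < tau - 1) (eta_sigma : sigma * (1 + eta) < tau - 1).
Local Notation K := (kernel_moment_bound tau sigma eta).

Variable eps : R.
Hypothesis decay_eps : forall u : V,
  \sum_v edge_decay alpha u v `^ (1 + eta) <= eps * c.

Section Truncated.
Variables (m T : R) (k : nat) (M : R).
Hypotheses (m1 : 1 <= m) (T0 : 0 < T).
Hypothesis cutM : (\int[lebesgue_measure]_x
  ((cut_pow sigma m k x)%:E * (pareto_pdf tau x)%:E) <= M%:E)%E.
Local Notation C := (((1 + k.*2) ^ k.*2)%:R * M ^+ (k.*2).+1).

Let X x := centered_mx alpha sigma m (W^~ x) (config x).
Let trX x : R := n%:R^-1 * \tr (iter k.*2 (mulmx (X x)) 1%:M).
Let diffX x : R := n%:R^-1 * \sum_i \sum_j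
  ((scaled_adjacency alpha (graph_of (config x)) : 'M[R]_n) i j - X x i j) ^+ 2.

Let mtrX : measurable_fun setT trX.
Proof.
apply: (measurable_weight_config (H := fun w g =>
  n%:R^-1 * \tr (iter k.*2 (mulmx (centered_mx alpha sigma m w g)) 1%:M))).
by move=> g; exact: borel_trace.
Qed.

Let mdiffX : measurable_fun setT diffX.
Proof.
apply: (measurable_weight_config (H := fun w g => n%:R^-1 * \sum_i \sum_j
  ((scaled_adjacency alpha (graph_of g) : 'M[R]_n) i j -
    centered_mx alpha sigma m w g i j) ^+ 2)).
by move=> g; exact: borel_sqr_diff.
Qed.

Let trX0 x : 0 <= trX x.
Proof. by rewrite mulr_ge0 //; apply: trace_even_ge0; exact: tr_centered_mx. Qed.

Let diffX0 x : 0 <= diffX x.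
Proof.
by rewrite mulr_ge0 // sumr_ge0 // => i _; rewrite sumr_ge0 // => j _; exact: sqr_ge0.
Qed.

Let trX_le : (\int[P]_x (trX x)%:E <= C%:E)%E.
Proof. exact: expectation_trace_le. Qed.

Let diffX_le : (\int[P]_x (diffX x)%:E <= (K * (m `^ (- eta) + eps))%:E)%E.
Proof. exact: expectation_diff_le. Qed.

(** [L] is the Lipschitz constant of the truncated power. In use, [delta] is chosen small first; [m]
    and N then beat the factor [L / delta]. *)
Lemma expectation_trunc_pow_le (L delta : R) : 0 < delta ->
  L = k.*2%:R * T ^+ k.*2.-1 ->
  (\int[P]_x (ESD_mean (trunc_pow T k.*2) x)%:E <=
   (L * delta + C + L / delta * (K * (m `^ (- eta) + eps)))%:E)%E.
Proof.
move=> delta0 LE.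
have L0 : 0 <= L by rewrite LE mulr_ge0 ?ler0n // exprn_ge0 // ltW.
rewrite -[C]mul1r.
apply: (integral_le3 (F0 := fun=> L * delta) (F1 := trX) (F2 := diffX)) => //.
- by rewrite divr_ge0 // ltW.
- exact: measurable_ESD_mean.
- by move=> x; apply: ESD_mean_ge0 => z; apply: trunc_pow_ge0; exact: ltW.
- by move=> x; rewrite mulr_ge0 // ltW.
- move=> x; rewrite mul1r.
  have := sum_eigenvalues_le (tr_scaled_adjacency x)
    (tr_centered_mx alpha sigma m (W^~ x) (config x))
    (f := trunc_pow T k.*2) (q := k.*2) L0 delta0 _ _.
  have h' y z : `|trunc_pow T k.*2 y - trunc_pow T k.*2 z| <= L * `|y - z|.
    by rewrite LE; apply: trunc_pow_lipschitz; exact: ltW.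
  move=> /(_ h').
  have h z : trunc_pow T k.*2 z <= z ^+ k.*2.
    have -> : z ^+ k.*2 = `|z| ^+ k.*2.
      by rewrite -!mul2n !exprM real_normK // num_real.
    by rewrite /trunc_pow lerXn2r ?nnegrE ?le_min ?normr_ge0 ?ge_min ?lexx // ltW.
  move/(_ h) => /(ler_wpM2l invn0) le1.
  apply: (le_trans le1); rewrite /trX /diffX graph_config !mulrDr.
  rewrite mulKf ?gt_eqF // [in leRHS]mulrCA.
  by rewrite [X in _ <= X + _]addrC.
- by rewrite integral_cst // [X in (_ * X)%E]probability_setT mule1.
Qed.

End Truncated.

Variable mean : R.
Hypothesis meanE : kernel_mean tau sigma = mean%:E.

Lemma expectation_trunc_sqr_le (T : R) : 0 <= T ->
  (\int[P]_x (ESD_mean (trunc_pow T 2) x)%:E <= mean%:E)%E.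
Proof.
move=> T0; apply: le_trans (expectation_sqr_le G tau2 alpha0 c1 meanE).
apply: ge0_le_integral => //.
- by move=> x _; rewrite lee_fin ESD_mean_ge0 // => z; exact: trunc_pow_ge0.
- by apply/measurable_EFinP; exact: measurable_ESD_mean.
- apply/measurable_EFinP; exact: (measurable_fun_config (fun g => n%:R^-1 * \sum_i \sum_j
    (scaled_adjacency alpha (graph_of g) : 'M[R]_n) i j ^+ 2)).
move=> x _; rewrite lee_fin graph_config; apply: ler_wpM2l => //.
by apply: sum_sqr_min_eigenvalues_le => //; exact: tr_scaled_adjacency.
Qed.

(** The trace bound with k = 2 and the Frobenius bound are inserted in [sum_sqr_eigenvalues_tail];
    the last term [K * eps] is the loss from the cap at 1. *)
Lemma expectation_trunc_sqr_ge (m T M B : R) : 1 <= m -> 0 < T ->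
  (\int[lebesgue_measure]_x
    ((cut_pow sigma m 2 x)%:E * (pareto_pdf tau x)%:E) <= M%:E)%E ->
  (\int[P]_x (ESD_mean (trunc_pow T 2) x)%:E <= B%:E)%E ->
  mean <= B + 16 / T ^+ 2 * (((1 + 4) ^ 4)%:R * M ^+ 5) +
    4 * (K * (m `^ (- eta) + eps)) + K * eps.
Proof.
move=> m1 T0 cutM hB.
have := expectation_sqr_ge G tau2 alpha0 c1 eta0 eta_tau eta_sigma decay_eps meanE.
rewrite -lee_fin EFinD; move/le_trans; apply; apply: leeD => //.
apply: (integral_le3 (F0 := ESD_mean (trunc_pow T 2))
  (F1 := fun x => n%:R^-1 * \tr (iter (2.*2)
     (mulmx (centered_mx alpha sigma m (W^~ x) (config x))) 1%:M))
  (F2 := fun x => n%:R^-1 * \sum_i \sum_j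
  ((scaled_adjacency alpha (graph_of (config x)) : 'M[R]_n) i j -
    centered_mx alpha sigma m (W^~ x) (config x) i j) ^+ 2)) => //.
- by rewrite divr_ge0 // exprn_ge0 // ltW.
- exact: (measurable_fun_config (fun g => n%:R^-1 * \sum_i \sum_j
    (scaled_adjacency alpha (graph_of g) : 'M[R]_n) i j ^+ 2)).
- exact: measurable_ESD_mean.
- apply: (measurable_weight_config (H := fun w g =>
    n%:R^-1 * \tr (iter (2.*2) (mulmx (centered_mx alpha sigma m w g)) 1%:M))).
  by move=> g; exact: borel_trace.
- apply: (measurable_weight_config (H := fun w g => n%:R^-1 * \sum_i \sum_j
    ((scaled_adjacency alpha (graph_of g) : 'M[R]_n) i j -
      centered_mx alpha sigma m w g i j) ^+ 2)).
  by move=> g; exact: borel_sqr_diff.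
- move=> x; rewrite mulr_ge0 // sumr_ge0 // => i _.
  by rewrite sumr_ge0 // => j _; exact: sqr_ge0.
- by move=> x; apply: ESD_mean_ge0 => z; apply: trunc_pow_ge0; exact: ltW.
- move=> x; rewrite mulr_ge0 //; apply: trace_even_ge0; exact: tr_centered_mx.
- move=> x; rewrite mulr_ge0 // sumr_ge0 // => i _.
  by rewrite sumr_ge0 // => j _; exact: sqr_ge0.
- move=> x; rewrite graph_config.
  have := sum_sqr_eigenvalues_tail (tr_scaled_adjacency x)
    (tr_centered_mx alpha sigma m (W^~ x) (config x)) T0.
  rewrite lerBlDl => /(ler_wpM2l invn0).
  by rewrite /ESD_mean !mulrDr addrA [in leRHS]mulrCA [X in _ + _ + X]mulrCA.
- exact: (expectation_trace_le G tau2 alpha0 c1 cutM).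
- exact: expectation_diff_le.
Qed.

End FiniteGraph.

(** * Passage to the limit *)

Section WeakLimit.
Variables (R : realType) (d : nat) (tau alpha sigma : R).
Hypothesis alpha0 : 0 < alpha.
Variable G : forall N : nat, kernel_graph d N tau alpha sigma.
Variable mu : probability (measurableTypeR R) R.
Hypothesis hmu : limiting_spectral_distribution G mu.
Local Notation TR := (measurableTypeR R).

Section Lipschitz.
Variables (f : R -> R) (K L : R).
Hypotheses (mf : measurable_fun setT (f : TR -> R)).
Hypotheses (f0 : forall x, 0 <= f x) (fK : forall x, f x <= K) (K0 : 0 < K).
Hypotheses (L0 : 0 <= L) (fL : forall x y, `|f x - f y| <= L * `|x - y|).

Lemma measurable_lp_event N' (eps : R) : measurable [set x : kg_space (G N'.+1) |
  eps < levy_prokhorov (ESD (scaled_adjacency alpha (kg_edge x))) mu].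
Proof.
pose F g := levy_prokhorov (ESD (scaled_adjacency alpha
  (graph_of (g : {ffun vertex d N'.+1 * vertex d N'.+1 -> bool})))) mu.
have -> : [set x : kg_space (G N'.+1) |
    eps < levy_prokhorov (ESD (scaled_adjacency alpha (kg_edge x))) mu] =
    (F \o config (G := G N'.+1)) @^-1` `]eps, +oo[%classic.
  by apply/seteqP; split => x; rewrite /F /= in_itv /= andbT graph_config.
by rewrite -[X in measurable X]setTI; apply: (measurable_fun_config F).
Qed.

Lemma lp_event_small (eps e : R) : 0 < eps -> 0 < e ->
  exists N0, forall N', (N0 <= N')%N ->
    (kg_prob (G N'.+1) [set x |
      (eps < levy_prokhorov (ESD (scaled_adjacency alpha (kg_edge x))) mu)%R] <= e%:E)%E.
Proof.
move=> eps0 e0; have /fine_cvgP[_ /cvgr0Pnorm_lt h] := hmu eps0.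
have [N0 _ hN] := h _ e0.
exists N0 => N' NN'; have := hN N'.+1 (leqW NN').
have mE := @measurable_lp_event N' eps.
have fin := fin_num_measure (kg_prob (G N'.+1)) _ mE.
move=> /(le_lt_trans (ler_norm _))/ltW.
by rewrite /= -lee_fin fineK.
Qed.

Lemma integral_bounded (nu : {measure set TR -> \bar R}) : (nu setT <= 1)%E ->
  (\int[nu]_x (f x)%:E <= K%:E)%E.
Proof.
move=> nu1; apply: (@le_trans _ _ (\int[nu]_x (cst K%:E x))%E).
  apply: ge0_le_integral => //.
  - by move=> x _; rewrite lee_fin.
  - by apply/measurable_EFinP.
  - by move=> x _; rewrite lee_fin.
rewrite integral_cst // -[leRHS]mule1; apply: lee_wpmul2l => //.
by rewrite lee_fin ltW.
Qed.

Lemma expectation_ESD_close (e : R) : 0 < e ->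
  exists N0, forall N', (N0 <= N')%N ->
    (\int[kg_prob (G N'.+1)]_x (ESD_mean f x)%:E <= \int[mu]_x (f x)%:E + e%:E)%E /\
    (\int[mu]_x (f x)%:E <= \int[kg_prob (G N'.+1)]_x (ESD_mean f x)%:E + e%:E)%E.
Proof.
move=> e0; pose C := 2 * L + 2 * K + 1.
(* The error [e] is split in halves: [eps] satisfies C eps = e/2 off the bad event, whose
   probability is at most e / (2K) and which therefore costs e/2. *)
have C0 : 0 < C by rewrite /C; move: (L0) (K0); lra.
pose eps := e / (2 * C).
have eps0 : 0 < eps by rewrite divr_gt0 // mulr_gt0.
have e'0 : 0 < e / (2 * K) by rewrite divr_gt0 // mulr_gt0.
have [N0 hN] := lp_event_small eps0 e'0.
exists N0 => N' /hN{hN}; set B := (X in kg_prob _ X) => PB.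
have mB : measurable B by exact: measurable_lp_event.
have mu1 : (mu setT <= 1)%E by rewrite probability_setT.
have I_le := integral_bounded mu1.
have I_ge : (0 <= \int[mu]_x (f x)%:E)%E.
  by apply: integral_ge0 => x _; rewrite lee_fin.
have finI : (\int[mu]_x (f x)%:E)%E \is a fin_num.
  by rewrite ge0_fin_numE // (le_lt_trans I_le) // ltry.
set m := fine (\int[mu]_x (f x)%:E)%E.
have IE : (\int[mu]_x (f x)%:E = m%:E)%E by rewrite /m fineK.
have ESD1 x : (ESD (scaled_adjacency alpha (kg_edge (k := G N'.+1) x)) setT <= 1)%E.
  by apply: ESD_setT_le1; exact: tr_scaled_adjacency.
have ESDE x : (\int[ESD (scaled_adjacency alpha (kg_edge (k := G N'.+1) x))]_z (f z)%:E
    = (ESD_mean f x)%:E)%E.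
  by rewrite integral_ESD.
have := @expectation_close _ _ _ (kg_prob (G N'.+1)) (ESD_mean f) B m K (e / 2)
  (@measurable_ESD_mean _ _ _ _ _ _ _ f) mB.
have h1 x : 0 <= ESD_mean (G := G N'.+1) f x by exact: ESD_mean_ge0.
have h2 x : ESD_mean (G := G N'.+1) f x <= K.
  by rewrite -lee_fin -ESDE; exact: integral_bounded.
have h3 : 0 <= m by rewrite -lee_fin -IE.
have h4 : m <= K by rewrite -lee_fin -IE.
have h5 : 0 <= e / 2 by rewrite divr_ge0 // ltW.
have h6 x : ~ B x -> ESD_mean f x <= m + e / 2 /\ m <= ESD_mean f x + e / 2.
  move=> /negP; rewrite /B /= -leNgt => lp.
  have [] := levy_prokhorov_integral_le mf f0 fK K0 L0 fL eps0 (ESD1 x) mu1 lp.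
  rewrite -/C ESDE IE -!EFinD !lee_fin.
  have -> : C * eps = e / 2.
    by rewrite /eps; field; rewrite gt_eqF.
  by [].
move=> /(_ h1 h2 h3 h4 h5 h6) [le1 le2].
have KP : (K%:E * kg_prob (G N'.+1) B <= (e / 2)%:E)%E.
  apply: (@le_trans _ _ (K%:E * (e / (2 * K))%:E)%E).
    by apply: lee_wpmul2l => //; rewrite lee_fin ltW.
  rewrite -EFinM lee_fin; have -> : K * (e / (2 * K)) = e / 2; last by [].
  by field; rewrite gt_eqF.
have ee : e = e / 2 + e / 2 by field.
rewrite IE; split.
  apply: (le_trans le1); rewrite [in leRHS]ee EFinD EFinD addeA.
  exact: leeD2l.
apply: (le_trans le2); rewrite [in leRHS]ee EFinD addeA.
exact: leeD2l.
Qed.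

End Lipschitz.

Lemma measurable_trunc_pow (T : R) (q : nat) :
  measurable_fun setT (trunc_pow T q : TR -> R).
Proof.
apply: measurable_funX; apply: measurable_minr => //.
Qed.

Lemma expectation_trunc_close (T e : R) (q : nat) : 0 < T -> 0 < e ->
  exists N0, forall N', (N0 <= N')%N ->
    (\int[kg_prob (G N'.+1)]_x (ESD_mean (trunc_pow T q) x)%:E <=
      \int[mu]_x (trunc_pow T q x)%:E + e%:E)%E /\
    (\int[mu]_x (trunc_pow T q x)%:E <=
      \int[kg_prob (G N'.+1)]_x (ESD_mean (trunc_pow T q) x)%:E + e%:E)%E.
Proof.
move=> T0; apply: (expectation_ESD_close (K := T ^+ q) (L := q%:R * T ^+ q.-1)).
- exact: measurable_trunc_pow.
- by move=> x; apply: trunc_pow_ge0; exact: ltW.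
- move=> x; rewrite /trunc_pow lerXn2r ?nnegrE ?le_min ?normr_ge0 ?ge_min ?lexx ?orbT //.
    by rewrite ltW.
  exact: ltW.
- exact: exprn_gt0.
- by rewrite mulr_ge0 ?ler0n // exprn_ge0 // ltW.
- by move=> x y; apply: trunc_pow_lipschitz; exact: ltW.
Qed.

Lemma integral_trunc_pow_fin (T : R) (q : nat) : 0 < T ->
  exists m : R, (\int[mu]_x (trunc_pow T q x)%:E = m%:E)%E.
Proof.
move=> T0; exists (fine (\int[mu]_x (trunc_pow T q x)%:E)%E); rewrite fineK //.
rewrite ge0_fin_numE; last first.
  by apply: integral_ge0 => x _; rewrite lee_fin; apply: trunc_pow_ge0; exact: ltW.
apply: le_lt_trans (ltry (T ^+ q)); apply: integral_bounded.
- exact: measurable_trunc_pow.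
- by move=> x; apply: trunc_pow_ge0; exact: ltW.
- move=> x; rewrite /trunc_pow lerXn2r ?nnegrE ?le_min ?normr_ge0 ?ge_min ?lexx ?orbT //.
    by rewrite ltW.
  exact: ltW.
- exact: exprn_gt0.
- by rewrite [X in (X <= _)%E]probability_setT.
Qed.

(** Monotone convergence along the truncation levels T = n + 1. *)
Lemma integral_norm_pow_le (q : nat) (C : \bar R) :
  (forall T : R, 0 < T -> (\int[mu]_x (trunc_pow T q x)%:E <= C)%E) ->
  (\int[mu]_x (`|x| ^+ q)%:E <= C)%E.
Proof.
move=> hC.
pose g (n : nat) (x : TR) := (trunc_pow n.+1%:R q x)%:E.
have mg n : measurable_fun setT (g n).
  by apply/measurable_EFinP; exact: measurable_trunc_pow.
have g0 n x : setT x -> (0 <= g n x)%E.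
  by move=> _; rewrite lee_fin; exact: trunc_pow_ge0.
have ndg (x : TR) : setT x -> {homo g ^~ x : n m / (n <= m)%N >-> (n <= m)%E}.
  move=> _ n m nm; rewrite lee_fin lerXn2r ?nnegrE //.
  by rewrite le_min !ge_min lexx /= ler_nat ltnS nm orbT.
have limg x : limn (g ^~ x) = (`|x| ^+ q)%:E.
  apply/cvg_lim => //; apply: cvg_near_cst.
  exists (Num.truncn `|x|) => // n /= xn.
  rewrite /g /trunc_pow min_l // ltW //; apply: lt_le_trans (truncnS_gt _) _.
  by rewrite ler_nat ltnS.
under eq_integral do rewrite -limg.
rewrite monotone_convergence //; apply: lime_le; last first.
  by apply: nearW => n; exact: hC.
apply: ereal_nondecreasing_is_cvgn => a b ab; apply: ge0_le_integral => //.
- by move=> x _; exact: g0.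
- by move=> x _; exact: ndg.
Qed.

End WeakLimit.

(** * Moments of the truncated Pareto weight *)

Section CutMoments.
Variables (R : realType) (tau sigma : R).
Hypothesis tau2 : 2 < tau.
Local Notation s := (Num.max sigma 1).

Let tau1 : 1 < tau. Proof. by move: (tau2); lra. Qed.

Lemma integral_pareto_cst (c : R) : 0 <= c ->
  (\int[lebesgue_measure]_x (c%:E * (pareto_pdf tau x)%:E) = c%:E)%E.
Proof.
move=> c0; rewrite ge0_integralZl_EFin //; last 2 first.
- by move=> x _; rewrite lee_fin pareto_pdf_ge0.
- by apply/measurable_EFinP; exact: measurable_pareto_pdf.
have -> : (\int[lebesgue_measure]_x (pareto_pdf tau x)%:E = 1)%E; last first.
  by rewrite mule1.
transitivity (\int[lebesgue_measure]_x ((x `^ 0)%:E * (pareto_pdf tau x)%:E))%E.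
  by apply: eq_integral => x _; rewrite powRr0 mul1e.
by rewrite pareto_moment ?subr_gt0 // subr0 divff // subr_eq0 gt_eqF.
Qed.

Let le_pareto (f g : R -> R) : measurable_fun setT f -> measurable_fun setT g ->
  (forall x, 0 <= f x) -> (forall x, 0 <= g x) -> (forall x, 1 <= x -> f x <= g x) ->
  (\int[lebesgue_measure]_x ((f x)%:E * (pareto_pdf tau x)%:E) <=
   \int[lebesgue_measure]_x ((g x)%:E * (pareto_pdf tau x)%:E))%E.
Proof.
move=> mf mg f0 g0 fg; apply: ge0_le_integral => //.
- by move=> x _; rewrite -EFinM lee_fin mulr_ge0 // pareto_pdf_ge0.
- apply: emeasurable_funM; apply/measurable_EFinP => //.
  exact: measurable_pareto_pdf.
- apply: emeasurable_funM; apply/measurable_EFinP => //.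
  exact: measurable_pareto_pdf.
move=> x _; rewrite -!EFinM lee_fin.
have [x1|x1] := leP 1 x; first by rewrite ler_wpM2r ?pareto_pdf_ge0 ?fg.
by rewrite /pareto_pdf ifN ?mulr0 // -ltNge.
Qed.

Let cut_pow_ge0 m k x : 0 <= cut_pow sigma m k x.
Proof. exact: le_trans ler01 (cut_pow_ge1 sigma m k x). Qed.

(** The power is at most its value at the cutoff. The bound grows with [m] but holds for every [k];
    the second moment uses it with k = 2, where the weight moment may be infinite. *)
Lemma integral_cut_pow_cut_le (m : R) k : 1 <= m ->
  (\int[lebesgue_measure]_x
    ((cut_pow sigma m k x)%:E * (pareto_pdf tau x)%:E) <=
   (1 + (m `^ s) ^+ k)%:E)%E.
Proof.
move=> m1; rewrite -[leRHS]integral_pareto_cst; last first.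
  by rewrite addr_ge0 // exprn_ge0 // powR_ge0.
apply: (le_pareto (g := fun=> 1 + (m `^ s) ^+ k)) => //.
- exact: measurable_cut_pow.
- by move=> x; rewrite addr_ge0 // exprn_ge0 // powR_ge0.
move=> x x1; rewrite /cut_pow lerD2l; case: (leP x m) => xm /=.
  rewrite mul1r lerXn2r ?nnegrE ?powR_ge0 // ge0_ler_powR ?nnegrE //.
  - by rewrite le_max ler01 orbT.
  - exact: le_trans x1.
  - exact: le_trans m1.
by rewrite mul0r exprn_ge0 // powR_ge0.
Qed.

(** Dropping the indicator makes the bound uniform in [m], so the cutoff may be chosen after the
    constant. *)
Lemma integral_cut_pow_le (m : R) k : s * k%:R < tau - 1 ->
  (\int[lebesgue_measure]_x
    ((cut_pow sigma m k x)%:E * (pareto_pdf tau x)%:E) <=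
   (1 + (tau - 1) / (tau - 1 - s * k%:R))%:E)%E.
Proof.
move=> sk.
apply: (@le_trans _ _ (\int[lebesgue_measure]_x
    ((1 + x `^ (s * k%:R))%:E * (pareto_pdf tau x)%:E))%E).
  apply: (le_pareto (g := fun x => 1 + x `^ (s * k%:R))).
  - exact: measurable_cut_pow.
  - by apply: measurable_funD => //; exact: measurable_powR.
  - by [].
  - by move=> x; rewrite addr_ge0 ?powR_ge0.
  move=> x x1; rewrite /cut_pow lerD2l powRrM powR_mulrn ?powR_ge0 //.
  by case: (x <= m); rewrite ?mul1r ?mul0r ?exprn_ge0 ?powR_ge0.
rewrite EFinD -(integral_pareto_cst ler01) -(pareto_moment tau1 sk).
rewrite -ge0_integralD //; last 4 first.
- by move=> x _; rewrite -EFinM lee_fin mulr_ge0 // pareto_pdf_ge0.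
- by apply: emeasurable_funM => //; apply/measurable_EFinP; exact: measurable_pareto_pdf.
- by move=> x _; rewrite -EFinM lee_fin mulr_ge0 ?powR_ge0 // pareto_pdf_ge0.
- apply: emeasurable_funM; apply/measurable_EFinP.
    exact: measurable_powR.
  exact: measurable_pareto_pdf.
by under eq_integral do rewrite -!EFinM -EFinD -mulrDl.
Qed.

End CutMoments.

Lemma kernel_mean_ge1 (R : realType) (d : nat) (tau alpha sigma : R)
    (G : kernel_graph d 2 tau alpha sigma) : (0 < d)%N ->
  2 < tau -> 0 < sigma -> sigma < tau - 1 ->
  exists mean : R, kernel_mean tau sigma = mean%:E /\ 1 <= mean.
Proof.
move=> d0 tau2 sigma0 sigma1.
have [eta [eta0 eta1 etat etas]] := exists_moment_gain tau2 sigma0 sigma1.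
(* For N = 2 and d >= 1 there are two distinct vertices, hence two independent weights on which the
   double integral is an expectation. *)
pose u : vertex d 2 := [ffun=> ord0]; pose v : vertex d 2 := [ffun=> ord_max].
have uv : u != v.
  by apply/eqP => /ffunP /(_ (Ordinal d0)); rewrite !ffunE => /(congr1 val).
have W1 x : 1 <= Defs.kernel sigma (weight (G := G) u x) (weight v x).
  by apply: kernel_ge1 => //; exact: weight_ge1.
have mk : measurable_fun setT
    (fun x => Defs.kernel sigma (weight (G := G) u x) (weight v x)).
  exact: (borel_kernel sigma u v (measurable_weight (G := G))).
have le1 : (1%:E <= kernel_mean tau sigma)%E.
  rewrite -(integral_kernel G tau2 uv).
  have <- : (\int[kg_prob G]_x cst 1%:E x = 1%:E)%E.
    by rewrite integral_cst // [X in (_ * X)%E]probability_setT mule1.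
  apply: ge0_le_integral => //; first by apply/measurable_EFinP.
  by move=> x _; rewrite lee_fin.
have leK : (kernel_mean tau sigma <= (kernel_moment_bound tau sigma eta)%:E)%E.
  rewrite -(integral_kernel G tau2 uv).
  apply: le_trans (kernel_moment_le G tau2 eta0 etat etas uv).
  apply: ge0_le_integral => //.
  - by move=> x _; rewrite lee_fin (le_trans ler01).
  - by apply/measurable_EFinP.
  - by apply/measurable_EFinP; exact: measurable_kernel_pow.
  move=> x _; rewrite lee_fin -[leLHS]powRr1 ?(le_trans ler01) //.
  by rewrite ler_powR // lerDl ltW.
have fin : kernel_mean tau sigma \is a fin_num.
  by rewrite ge0_fin_numE ?(le_lt_trans leK) ?ltry // (le_trans _ le1).
exists (fine (kernel_mean tau sigma)); rewrite fineK //; split => //.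
by rewrite -lee_fin fineK.
Qed.

Lemma exists_cutoff (R : realType) (eta eps : R) : 0 < eta -> 0 < eps ->
  exists m : R, 1 <= m /\ m `^ (- eta) <= eps.
Proof.
move=> eta0 eps0; exists (Num.max 1 (eps^-1 `^ eta^-1)).
set y := eps^-1 `^ _; have y0 : 0 < y by rewrite powR_gt0 // invr_gt0.
split; first by rewrite le_max lexx.
rewrite powRN -[leRHS]invrK lef_pV2 ?posrE ?invr_gt0 //; last first.
  by rewrite powR_gt0 // lt_max ltr01.
have -> : eps^-1 = y `^ eta.
  by rewrite -powRrM mulVf ?gt_eqF // powRr1 // invr_ge0 ltW.
rewrite ge0_ler_powR ?nnegrE ?(ltW eta0) ?(ltW y0) //.
- by rewrite le_max ler01.
- by rewrite le_max lexx orbT.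
Qed.

Section Moments.
Variables (R : realType) (d : nat) (tau alpha sigma : R).
Hypotheses (d0 : (0 < d)%N) (tau2 : 2 < tau).
Hypotheses (alpha0 : 0 < alpha) (alphad : alpha < d%:R).
Hypotheses (sigma0 : 0 < sigma) (sigma1 : sigma < tau - 1).
Variable G : forall N : nat, kernel_graph d N tau alpha sigma.
Variable mu : probability (measurableTypeR R) R.
Hypothesis hmu : limiting_spectral_distribution G mu.
Local Notation s := (Num.max sigma 1).

Lemma moment_le (p : nat) : s * p%:R < tau - 1 ->
  (\int[mu]_x (`|x| ^+ p.*2)%:E <= (((1 + p.*2) ^ p.*2)%:R *
    (1 + (tau - 1) / (tau - 1 - s * p%:R)) ^+ (p.*2).+1)%:E)%E.
Proof.
move=> sp; set M := 1 + _; set C := _ * _.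
apply: integral_norm_pow_le => T T0.
have [eta [eta0 eta1 etat etas]] := exists_moment_gain tau2 sigma0 sigma1.
pose L : R := p.*2%:R * T ^+ p.*2.-1.
have L0 : 0 <= L by rewrite mulr_ge0 ?ler0n // exprn_ge0 // ltW.
set K := kernel_moment_bound tau sigma eta.
apply/lee_addgt0Pr => e e0.
(* Three errors of e/3: [L * delta], the Frobenius term, and the weak limit. The shifts by 1 in
   [delta] and [D] keep the denominators positive whatever the sizes of [L] and [K]. *)
pose delta := e / (3 * (L + 1)).
have L1 : 0 < L + 1 by rewrite ltr_wpDl.
have delta0 : 0 < delta by rewrite divr_gt0 // mulr_gt0.
pose D := `|L / delta * K| + 1.
have D0 : 0 < D by rewrite ltr_wpDl.
pose eps := e / (6 * D).
have eps0 : 0 < eps by rewrite divr_gt0 // mulr_gt0.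
have [m [m1 meps]] := exists_cutoff eta0 eps0.
have [N1 hN1] := sum_edge_decay_small d0 alpha0 alphad eta0 eps0.
have e30 : 0 < e / 3 by rewrite divr_gt0.
have [N2 hN2] := expectation_trunc_close hmu p.*2 T0 e30.
have [c1 dec] := hN1 (maxn N1 N2) (leq_maxl _ _).
have [_ close] := hN2 (maxn N1 N2) (leq_maxr _ _).
have bnd := expectation_trunc_pow_le (G (maxn N1 N2).+1) tau2 sigma0 alpha0 c1 eta0 eta1
  etat etas dec m1 T0 (integral_cut_pow_le tau2 m sp) delta0 (erefl L).
apply: (le_trans close); apply: (le_trans (leeD2r _ bnd)).
rewrite -!EFinD lee_fin -/K -/M -/C.
have h1 : L * delta <= e / 3.
  have -> : e / 3 = (L + 1) * delta by rewrite /delta; field; rewrite gt_eqF.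
  by apply: ler_wpM2r; [exact: ltW|rewrite lerDl].
have h2 : L / delta * (K * (m `^ (- eta) + eps)) <= e / 3.
  have -> : e / 3 = D * (eps + eps) by rewrite /eps; field; rewrite gt_eqF.
  rewrite mulrA; apply: (@le_trans _ _ (D * (m `^ (- eta) + eps))).
    apply: ler_wpM2r; first by rewrite addr_ge0 ?powR_ge0 // ltW.
    by rewrite /D (le_trans (ler_norm _)) // lerDl.
  by apply: ler_wpM2l; [exact: ltW|rewrite lerD2r].
by move: h1 h2; lra.
Qed.

Let sqrE : (\int[mu]_x (x ^+ 2)%:E = \int[mu]_x (`|x| ^+ 2)%:E)%E.
Proof. by apply: eq_integral => x _; rewrite real_normK // num_real. Qed.

Let trunc_sqr_le (T : R) : 0 < T ->
  (\int[mu]_x (trunc_pow T 2 x)%:E <= \int[mu]_x (x ^+ 2)%:E)%E.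
Proof.
move=> T0; rewrite sqrE; apply: ge0_le_integral => //.
- by move=> x _; rewrite lee_fin; apply: trunc_pow_ge0; exact: ltW.
- by apply/measurable_EFinP; exact: measurable_trunc_pow.
- by apply/measurable_EFinP; apply: measurable_funX; exact: normr_measurable.
move=> x _; rewrite lee_fin lerXn2r ?nnegrE //.
  by rewrite le_min normr_ge0 ltW.
by rewrite ge_min lexx.
Qed.

Lemma second_moment : (\int[mu]_x (x ^+ 2)%:E = kernel_mean tau sigma)%E.
Proof.
have [mean [meanE mean1]] := kernel_mean_ge1 (G 2) d0 tau2 sigma0 sigma1.
have [eta [eta0 eta1 etat etas]] := exists_moment_gain tau2 sigma0 sigma1.
rewrite meanE; apply/eqP; rewrite eq_le; apply/andP; split.
  rewrite sqrE; apply: integral_norm_pow_le => T T0.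
  apply/lee_addgt0Pr => e e0.
  have [N1 hN1] := sum_edge_decay_small d0 alpha0 alphad eta0 ltr01.
  have [N2 hN2] := expectation_trunc_close hmu 2 T0 e0.
  have [c1 _] := hN1 (maxn N1 N2) (leq_maxl _ _).
  have [_ close] := hN2 (maxn N1 N2) (leq_maxr _ _).
  apply: (le_trans close); apply: leeD2r.
  exact: (expectation_trunc_sqr_le (G (maxn N1 N2).+1) tau2 alpha0 c1 meanE (ltW T0)).
apply/lee_addgt0Pr => e e0.
set K := kernel_moment_bound tau sigma eta.
pose D := `|K| + 1.
have D0 : 0 < D by rewrite ltr_wpDl.
have KD : K <= D by rewrite /D (le_trans (ler_norm _)) // lerDl.
(* [eps] and [m] come before [T], since the trace constant [C] depends on [m]. The errors are e/4
   for the weak limit, e/4 for the trace term, and 4 (e/36 + e/36) + e/36 = e/4 for the rest. *)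
pose eps := e / (36 * D).
have eps0 : 0 < eps by rewrite divr_gt0 // mulr_gt0.
have [m [m1 meps]] := exists_cutoff eta0 eps0.
set M := 1 + (m `^ s) ^+ 2.
pose C : R := ((1 + 4) ^ 4)%:R * M ^+ 5.
have M0 : 0 <= M by rewrite addr_ge0 // sqr_ge0.
have C0 : 0 <= C by apply: mulr_ge0; rewrite ?ler0n ?exprn_ge0.
(* Chosen so that 16 C <= (e/4) T, with T >= 1 to pass from T to T^2. *)
pose T : R := 1 + 64 * C / e.
have T1 : 1 <= T by rewrite lerDl divr_ge0 ?mulr_ge0 // ltW.
have T0 : 0 < T by exact: lt_le_trans T1.
have [N1 hN1] := sum_edge_decay_small d0 alpha0 alphad eta0 eps0.
have e40 : 0 < e / 4 by rewrite divr_gt0.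
have [N2 hN2] := expectation_trunc_close hmu 2 T0 e40.
have [c1 dec] := hN1 (maxn N1 N2) (leq_maxl _ _).
have [close _] := hN2 (maxn N1 N2) (leq_maxr _ _).
have [I IE] := integral_trunc_pow_fin mu 2 T0.
rewrite IE -EFinD in close.
have := expectation_trunc_sqr_ge tau2 sigma0 alpha0 c1 eta0 eta1 etat etas dec
  meanE m1 T0 (integral_cut_pow_cut_le sigma tau2 2 m1) close.
rewrite -/K -/M -/C => bnd.
apply: (@le_trans _ _ (I%:E + e%:E)%E); last first.
  by apply: leeD2r; rewrite -IE; exact: trunc_sqr_le.
rewrite -EFinD lee_fin; apply: (le_trans bnd).
have h1 : 16 / T ^+ 2 * C <= e / 4.
  rewrite mulrAC ler_pdivrMr ?exprn_gt0 //.
  have TT : T <= T ^+ 2 by rewrite expr2 ler_peMl // ltW.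
  apply: (@le_trans _ _ (e / 4 * T)); last by rewrite ler_wpM2l // ltW.
  have -> : e / 4 * T = e / 4 + 16 * C by rewrite /T; field; rewrite gt_eqF.
  by rewrite lerDr ltW.
have De : D * eps = e / 36 by rewrite /eps; field; rewrite gt_eqF.
have h2 : K * eps <= e / 36 by rewrite -De; apply: ler_wpM2r => //; exact: ltW.
have h3 : K * (m `^ (- eta) + eps) <= e / 36 + e / 36.
  apply: (@le_trans _ _ (D * (m `^ (- eta) + eps))).
    by apply: ler_wpM2r => //; rewrite addr_ge0 ?powR_ge0 // ltW.
  by rewrite -De -mulrDr; apply: ler_wpM2l; [exact: ltW|rewrite lerD2r].
by move: h1 h2 h3 (e0); lra.
Qed.

End Moments.

Theorem theorem2p3 (R : realType) (d : nat) (tau alpha sigma : R)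
  (hd : (1 <= d)%N) (htau : 2 < tau)
  (halpha0 : 0 < alpha) (halphad : alpha < d%:R)
  (hsigma0 : 0 < sigma) (hsigma1 : sigma < tau - 1)
  (G : forall N : nat, kernel_graph d N tau alpha sigma)
  (mu : probability (measurableTypeR R) R)
  (hmu : limiting_spectral_distribution G mu) :
  let I := (((tau - 1) ^+ 2)%:E *
    \int[lebesgue_measure]_(x in `[1%R, +oo[)
      \int[lebesgue_measure]_(y in `[1%R, +oo[)
        (((Num.min x y) `^ (tau - sigma) *
          (Num.max x y) `^ (tau - 1))^-1)%:E)%E in
  [/\ (\int[mu]_x (x ^+ 2)%:E)%E = I,
      (0 < I < +oo)%E &
      forall p : nat, p%:R < (tau - 1) / Num.max sigma 1 ->
        (\int[mu]_x (`|x| ^+ (2 * p))%:E < +oo)%E].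
Proof.
move=> I; have [mean [meanE mean1]] := kernel_mean_ge1 (G 2) hd htau hsigma0 hsigma1.
split.
- exact: (second_moment hd htau halpha0 halphad hsigma0 hsigma1 hmu).
- rewrite (_ : I = mean%:E) // ltry andbT lte_fin.
  exact: lt_le_trans mean1.
move=> p hp; rewrite mul2n; apply: le_lt_trans (ltry _).
apply: (moment_le hd htau halpha0 halphad hsigma0 hsigma1 hmu).
by rewrite mulrC -ltr_pdivlMr // lt_max ltr01 orbT.
Qed.
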